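(* Let $p_k^*$ and $d_k^*$ denote the infimum of $(P_k)$ and the supremum of $(D_k)$, respectively (all problems are defined in the context). Then $\{p_k^*\}_{k=1}^\infty$ and $\{d_k^*\}_{k=1}^\infty$ converge monotonically from below to the optimal value of $(P)$ and $(D)$.
   Context: **Hybrid system.** A controlled hybrid system consists of: a finite set $\mathcal I$ of modes; edges $\mathcal E\subset\mathcal I\times\mathcal I$; compact domains $X_i\subset\mathbb R^{n_i}$; $\mathcal D=\coprod_iX_i$; a compact control set $U\subset\mathbb R^m$; vector fields $F_i:\mathbb R\times X_i\times U\to\mathbb R^{n_i}$; guards $S_{(i,i')}\subset\partial X_i$, compact of co-dimension 1; reset maps $R_{(i,i')}:S_{(i,i')}\to X_{i'}$. Also given: $T>0$, compact targets $X_{T_i}\subset X_i$, an initial point $(x_0,j)\in\mathcal D$, and costs $h_i(t,x,u)$, $H_i(x)$. **Standing assumptions.** $S_e\cap S_{e'}=\emptyset$ for distinct $e,e'$; $S_e\cap R_{e'}(S_{e'})=\emptyset$ for all $e,e'$; $F_i$ has nonzero normal component on $\partial X_i$; no Zeno executions (trajectories flowing along $F_i$ in mode $i$ and reset by $R_{(i,i')}$ on reaching $S_{(i,i')}$ never make infinitely many transitions in finite time); $X_{T_i}\cap S_{(i,i')}=\emptyset$; the initial point lies in no guard. The functions $F_i$ (componentwise), $h_i$, $H_i$ are polynomials, and reset maps are polynomial. The sets are semialgebraic: $X_i=\{x: h_{X_{i_l}}(x)\ge0,\ l\le n_{X_i}\}$, $X_{T_i}=\{x:h_{T_{i_l}}(x)\ge0,\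 l\le n_{T_i}\}$, $U=\{u:h_{U_l}(u)\ge0,\ l\le n_U\}$, $S_e=\{x\in\partial X_i:h_{e_l}(x)\ge0,\ l\le n_e\}$ for $e=(i,i')$, with polynomial data; Putinar's condition is ensured by including the redundant constraint $M-\|x\|_2^2\ge0$ for large $M$. **Problems $(P)$ and $(D)$.** $(\mathcal L_iv)(t,x,u)=\partial_tv+\nabla_xv\cdot F_i(t,x,u)$; $\tilde R_e(t,x)=(t,R_e(x))$; $\mu_0^i=\delta_{x_0}$ if $i=j$, else $0$; $\mathcal M_+$ denotes nonnegative Radon measures, $\langle\mu,v\rangle=\int v\,d\mu$. $(P)$: minimize $\sum_i\langle\mu^i,h_i\rangle+\sum_i\langle\mu_T^i,H_i\rangle$ over $\mu^i\in\mathcal M_+([0,T]\times X_i\times U)$, $\mu_T^i\in\mathcal M_+(X_{T_i})$, $\mu^{S_e}\in\mathcal M_+([0,T]\times S_e)$ subject to, for all $i$ and all $v\in C^1([0,T]\times X_i)$, $$\langle\mu_0^i,v(0,\cdot)\rangle+\langle\mu^i,\mathcal L_iv\rangle+\sum_{(i',i)\in\mathcal E}\langle\mu^{S_{(i',i)}},v\circ\tilde R_{(i',i)}\rangle=\langle\mu_T^i,v(T,\cdot)\rangle+\sum_{(i,i')\in\mathcal E}\langle\mu^{S_{(i,i')}},v\rangle.\quad(\ast)$$ $(D)$: maximize $\sum_i\langle\mu_0^i,v_i(0,\cdot)\rangle$ over $v_i\in C^1([0,T]\times X_i)$ subject to $\mathcal L_iv_i+h_i\ge0$ on $[0,T]\times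 X_i\times U$; $v_i(T,\cdot)\le H_i$ on $X_{T_i}$; $v_i(t,x)\le v_{i'}(t,R_{(i,i')}(x))$ for $(i,i')\in\mathcal E$, $(t,x)\in[0,T]\times S_{(i,i')}$. **Moment notation.** For $y=(y_\alpha)$ and $p=\sum_\alpha p_\alpha z^\alpha$, $L_y(p)=\sum_\alpha p_\alpha y_\alpha$. Moment matrix: $[M_k(y)]_{\alpha\beta}=y_{\alpha+\beta}$ ($|\alpha|,|\beta|\le k$); localizing matrix: $[M_k(h,y)]_{\alpha\beta}=\sum_\gamma h_\gamma y_{\gamma+\alpha+\beta}$. **Problem $(P_k)$.** Variables are sequences of moments truncated to degree $2k$: $y_{k,\mu^i}$ (variables $(t,x,u)$), $y_{k,\mu_T^i}$ (variable $x$), $y_{k,\mu^{S_e}}$ (variables $(t,x)$). Minimize $\sum_iL_{y_{k,\mu^i}}(h_i)+\sum_iL_{y_{k,\mu_T^i}}(H_i)$ subject to: - the finite linear system $A_k(\mathbf y_k)=b_k$ obtained from $(\ast)$ by taking polynomial test functions $v$ with all polynomials involved of degree at most $2k$ and replacing integrals against unknown measures by the functionals $L_y$; - $M_k(y_{k,\xi})\succeq0$ for every unknown measure $\xi$; - $M_{k-\lceil\deg h/2\rceil}(h,y)\succeq0$ for: $h=h_{X_{i_l}}$ and $h=h_{U_l}$ with $y=y_{k,\mu^i}$; $h=h_{e_l}$ with $y=y_{k,\mu^{S_e}}$; $h=h_{T_{i_l}}$ with $y=y_{k,\mu_T^i}$; - $M_{k-1}(h_\tau,y)\succeq0$ with $h_\tau=t(T-t)$,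 for $y=y_{k,\mu^i}$ and $y=y_{k,\mu^{S_e}}$. **Problem $(D_k)$.** $Q_{2k}(g_1,\dots,g_r)$ is the set of polynomials of degree at most $2k$ of the form $s_0+\sum_ls_lg_l$ with $s_l$ sums of squares of polynomials, $\deg s_0\le2k$, $\deg(s_lg_l)\le2k$. Maximize $\sum_i\langle\mu_0^i,v_i(0,\cdot)\rangle$ over $v_i\in\mathbb R_{2k}[t,x]$ (polynomials of degree at most $2k$) subject to $\mathcal L_iv_i+h_i\in Q_{2k}(h_\tau,h_{X_{i_1}},\dots,h_{X_{i_{n_{X_i}}}},h_{U_1},\dots,h_{U_{n_U}})$; $-v_i(T,\cdot)+H_i\in Q_{2k}(h_{T_{i_1}},\dots,h_{T_{i_{n_{T_i}}}})$; and $v_{i'}\circ\tilde R_{(i,i')}-v_i\in Q_{2k}(h_\tau,h_{(i,i')_1},\dots,h_{(i,i')_{n_{(i,i')}}})$ for $(i,i')\in\mathcal E$.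
   Formalization: Added assumption: for each edge e=(i,i') the inequalities h_{e_l}(x)≥0 alone already force x∈∂X_i, so they describe S_e completely; (P_k) and (D_k) see guards only through the h_{e_l}, and without this the convergence can fail. *)

(* Defs.v *)
From HB Require Import structures.
From mathcomp Require Import all_boot all_order all_algebra.
From mathcomp Require Import all_classical all_reals all_analysis.
(* The notations of mpoly clash with those of MathComp-Analysis. *)
From mathcomp Require Import -(notations) mpoly.
Import numFieldNormedType.Exports.
Set Implicit Arguments.
Unset Strict Implicit.
Unset Printing Implicit Defensive.
Import Order.TTheory GRing.Theory Num.Theory.
Local Open Scope classical_set_scope.
Local Open Scope ring_scope.

Section Polynomials.
Context {R : realType}.

Definition peval n (p : mpoly n R) (z : 'rV[R]_n) : R :=
  meval (fun a => z ord0 a) p.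

(* Total degree; the zero polynomial gets degree 0. *)
Definition pdeg n (p : mpoly n R) : nat := (mmeasure (@mdeg n) p).-1.

Definition pvar n (a : 'I_n) : mpoly n R := mpolyX R (mnm1 a).

Definition psubst n n' (s : 'I_n -> mpoly n' R) (p : mpoly n R) : mpoly n' R :=
  comp_mpoly [tuple s a | a < n] p.

Definition nonneg_set n (gs : seq (mpoly n R)) : set 'rV[R]_n :=
  [set z | forall g, g \in gs -> 0 <= peval g z].

(* M - |x|_2^2 *)
Definition ball_poly n (M : R) : mpoly n R :=
  mpolyC n M - \sum_(a < n) pvar a ^+ 2.

Definition sos n (p : mpoly n R) : Prop :=
  exists qs : seq (mpoly n R), p = \sum_(q <- qs) q ^+ 2.

(* The truncated quadratic module Q_d(g_1, ..., g_r) (used with d = 2k). *)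
Definition quad_module n (d : nat) (gs : seq (mpoly n R)) (p : mpoly n R) :
    Prop :=
  (pdeg p <= d)%N /\
  exists (s0 : mpoly n R) (s : 'I_(size gs) -> mpoly n R),
    [/\ sos s0 /\ (pdeg s0 <= d)%N,
        forall l, sos (s l) /\ (pdeg (s l * gs`_l)%R <= d)%N &
        p = s0 + \sum_l s l * gs`_l].

End Polynomials.

Section Moments.
Context {R : realType}.

(* A moment sequence is represented by a total function of the exponent.
   Only the entries of degree at most 2k are constrained in (P_k), so this is
   the sequence truncated to degree 2k as soon as 2k bounds the degrees of the
   costs; for smaller k it makes the objective of (P_k) meaningful. *)
Definition moment_seq n := multinom n -> R.

Definition riesz n (y : moment_seq n) (p : mpoly n R) : R :=
  \sum_(a <- msupp p) mcoeff a p * y a.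

Definition moment_matrix n (k : nat) (y : moment_seq n) :
    'M[R]_#|{: bmultinom n k.+1}| :=
  \matrix_(a, b) y (mnm_add (bmnm (enum_val a)) (bmnm (enum_val b))).

Definition localizing_matrix n (k : nat) (h : mpoly n R) (y : moment_seq n) :
    'M[R]_#|{: bmultinom n k.+1}| :=
  \matrix_(a, b) \sum_(c <- msupp h)
    mcoeff c h * y (mnm_add c (mnm_add (bmnm (enum_val a)) (bmnm (enum_val b)))).

Definition psd n (A : 'M[R]_n) : Prop :=
  A^T = A /\ forall c : 'rV[R]_n, 0 <= (c *m A *m c^T) ord0 ord0.

(* M_{k - ceil(deg h / 2)}(h, y) is positive semidefinite; there is no
   condition when the order is negative. *)
Definition localizing_psd n (k : nat) (h : mpoly n R) (y : moment_seq n) :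
    Prop :=
  (uphalf (pdeg h) <= k)%N ->
  psd (localizing_matrix (k - uphalf (pdeg h)) h y).

End Moments.

Section Geometry.
Context {R : realType}.

Definition boundary n (A : set 'rV[R]_n) : set 'rV[R]_n :=
  closure A `\` interior A.

(* Bouligand's contingent cone: the tangent space of A at x when A is a
   C^1 submanifold near x. *)
Definition contingent_cone n (A : set 'rV[R]_n) (x : 'rV[R]_n) :
    set 'rV[R]_n :=
  [set w | exists (y : nat -> 'rV[R]_n) (s : nat -> R),
    [/\ forall k, A (y k), forall k, 0 < s k, s @ \oo --> (0 : R),
        y @ \oo --> x & (fun k => (s k)^-1 *: (y k - x)) @ \oo --> w]].

(* At a corner of A only 0 is normal. *)
Definition normal_vector n (A : set 'rV[R]_n) (x nu : 'rV[R]_n) : Prop :=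
  forall w, contingent_cone A x w -> \sum_l nu ord0 l * w ord0 l = 0.

Definition contains_cube n (d : nat) (A : set 'rV[R]_n) : Prop :=
  let cube := [set c : 'rV[R]_d | forall a, 0 <= c ord0 a <= 1] in
  exists f : 'rV[R]_d -> 'rV[R]_n,
    [/\ {within cube, continuous f},
        forall b c, cube b -> cube c -> f b = f c -> b = c &
        f @` cube `<=` A].

(* The dimension of a semialgebraic set is the largest d for which it contains
   a homeomorphic copy of a d-dimensional cube. *)
Definition codim1 n (A : set 'rV[R]_n) : Prop :=
  exists d, [/\ d.+1 = n, contains_cube d A & ~ contains_cube d.+1 A].

(* C^1([0,T] x X) is encoded by its elements' C^1 extensions to R x R^n. *)
Definition C1 n (v : 'rV[R]_n -> R) : Prop :=
  (forall z, differentiable v z) /\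
  forall a : 'I_n, continuous (fun z => 'D_(delta_mx ord0 a) v z).

End Geometry.

Notation borel R n := (g_sigma_algebraType (@open 'rV[R]_n)).

(* A nonnegative Radon measure on a compact K in R^n is a finite Borel measure
   of R^n concentrated on K (regularity is automatic). *)
Definition concentrated (R : realType) n
    (mu : {finite_measure set (borel R n) -> \bar R}) (K : set 'rV[R]_n) :
    Prop :=
  mu (~` K) = 0%E.

Definition pairing (R : realType) n
    (mu : {measure set (borel R n) -> \bar R}) (f : 'rV[R]_n -> R) : R :=
  \int[mu]_z f z.

(* Points (t,x,u) are rows of length 1 + dim i + cdim, points (t,x) rows of
   length 1 + dim i.  [reset i i'] and [hS i i'] are meaningful only when
   (i, i') is an edge. *)
Record hybrid_system (R : realType) := HybridSystem {
  mode : finType;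
  edge : rel mode;
  dim : mode -> nat;
  cdim : nat;
  vfield : forall i, 'I_(dim i) -> mpoly (1 + dim i + cdim) R;
  reset : forall i i', 'I_(dim i') -> mpoly (dim i) R;
  hX : forall i, seq (mpoly (dim i) R);
  hT : forall i, seq (mpoly (dim i) R);
  hU : seq (mpoly cdim R);
  hS : forall i i' : mode, seq (mpoly (dim i) R);
  horizon : R;
  init : {i : mode & 'rV[R]_(dim i)};
  run_cost : forall i, mpoly (1 + dim i + cdim) R;
  end_cost : forall i, mpoly (dim i) R
}.

Section HybridSystem.
Context {R : realType} (S : hybrid_system R).
Implicit Types i : mode S.
Local Notation n := (@dim R S).
Local Notation m := (cdim S).
Local Notation T := (horizon S).

Definition dom i : set 'rV[R]_(n i) := nonneg_set (hX i).
Definition target i : set 'rV[R]_(n i) := nonneg_set (hT i).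
Arguments dom : clear implicits.
Arguments target : clear implicits.
Definition control : set 'rV[R]_m := nonneg_set (hU S).
Definition guard i i' : set 'rV[R]_(n i) :=
  boundary (dom i) `&` nonneg_set (hS i i').
Arguments guard : clear implicits.

Definition tx k (t : R) (x : 'rV[R]_k) : 'rV[R]_(1 + k) :=
  row_mx (const_mx t) x.

Definition txu i (t : R) (x : 'rV[R]_(n i)) (u : 'rV[R]_m) :
    'rV[R]_(1 + n i + m) :=
  row_mx (tx t x) u.

Definition vfield_at i (z : 'rV[R]_(1 + n i + m)) : 'rV[R]_(n i) :=
  \row_l peval (vfield l) z.

Definition reset_map i i' (x : 'rV[R]_(n i)) : 'rV[R]_(n i') :=
  \row_l peval (reset i l) x.

Definition reset_map_t i i' (z : 'rV[R]_(1 + n i)) : 'rV[R]_(1 + n i') :=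
  row_mx (lsubmx z) (reset_map i' (rsubmx z)).

(* Caratheodory solution of x' = F_i(t, x, u) staying in X_i during [a, b]. *)
Definition flows i (u : R -> 'rV[R]_m) (a b : R) (x : R -> 'rV[R]_(n i)) :
    Prop :=
  [/\ {within `[a, b], continuous x},
      forall t, a <= t <= b -> dom i (x t) &
      forall t l, a <= t <= b ->
        x t ord0 l = x a ord0 l +
          \int[lebesgue_measure]_(s in `[a, t])
             vfield_at (txu s (x s) (u s)) ord0 l].

(* An execution with infinitely many transitions: the k-th arc lives in mode
   [q k] on [tau k, tau k.+1] and is reset as soon as it reaches a guard. *)
Definition infinite_execution (u : R -> 'rV[R]_m) (tau : nat -> R)
    (q : nat -> mode S) (x : forall k, R -> 'rV[R]_(n (q k))) : Prop :=
  [/\ (forall l, measurable_fun setT (fun t => u t ord0 l)) /\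
        (forall t, control (u t)),
      forall k, tau k <= tau k.+1 /\ edge (q k) (q k.+1),
      forall k, flows u (tau k) (tau k.+1) (x k),
      forall k t i', tau k <= t < tau k.+1 -> edge (q k) i' ->
        ~ guard (q k) i' (x k t) &
      forall k, guard (q k) (q k.+1) (x k (tau k.+1)) /\
        x k.+1 (tau k.+1) = reset_map (q k.+1) (x k (tau k.+1))].

Definition no_zeno : Prop :=
  forall u tau q x, @infinite_execution u tau q x ->
    forall B : R, exists k, B < tau k.

Record standing_assumptions : Prop := StandingAssumptions {
  horizon_gt0 : 0 < T;
  dom_compact : forall i, compact (dom i);
  target_compact : forall i, compact (target i);
  target_sub_dom : forall i, target i `<=` dom i;
  control_compact : compact control;
  guard_compact : forall i i', edge i i' -> compact (guard i i');
  guard_codim1 : forall i i', edge i i' -> codim1 (guard i i');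
  reset_in_dom : forall i i', edge i i' ->
    reset_map i' @` guard i i' `<=` dom i';
  init_in_dom : dom (tag (init S)) (tagged (init S));
  guards_disjoint : forall i i' i'', edge i i' -> edge i i'' -> i' != i'' ->
    guard i i' `&` guard i i'' = set0;
  guard_reset_disjoint : forall i0 i i', edge i0 i -> edge i i' ->
    guard i i' `&` reset_map i @` guard i0 i = set0;
  normal_component_neq0 : forall i t x u nu, 0 <= t <= T ->
    boundary (dom i) x -> control u ->
    nu != 0 -> normal_vector (boundary (dom i)) x nu ->
    \sum_l nu ord0 l * vfield_at (txu t x u) ord0 l != 0;
  no_zeno_execution : no_zeno;
  target_guard_disjoint : forall i i', edge i i' ->
    target i `&` guard i i' = set0;
  init_notin_guard : forall i', edge (tag (init S)) i' ->
    ~ guard (tag (init S)) i' (tagged (init S));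
  putinar_dom : forall i, exists M, ball_poly (n i) M \in hX i;
  putinar_target : forall i, exists M, ball_poly (n i) M \in hT i;
  putinar_control : exists M, ball_poly m M \in hU S;
  putinar_guard : forall i i', edge i i' ->
    exists M, ball_poly (n i) M \in hS i i';
  (* The inequalities listed for a guard describe it completely, i.e. they
     already imply membership in the boundary: (P_k) and (D_k) see the guard
     only through them. *)
  guard_description : forall i i', edge i i' ->
    nonneg_set (hS i i') `<=` boundary (dom i)
}.

Definition occ_set i : set 'rV[R]_(1 + n i + m) :=
  [set z | [/\ 0 <= lsubmx (lsubmx z) ord0 ord0 <= T,
               dom i (rsubmx (lsubmx z)) & control (rsubmx z)]].

Arguments occ_set : clear implicits.

Definition guard_set i i' : set 'rV[R]_(1 + n i) :=
  [set z | 0 <= lsubmx z ord0 ord0 <= T /\ guard i i' (rsubmx z)].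
Arguments guard_set : clear implicits.

Definition mu0 i : {measure set (borel R (n i)) -> \bar R} :=
  untag (mzero : {measure set (borel R (n i)) -> \bar R})
    (fun x : 'rV[R]_(n i) => (dirac (x : borel R (n i)) :
       {measure set (borel R (n i)) -> \bar R})) (init S).

Definition lie i (v : 'rV[R]_(1 + n i) -> R) (z : 'rV[R]_(1 + n i + m)) : R :=
  'D_(delta_mx ord0 (lshift (n i) ord0)) v (lsubmx z) +
  \sum_(l < n i)
    'D_(delta_mx ord0 (rshift 1 l)) v (lsubmx z) * peval (vfield l) z.

Record measures := Measures {
  occ : forall i, {finite_measure set (borel R (1 + n i + m)) -> \bar R};
  ter : forall i, {finite_measure set (borel R (n i)) -> \bar R};
  grd : forall i i' : mode S,
    {finite_measure set (borel R (1 + n i)) -> \bar R}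
}.

Definition P_feasible (mu : measures) : Prop :=
  [/\ forall i, concentrated (occ mu i) (occ_set i),
      forall i, concentrated (ter mu i) (target i),
      forall i i', edge i i' ->
        concentrated (grd mu i i') (guard_set i i') &
      forall i (v : 'rV[R]_(1 + n i) -> R), C1 v ->
        pairing (mu0 i) (fun x => v (tx 0 x)) + pairing (occ mu i) (lie v)
        + \sum_(i' | edge i' i) pairing (grd mu i' i) (v \o @reset_map_t i' i)
        = pairing (ter mu i) (fun x => v (tx T x))
          + \sum_(i' | edge i i') pairing (grd mu i i') v].

Definition P_cost (mu : measures) : R :=
  \sum_i pairing (occ mu i) (peval (run_cost i)) +
  \sum_i pairing (ter mu i) (peval (end_cost i)).

Definition P_value : \bar R :=
  ereal_inf [set (P_cost mu)%:E | mu in P_feasible].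

Definition D_feasible (v : forall i, 'rV[R]_(1 + n i) -> R) : Prop :=
  [/\ forall i, C1 (v i),
      forall i z, occ_set i z -> 0 <= lie (v i) z + peval (run_cost i) z,
      forall i x, target i x -> v i (tx T x) <= peval (end_cost i) x &
      forall i i' z, edge i i' -> guard_set i i' z ->
        v i z <= v i' (reset_map_t i' z)].

Definition D_objective (v : forall i, 'rV[R]_(1 + n i) -> R) : R :=
  \sum_i pairing (mu0 i) (fun x => v i (tx 0 x)).

Definition D_value : \bar R :=
  ereal_sup [set (D_objective v)%:E | v in D_feasible].

Definition tx_to_txu i (p : mpoly (1 + n i) R) : mpoly (1 + n i + m) R :=
  psubst (fun a => pvar (lshift m a)) p.

Definition x_to_tx i (p : mpoly (n i) R) : mpoly (1 + n i) R :=
  psubst (fun l => pvar (rshift 1 l)) p.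

Definition u_to_txu i (p : mpoly m R) : mpoly (1 + n i + m) R :=
  psubst (fun l => pvar (rshift (1 + n i) l)) p.

Definition plie i (v : mpoly (1 + n i) R) : mpoly (1 + n i + m) R :=
  tx_to_txu (mderiv (lshift (n i) ord0) v) +
  \sum_(l < n i) tx_to_txu (mderiv (rshift 1 l) v) * vfield l.

(* v(T, .) *)
Definition pfinal i (v : mpoly (1 + n i) R) : mpoly (n i) R :=
  psubst (fun a : 'I_(1 + n i) =>
    match fintype.split a with inl _ => mpolyC (n i) T | inr l => pvar l end) v.

(* v o R~_(i,i') *)
Definition preset i i' (v : mpoly (1 + n i') R) : mpoly (1 + n i) R :=
  psubst (fun a : 'I_(1 + n i') =>
    match fintype.split a with
    | inl _ => pvar (lshift (n i) ord0)
    | inr l => x_to_tx (reset i l)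
    end) v.

(* h_tau = t (T - t), where t is the a-th variable *)
Definition htau k (a : 'I_k) : mpoly k R := pvar a * (mpolyC k T - pvar a).

Definition htau_txu i : mpoly (1 + n i + m) R :=
  htau (lshift m (lshift (n i) ord0)).
Definition htau_tx i : mpoly (1 + n i) R := htau (lshift (n i) ord0).

Record moments := Moments {
  occ_y : forall i, moment_seq (R := R) (1 + n i + m);
  ter_y : forall i, moment_seq (R := R) (n i);
  grd_y : forall i i' : mode S, moment_seq (R := R) (1 + n i)
}.
Arguments occ_y : clear implicits.
Arguments ter_y : clear implicits.
Arguments grd_y : clear implicits.

Definition Pk_linear (k : nat) (y : moments) : Prop :=
  forall i (v : mpoly (1 + n i) R),
    (pdeg v <= 2 * k)%N -> (pdeg (plie v) <= 2 * k)%N ->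
    (forall i', edge i' i -> (pdeg (preset i' v) <= 2 * k)%N) ->
    pairing (mu0 i) (fun x => peval v (tx 0 x)) + riesz (occ_y y i) (plie v)
    + \sum_(i' | edge i' i) riesz (grd_y y i' i) (preset i' v)
    = riesz (ter_y y i) (pfinal v)
      + \sum_(i' | edge i i') riesz (grd_y y i i') v.

Definition Pk_feasible (k : nat) (y : moments) : Prop :=
  [/\ Pk_linear k y,
      forall i,
        [/\ psd (moment_matrix k (occ_y y i)),
            psd (localizing_matrix k.-1 (htau_txu i) (occ_y y i)),
            forall g, g \in hX i ->
              localizing_psd k (tx_to_txu (x_to_tx g)) (occ_y y i) &
            forall g, g \in hU S ->
              localizing_psd k (u_to_txu i g) (occ_y y i)],
      forall i,
        psd (moment_matrix k (ter_y y i)) /\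
        (forall g, g \in hT i -> localizing_psd k g (ter_y y i)) &
      forall i i', edge i i' ->
        [/\ psd (moment_matrix k (grd_y y i i')),
            psd (localizing_matrix k.-1 (htau_tx i) (grd_y y i i')) &
            forall g, g \in hS i i' ->
              localizing_psd k (x_to_tx g) (grd_y y i i')]].

Definition Pk_cost (y : moments) : R :=
  \sum_i riesz (occ_y y i) (run_cost i) +
  \sum_i riesz (ter_y y i) (end_cost i).

Definition Pk_value (k : nat) : \bar R :=
  ereal_inf [set (Pk_cost y)%:E | y in Pk_feasible k].

Definition Dk_feasible (k : nat) (v : forall i, mpoly (1 + n i) R) : Prop :=
  [/\ forall i, (pdeg (v i) <= 2 * k)%N,
      forall i, quad_module (2 * k)
        (htau_txu i :: [seq tx_to_txu (x_to_tx g) | g <- hX i]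
                    ++ [seq u_to_txu i g | g <- hU S])
        (plie (v i) + run_cost i),
      forall i, quad_module (2 * k) (hT i) (end_cost i - pfinal (v i)) &
      forall i i', edge i i' -> quad_module (2 * k)
        (htau_tx i :: [seq x_to_tx g | g <- hS i i'])
        (preset i (v i') - v i)].

Definition Dk_value (k : nat) : \bar R :=
  ereal_sup [set (D_objective (fun i => peval (v i)))%:E
            | v in Dk_feasible k].

End HybridSystem.

(* Main.v *)
(* Both hierarchies are nondecreasing; weak duality gives D_k <= D <= P, and the
   moments of a feasible point of (P) are feasible for (P_k), so P_k <= P.  It
   remains to reach every real c < P with both hierarchies, for which it
   suffices to find polynomials v_i satisfying the constraints of (D) strictly,
   with objective above c.  If there are none, separating the cone of polynomial
   dual data from the positive functions yields a positive functional, that is,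
   finite measures on the domains of the constraints together with a mass on the
   objective.  This mass is positive because guards and reset images are
   disjoint: polynomials separating them give a direction along which all
   constraints of (D) increase strictly.  Normalised by this mass, the measures
   satisfy the constraint of (P) for polynomial test functions, hence for all C^1
   ones, and cost at most c, a contradiction.  Finally Putinar's
   Positivstellensatz turns the strict inequalities for v into certificates of
   some degree: they make v feasible for (D_k), and evaluated on pseudo-moments
   they bound (P_k) from below by the objective of v.

   The measure representing a positive functional on a compact set K is built
   from a right inverse psi : K -> [0, 1] of a continuous curve whose range
   contains K: the values of the functional on the indicators of [psi <= s] give
   a distribution function, whose Lebesgue-Stieltjes measure is pushed forward
   along the curve. *)
Require Import Defs.
From HB Require Import structures.
From mathcomp Require Import all_boot all_order all_algebra.
From mathcomp Require Import all_classical all_reals all_analysis.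
From mathcomp Require Import measurable_realfun.
From mathcomp Require Import -(notations) mpoly.
From mathcomp Require Import ssrcomplements.
From mathcomp Require Import ring lra zify.
Import Defs.
Import numFieldNormedType.Exports.
Set Implicit Arguments.
Unset Strict Implicit.
Unset Printing Implicit Defensive.
Import Order.TTheory GRing.Theory Num.Theory.
Local Open Scope classical_set_scope.
Local Open Scope ring_scope.

(** * Putinar's Positivstellensatz *)

(** One construction serves twice. A convex cone avoiding the opposite of an order unit e is
    enlarged by Zorn's lemma until it contains x or -x for every x; the infimum of the r such that r
    e - x lies in it is then linear in x. For a maximal quadratic module this form is moreover
    multiplicative, hence the evaluation at a point, which yields Putinar's theorem; for a cone of
    bounded functions it is the functional of the duality argument.

    This functional lives on all bounded functions, so its values on arbitrary indicators make
    sense; but it is only finitely additive there. Its distribution function may fail to be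
    right-continuous and is replaced by its right limits, which leaves the integrals of continuous
    functions unchanged.

    Working with strict inequalities and a total mass normalised to 1 replaces any closedness of the
    dual cone or weak compactness of sets of measures. The delicate point is that the objective
    could receive mass 0. The passage from polynomial to C^1 test functions needs an approximation
    of a function together with its first derivatives, which Bernstein polynomials provide. *)

Lemma zorn_above (T : Type) (P : set (set T)) (A0 : set T) :
  P A0 -> A0 !=set0 ->
  (forall F : set (set T), F !=set0 -> F `<=` P -> total_on F subset ->
     P (\bigcup_(X in F) X)) ->
  exists A, [/\ P A, A0 `<=` A & forall B, A `<=` B -> P B -> B `<=` A].
Proof.
move=> PA0 [a0 A0a0] chain.
(* [Zorn_bigcup] also treats the empty chain, whose union is [set0], so [set0] is adjoined to the
   family. It is not maximal because [A0] is nonempty. *)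
pose P' := [set X | X = set0 \/ (A0 `<=` X /\ P X)].
have [F FP' totF|A [PA maxA]] := @Zorn_bigcup T P'.
  have [[X FX A0X]|noX] := pselect (exists2 X, F X & A0 `<=` X); last first.
    left; rewrite -subset0 => x [X FX Xx].
    case: (FP' X FX) => [X0|[A0X _]]; first by rewrite X0 in Xx.
    by case: noX; exists X.
  pose F' := F `&` [set Y | A0 `<=` Y].
  have -> : \bigcup_(Y in F) Y = \bigcup_(Y in F') Y.
    apply/seteqP; split=> x [Y FY Yx]; exists Y => //; last by case: FY.
    split=> //; case: (FP' Y FY) => [Y0|[]//].
    by rewrite Y0 in Yx.
  right; split; first by move=> x A0x; exists X => //; apply: A0X.
  apply: chain; first by exists X.
    move=> Y [FY A0Y]; case: (FP' Y FY) => [Y0|[]//].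
    by exfalso; rewrite Y0 in A0Y; exact: (A0Y _ A0a0).
  by move=> Y Z [FY _] [FZ _]; exact: totF.
have A0A : A0 `<=` A /\ P A.
  case: PA => // A_0; exfalso; apply: (maxA A0); last by right; split.
  by rewrite A_0; split; [exact: sub0set|move=> /(_ _ A0a0)].
exists A; split; [by case: A0A|by case: A0A|].
move=> B AB PB; apply: contrapT => nBA; apply: (maxA B); first by split.
by right; split=> //; apply: subset_trans AB; case: A0A.
Qed.

(** * Linear forms defined by total cones *)

Section TotalCone.
Variables (R : realType) (V : lmodType R) (e : V) (M : set V).
Hypothesis MD : forall x y, M x -> M y -> M (x + y).
Hypothesis MZ : forall a x, 0 <= a -> M x -> M (a *: x).
Hypothesis Mtotal : forall x, M x \/ M (- x).
Hypothesis MNe : ~ M (- e).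

Definition order_bounded x := exists2 N, M (N *: e - x) & M (N *: e + x).

(** As [M] is total, this infimum is also the supremum of the r with [x - r *: e] in [M]. Bounding
    it from both sides gives linearity on the order bounded elements. *)
Definition cone_state x := locked (inf [set r | M (r *: e - x)]).

Let Mneg r : r < 0 -> ~ M (r *: e).
Proof.
move=> r0 Mre; apply: MNe.
have -> : - e = (- r)^-1 *: (r *: e).
  by rewrite scalerA invrN mulNr mulVf ?lt_eqF// scaleN1r.
by apply: MZ => //; rewrite invr_ge0 oppr_ge0 ltW.
Qed.

Let bounded_inf x : order_bounded x -> has_inf [set r | M (r *: e - x)].
Proof.
move=> [N MNx MNx']; split; first by exists N.
exists (- N) => r /= Mr; rewrite leNgt; apply/negP => rN.
apply: (@Mneg (r + N)); first lra.
have -> : (r + N) *: e = (r *: e - x) + (N *: e + x).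
  by rewrite scalerDl addrACA addNr addr0.
exact: MD.
Qed.

Lemma cone_state_le x r :
  order_bounded x -> M (r *: e - x) -> cone_state x <= r.
Proof. by move=> /bounded_inf[_ lbx] Mr; rewrite /cone_state -lock; exact: ge_inf. Qed.

Lemma cone_state_ge x r :
  order_bounded x -> M (x - r *: e) -> r <= cone_state x.
Proof.
move=> /bounded_inf[nex _] Mr; rewrite /cone_state -lock; apply: lb_le_inf => // s /= Ms.
rewrite leNgt; apply/negP => sr; apply: (@Mneg (s - r)); first lra.
have -> : (s - r) *: e = (s *: e - x) + (x - r *: e).
  by rewrite scalerBl addrA subrK.
exact: MD.
Qed.

Lemma cone_state_lt x r : cone_state x < r -> order_bounded x ->
  M (r *: e - x).
Proof.
move=> xr bx; have [//|] := Mtotal (r *: e - x).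
by rewrite opprB => /(cone_state_ge bx); rewrite leNgt xr.
Qed.

Lemma cone_state_gt x r : r < cone_state x -> order_bounded x ->
  M (x - r *: e).
Proof.
move=> xr bx; have [//|] := Mtotal (x - r *: e).
by rewrite opprB => /(cone_state_le bx); rewrite leNgt xr.
Qed.

Lemma order_boundedD x y :
  order_bounded x -> order_bounded y -> order_bounded (x + y).
Proof.
move=> [N Nx Nx'] [K Ky Ky']; exists (N + K).
  by rewrite scalerDl opprD addrACA; exact: MD.
by rewrite scalerDl addrACA; exact: MD.
Qed.

Lemma order_boundedN x : order_bounded x -> order_bounded (- x).
Proof. by move=> [N Nx Nx']; exists N; rewrite ?opprK. Qed.

Lemma order_boundedZ a x : order_bounded x -> order_bounded (a *: x).
Proof.
wlog a0 : a x / 0 <= a => [hw bx|[N Nx Nx']].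
  have [a0|a0] := leP 0 a; first exact: hw.
  rewrite -[a *: x]opprK -scaleNr; apply: order_boundedN.
  by apply: hw => //; rewrite oppr_ge0 ltW.
exists (a * N); first by rewrite -scalerA -scalerBr; exact: MZ.
by rewrite -scalerA -scalerDr; exact: MZ.
Qed.

Lemma cone_stateD x y : order_bounded x -> order_bounded y ->
  cone_state (x + y) = cone_state x + cone_state y.
Proof.
move=> bx bY; have bxy := order_boundedD bx bY.
apply/eqP; rewrite eq_le; apply/andP; split; apply/ler_addgt0Pr => eps eps0.
  apply: cone_state_le => //.
  have -> : (cone_state x + cone_state y + eps) *: e - (x + y) =
     ((cone_state x + eps / 2) *: e - x) + ((cone_state y + eps / 2) *: e - y).
    move: (cone_state x) (cone_state y) => a b.
    rewrite opprD [RHS]addrACA -scalerDl; congr (_ *: _ + _); lra.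
  by apply: MD; apply: cone_state_lt => //; lra.
rewrite -lerBlDr; apply: cone_state_ge => //.
have -> : x + y - (cone_state x + cone_state y - eps) *: e =
   (x - (cone_state x - eps / 2) *: e) + (y - (cone_state y - eps / 2) *: e).
  move: (cone_state x) (cone_state y) => a b.
  rewrite [RHS]addrACA -opprD -scalerDl; congr (_ - _ *: _); lra.
by apply: MD; apply: cone_state_gt => //; lra.
Qed.

Lemma cone_stateN x : order_bounded x -> cone_state (- x) = - cone_state x.
Proof.
move=> bx; have bNx := order_boundedN bx.
apply/eqP; rewrite eq_le; apply/andP; split; apply/ler_addgt0Pr => eps eps0.
  apply: cone_state_le => //; rewrite opprK.
  have -> : (- cone_state x + eps) *: e + x =
    x - (cone_state x - eps) *: e.
    move: (cone_state x) => a.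
    rewrite addrC -scaleNr; congr (_ + _ *: _); lra.
  by apply: cone_state_gt => //; lra.
rewrite -lerBlDr; apply: cone_state_ge => //.
have -> : - x - (- cone_state x - eps) *: e = (cone_state x + eps) *: e - x.
  move: (cone_state x) => a.
  rewrite addrC -scaleNr; congr (_ *: _ + _); lra.
by apply: cone_state_lt => //; lra.
Qed.

Lemma cone_state_ge0 x : order_bounded x -> M x -> 0 <= cone_state x.
Proof. by move=> bx Mx; apply: cone_state_ge => //; rewrite scale0r subr0. Qed.

Let M0 : M 0.
Proof. by case: (Mtotal 0) => //; rewrite oppr0. Qed.

Lemma order_bounded_unit a : order_bounded (a *: e).
Proof.
apply: order_boundedZ; exists 1; rewrite scale1r ?subrr//.
have [Me|//] := Mtotal e; exact: MD.
Qed.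

Lemma cone_state_unit a : cone_state (a *: e) = a.
Proof.
have b := order_bounded_unit a; apply/eqP; rewrite eq_le; apply/andP; split.
  by apply: cone_state_le => //; rewrite subrr.
by apply: cone_state_ge => //; rewrite subrr.
Qed.

Lemma cone_stateZ a x : order_bounded x ->
  cone_state (a *: x) = a * cone_state x.
Proof.
wlog a0 : a x / 0 <= a => [hw bx|bx].
  have [a0|a0] := leP 0 a; first exact: hw.
  rewrite -[a *: x]opprK -scaleNr cone_stateN; last exact: order_boundedZ.
  by rewrite hw// ?mulNr ?opprK// oppr_ge0 ltW.
have bax := order_boundedZ a bx.
have [->|an0] := eqVneq a 0.
  by rewrite mul0r scale0r -(scale0r e) cone_state_unit.
have {an0}a0 : 0 < a by rewrite lt_neqAle eq_sym an0.
apply/eqP; rewrite eq_le; apply/andP; split; apply/ler_addgt0Pr => eps eps0.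
  apply: cone_state_le => //.
  have -> : (a * cone_state x + eps) *: e - a *: x =
    a *: ((cone_state x + eps / a) *: e - x).
    rewrite scalerBr scalerA mulrDr mulrCA divff ?mulr1//; exact: lt0r_neq0.
  apply: MZ; first exact: ltW.
  by apply: cone_state_lt => //; rewrite ltrDl divr_gt0.
rewrite -lerBlDr; apply: cone_state_ge => //.
have -> : a *: x - (a * cone_state x - eps) *: e =
  a *: (x - (cone_state x - eps / a) *: e).
  rewrite scalerBr scalerA mulrBr mulrCA divff ?mulr1//; exact: lt0r_neq0.
apply: MZ; first exact: ltW.
by apply: cone_state_gt => //; rewrite ltrBlDr ltrDl divr_gt0.
Qed.

End TotalCone.

(** * Maximal quadratic modules and points *)

Section QuadraticModule.
Variables (R : realType) (n : nat).
Local Notation A := (mpoly n R).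
Implicit Types (p q x y s : A) (M : set A).

Lemma sos0 : sos (0 : A).
Proof. by exists [::]; rewrite big_nil. Qed.

Lemma sos_sqr q : sos (q ^+ 2).
Proof. by exists [:: q]; rewrite big_seq1. Qed.

Lemma sosD p q : sos p -> sos q -> sos (p + q).
Proof. by move=> [s ->] [r ->]; exists (s ++ r); rewrite big_cat. Qed.

Lemma sos_sqrM p q : sos p -> sos (q ^+ 2 * p).
Proof.
move=> [s ->]; exists [seq q * r | r <- s].
by rewrite big_map mulr_sumr; apply: eq_bigr => r _; rewrite exprMn.
Qed.

Definition qmodule M := [/\ M 1, forall x y, M x -> M y -> M (x + y) &
  forall q x, M x -> M (q ^+ 2 * x)].

Section Basics.
Variable M : set A.
Hypothesis qM : qmodule M.

Lemma qmoduleD x y : M x -> M y -> M (x + y).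
Proof. by case: qM => _ + _; apply. Qed.

Lemma qmodule_sqrM q x : M x -> M (q ^+ 2 * x).
Proof. by case: qM => _ _; apply. Qed.

Lemma qmodule_sqr q : M (q ^+ 2).
Proof. by rewrite -[_ ^+ 2]mulr1; apply: qmodule_sqrM; case: qM. Qed.

Lemma qmodule0 : M 0.
Proof. by have := qmodule_sqr 0; rewrite expr0n. Qed.

Lemma qmoduleZ a x : 0 <= a -> M x -> M (a *: x).
Proof.
move=> a0 Mx; rewrite -(sqr_sqrtr a0) -mul_mpolyC rmorphXn.
exact: qmodule_sqrM.
Qed.

Lemma qmodule_sosM s x : sos s -> M x -> M (s * x).
Proof.
move=> [qs ->] Mx; rewrite mulr_suml; elim: qs => [|q qs ih].
  by rewrite big_nil; exact: qmodule0.
by rewrite big_cons; apply: qmoduleD => //; exact: qmodule_sqrM.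
Qed.

Lemma qmodule_sos s : sos s -> M s.
Proof. by move=> /qmodule_sosM; rewrite -{2}[s]mulr1; apply; case: qM. Qed.

(** Every q is a difference of squares, ((q + 1) / 2)^2 - ((q - 1) / 2)^2, so the elements that lie
    in [M] together with their opposite form an ideal. *)
Lemma qmodule_ideal q x : M x -> M (- x) -> M (q * x).
Proof.
move=> Mx MNx; have -> : q * x = (2^-1 *: (q + 1)) ^+ 2 * x
    + (2^-1 *: (q - 1)) ^+ 2 * (- x).
  rewrite -!mul_mpolyC; set c := mpolyC n _.
  have c2 : c * 4 * c = 1.
    rewrite -mpolyC_nat -!mpolyCM -mpolyC1; congr mpolyC; lra.
  by transitivity (c * 4 * c * (q * x)); [rewrite c2 mul1r|ring].
by apply: qmoduleD; exact: qmodule_sqrM.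
Qed.

Lemma qmodule_adjoin x :
  qmodule [set y | exists m s, [/\ M m, sos s & y = m + s * x]].
Proof.
split.
- exists 1, 0; split; [by case: qM|exact: sos0|by rewrite mul0r addr0].
- move=> _ _ [m [s [Mm ss ->]]] [m' [s' [Mm' ss' ->]]].
  exists (m + m'), (s + s'); split; [exact: qmoduleD|exact: sosD|].
  by rewrite mulrDl addrACA.
- move=> q _ [m [s [Mm ss ->]]]; exists (q ^+ 2 * m), (q ^+ 2 * s).
  split; [exact: qmodule_sqrM|exact: sos_sqrM|by rewrite mulrDr mulrA].
Qed.

End Basics.

Definition qmodule_maximal M := [/\ qmodule M, ~ M (-1) &
  forall B, qmodule B -> ~ B (-1) -> M `<=` B -> B `<=` M].

Lemma qmodule_maximal_ext M : qmodule M -> ~ M (-1) ->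
  exists2 B, qmodule_maximal B & M `<=` B.
Proof.
move=> qM MN1.
have [||F [X0 FX0] FP totF|B [[qB BN1] MB maxB]] :=
    @zorn_above _ [set X | qmodule X /\ ~ X (-1)] M.
- by split.
- by exists 1; case: qM.
- split; last by move=> [X FX]; case: (FP X FX).
  split.
  + by exists X0 => //; case: (FP X0 FX0) => -[].
  + move=> x y [X FX Xx] [Y FY Yy]; case: (totF X Y FX FY) => XY.
      exists Y => //; apply: qmoduleD => //; last exact: XY.
      by case: (FP Y FY).
    exists X => //; apply: qmoduleD => //; last exact: XY.
    by case: (FP X FX).
  + move=> q x [X FX Xx]; exists X => //; apply: qmodule_sqrM => //.
    by case: (FP X FX).
by exists B => //; split=> // C qC CN1 BC; exact: maxB.
Qed.

Lemma qmodule_maximal_notin M x : qmodule_maximal M -> ~ M x ->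
  exists m s, [/\ M m, sos s & -1 = m + s * x].
Proof.
move=> [qM MN1 maxM] Mx; apply: contrapT => noN1; apply: Mx.
apply: (maxM _ (qmodule_adjoin qM x) noN1).
  move=> m Mm; exists m, 0; split=> //; first exact: sos0.
  by rewrite mul0r addr0.
exists 0, 1; split; [exact: qmodule0| |by rewrite mul1r add0r].
by have := sos_sqr 1; rewrite expr1n.
Qed.

(** If both x and -x were missing, maximality would give -1 = m + s x and -1 = m' - s' x.
    Eliminating x shows that -s lies in [M]; so does s, hence s x by the ideal property, and then
    -1. *)
Lemma qmodule_maximal_total M x : qmodule_maximal M -> M x \/ M (- x).
Proof.
move=> maxM; have [qM MN1 _] := maxM.
apply: contrapT => /not_orP[Mx MNx].
have [m [s [Mm ss E]]] := qmodule_maximal_notin maxM Mx.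
have [m' [s' [Mm' ss' E']]] := qmodule_maximal_notin maxM MNx.
apply: MN1; rewrite {1}E.
apply: (qmoduleD qM) => //; rewrite mulrC; apply: qmodule_ideal => //.
  exact: qmodule_sos.
have -> : - s = s' + s' * m + s * m'.
  have E1 : s' * -1 = s' * (m + s * x) by rewrite -E.
  have E2 : s * -1 = s * (m' + s' * - x) by rewrite -E'.
  rewrite -mulrN1 E2; apply: (addrI (s' * -1)); rewrite {1}E1; ring.
apply: (qmoduleD qM); last exact: qmodule_sosM.
by apply: (qmoduleD qM); [exact: qmodule_sos|exact: qmodule_sosM].
Qed.

(** The state of a maximal extension maps x^2 to the square of the image of x, hence is
    multiplicative by polarisation. A multiplicative linear form on polynomials is the evaluation at
    the point formed by the images of the variables. *)
Lemma qmodule_point M : qmodule M -> ~ M (-1) ->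
  (forall p, exists N, M (N *: 1 - p)) ->
  exists z, forall p, M p -> 0 <= peval p z.
Proof.
move=> qM0 MN1 archi0; have [B maxB MB] := qmodule_maximal_ext qM0 MN1.
have [qB BN1 _] := maxB.
have BZ := @qmoduleZ _ qB.
have BD := qmoduleD qB.
have Btot x := qmodule_maximal_total x maxB.
have bd x : order_bounded 1 B x.
  have [N /MB BN] := archi0 x; have [K /MB BK] := archi0 (- x).
  exists (`|N| + `|K|).
    have -> : (`|N| + `|K|) *: 1 - x =
      (N *: 1 - x) + (`|N| + `|K| - N) *: 1 :> A.
      by rewrite [RHS]addrAC -scalerDl subrKC.
    apply: BD => //; apply: BZ; last by case: qB.
    by have := ler_norm N; have := normr_ge0 K; lra.
  have -> : (`|N| + `|K|) *: 1 + x =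
    (K *: 1 - - x) + (`|N| + `|K| - K) *: 1 :> A.
    by rewrite opprK [RHS]addrAC -scalerDl subrKC.
  apply: BD => //; apply: BZ; last by case: qB.
  by have := ler_norm K; have := normr_ge0 N; lra.
pose L := cone_state 1 B.
have LD x y : L (x + y) = L x + L y by exact: cone_stateD.
have LZ a x : L (a *: x) = a * L x by exact: cone_stateZ.
have LC a : L (a *: 1) = a by exact: cone_state_unit.
have L1 : L 1 = 1 by have := LC 1; rewrite scale1r.
have L0 x : L x = 0 -> L (x ^+ 2) <= 0.
  move=> Lx; apply/ler_addgt0Pr => eps eps0; rewrite add0r.
  apply: cone_state_le => //.
  pose d := Num.sqrt eps.
  have d0 : 0 < d by rewrite sqrtr_gt0.
  have B1 : B (d *: 1 - x) by apply: cone_state_lt => //; rewrite -/(L x) Lx.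
  have B2 : B (d *: 1 + x).
    have : B (x - (- d) *: 1).
      by apply: cone_state_gt => //; rewrite -/(L x) Lx oppr_lt0.
    by rewrite scaleNr opprK addrC.
  (* A quadratic module is not closed under products, so d^2 - x^2 cannot be treated as (d - x) (d +
     x); it is a combination of d - x and d + x with square coefficients. *)
  have -> : eps *: 1 - x ^+ 2 = (2 * d)^-1 *:
     ((d *: 1 + x) ^+ 2 * (d *: 1 - x) + (d *: 1 - x) ^+ 2 * (d *: 1 + x)) :> A.
    rewrite -(sqr_sqrtr (ltW eps0)) -/d -!mul_mpolyC rmorphXn.
    set c := mpolyC n d; set c' := mpolyC n _^-1.
    have c2 : c' * (2 * c) = 1.
      rewrite -mpolyC_nat -!mpolyCM -mpolyC1; congr mpolyC.
      by rewrite mulVf// mulf_neq0// gt_eqF.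
    transitivity (c' * (2 * c) * (c ^+ 2 * 1 - x ^+ 2)); last ring.
    by rewrite c2 mul1r.
  apply: BZ; first by rewrite invr_ge0 mulr_ge0// ltW.
  by apply: BD; exact: qmodule_sqrM.
have Lsq x : L (x ^+ 2) = L x ^+ 2.
  have E : x ^+ 2 = (x - L x *: 1) ^+ 2 + ((2 * L x) *: x - (L x ^+ 2) *: 1).
    rewrite -!mul_mpolyC mpolyCM mpolyC_nat rmorphXn; ring.
  have Lxx : L (x - L x *: 1) = 0 by rewrite -scaleNr LD LC subrr.
  have LE : L (x ^+ 2) = L ((x - L x *: 1) ^+ 2) + L x ^+ 2.
    rewrite {1}E LD; congr (_ + _).
    rewrite -scaleNr LD LZ LC; ring.
  apply/eqP; rewrite eq_le; apply/andP; split.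
    by rewrite LE gerDr; exact: L0.
  by rewrite LE lerDr; apply: cone_state_ge0 => //; exact: (qmodule_sqr qB).
have LM x y : L (x * y) = L x * L y.
  have : L ((x + y) ^+ 2) = L (x ^+ 2 + (2 *: (x * y) + y ^+ 2)).
    by congr L; rewrite -mul_mpolyC mpolyC_nat; ring.
  rewrite Lsq !LD LZ !Lsq; move: (L (x * y)) (L x) (L y) => a b c; lra.
exists (\row_a L (pvar a)) => p Bp.
suff -> : peval p (\row_a L (pvar a)) = L p by apply: cone_state_ge0 => //; exact: MB.
rewrite /peval mevalE [in RHS](mpolyE p).
have L00 : L 0 = 0 by rewrite -[0](scale0r 1) LC.
rewrite (big_morph L LD L00); apply: eq_bigr => m _.
rewrite LZ; congr (_ * _); rewrite mpolyXE_id (big_morph L LM L1).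
apply: eq_bigr => a _; rewrite mxE /pvar.
by elim: (fun_of_multinom m a) => [|k ih]; rewrite ?expr0 ?exprS ?LM ?ih ?L1.
Qed.

End QuadraticModule.

(** * Archimedean quadratic modules *)

Section Putinar.
Variables (R : realType) (n : nat).
Local Notation A := (mpoly n R).
Implicit Types (p q x y s f : A) (M : set A).

(** The quadratic module without degree bounds, that is, the union of the [quad_module d gs] over
    all d. *)
Definition qgen (gs : seq A) : set A := [set p |
  exists (s0 : A) (s : 'I_(size gs) -> A),
    [/\ sos s0, forall l, sos (s l) & p = s0 + \sum_l s l * gs`_l]].

Lemma qgen_qmodule gs : qmodule (qgen gs).
Proof.
split.
- exists 1, (fun=> 0); split; [|by move=> _; exact: sos0|].
    by have := sos_sqr (1 : A); rewrite expr1n.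
  by rewrite big1 ?addr0// => l _; rewrite mul0r.
- move=> _ _ [s0 [s [S0 Ss ->]]] [t0 [t [T0 Tt ->]]].
  exists (s0 + t0), (fun l => s l + t l); split; [exact: sosD| |].
    by move=> l; exact: sosD.
  by rewrite addrACA -big_split; congr (_ + _); apply: eq_bigr => l _; rewrite mulrDl.
- move=> q _ [s0 [s [S0 Ss ->]]]; exists (q ^+ 2 * s0), (fun l => q ^+ 2 * s l).
  split; [exact: sos_sqrM|by move=> l; exact: sos_sqrM|].
  by rewrite mulrDr mulr_sumr; congr (_ + _); apply: eq_bigr => l _; rewrite mulrA.
Qed.

Lemma qgen_mem gs g : g \in gs -> qgen gs g.
Proof.
move=> ggs; have ig : (index g gs < size gs)%N by rewrite index_mem.
exists 0, (fun l => (l == Ordinal ig)%:R); split; first exact: sos0.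
  move=> l; case: eqP => _; last exact: sos0.
  by have := sos_sqr (1 : A); rewrite expr1n.
rewrite add0r (bigD1 (Ordinal ig))//= eqxx mul1r nth_index// big1 ?addr0//.
by move=> l /negbTE ->; rewrite mul0r.
Qed.

Section Archimedean.
Variable M : set A.
Hypothesis qM : qmodule M.
Local Notation bd := (order_bounded 1 M).

Let MD := qmoduleD qM.
Let MZ := qmoduleZ qM.

Let bd_le p N N' : N <= N' -> M (N *: 1 - p) -> M (N' *: 1 - p).
Proof.
move=> NN' Mp; have -> : N' *: 1 - p = (N *: 1 - p) + (N' - N) *: 1 :> A.
  by rewrite [RHS]addrAC -scalerDl subrKC.
by apply: MD => //; apply: MZ; [rewrite subr_ge0|case: qM].
Qed.

(** Both p and -p are at most p^2 + 1/4, as the squares of p - 1/2 and p + 1/2 certify. *)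
Lemma qmodule_boundedV p N : M (N *: 1 - p ^+ 2) -> bd p.
Proof.
move=> MN; exists (N + 4^-1).
  have -> : (N + 4^-1) *: 1 - p = (N *: 1 - p ^+ 2) + (p - 2^-1 *: 1) ^+ 2 :> A.
    rewrite -!mul_mpolyC mpolyCD.
    have -> : mpolyC n (4^-1 : R) = mpolyC n 2^-1 ^+ 2.
      by rewrite -rmorphXn/=; congr mpolyC; lra.
    have h : mpolyC n (2^-1 : R) * 2 = 1.
      by rewrite -mpolyC_nat -mpolyCM -mpolyC1; congr mpolyC; lra.
    rewrite -[p in LHS]mul1r -[X in X * p]h; ring.
  by apply: MD => //; exact: qmodule_sqr.
have -> : (N + 4^-1) *: 1 + p = (N *: 1 - p ^+ 2) + (p + 2^-1 *: 1) ^+ 2 :> A.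
  rewrite -!mul_mpolyC mpolyCD.
  have -> : mpolyC n (4^-1 : R) = mpolyC n 2^-1 ^+ 2.
    by rewrite -rmorphXn/=; congr mpolyC; lra.
  have h : mpolyC n (2^-1 : R) * 2 = 1.
    by rewrite -mpolyC_nat -mpolyCM -mpolyC1; congr mpolyC; lra.
  rewrite -[p in LHS]mul1r -[X in X * p]h; ring.
by apply: MD => //; exact: qmodule_sqr.
Qed.

Lemma qmodule_bounded_sqr p : bd p -> bd (p ^+ 2).
Proof.
move=> [N Mp Mp'].
have [K [K0 {}Mp {}Mp']] : exists K, [/\ 0 < K, M (K *: 1 - p) & M (K *: 1 + p)].
  exists (`|N| + 1); have NN : N <= `|N| + 1 by rewrite ler_wpDr// ler_norm.
  split; first by rewrite ltr_pwDr.
    exact: bd_le Mp.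
  by rewrite -[p in M (_ + p)]opprK; apply: bd_le NN _; rewrite opprK.
exists (K ^+ 2); last first.
  apply: MD; last exact: qmodule_sqr.
  by apply: MZ; [exact: sqr_ge0|case: qM].
have -> : K ^+ 2 *: 1 - p ^+ 2 = (2 * K)^-1 *:
   ((K *: 1 + p) ^+ 2 * (K *: 1 - p) + (K *: 1 - p) ^+ 2 * (K *: 1 + p)) :> A.
  rewrite -!mul_mpolyC rmorphXn; set c := mpolyC n K; set c' := mpolyC n _^-1.
  have c2 : c' * (2 * c) = 1.
    rewrite -mpolyC_nat -!mpolyCM -mpolyC1; congr mpolyC.
    by rewrite mulVf// mulf_neq0// gt_eqF.
  transitivity (c' * (2 * c) * (c ^+ 2 * 1 - p ^+ 2)); last ring.
  by rewrite c2 mul1r.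
apply: MZ; first by rewrite invr_ge0 mulr_ge0// ltW.
by apply: MD; exact: qmodule_sqrM.
Qed.

Lemma qmodule_boundedM p q : bd p -> bd q -> bd (p * q).
Proof.
move=> bp bq.
have -> : p * q = 4^-1 *: ((p + q) ^+ 2 - (p - q) ^+ 2).
  rewrite -mul_mpolyC; set c := mpolyC n _.
  have c4 : c * 4 = 1.
    by rewrite -mpolyC_nat -!mpolyCM -mpolyC1; congr mpolyC; lra.
  by transitivity (c * 4 * (p * q)); [rewrite c4 mul1r|ring].
apply: order_boundedZ => //; apply: order_boundedD => //.
  by apply: qmodule_bounded_sqr; exact: order_boundedD.
apply: order_boundedN; apply: qmodule_bounded_sqr.
by apply: order_boundedD => //; exact: order_boundedN.
Qed.

(** The order bounded elements form a ring containing the constants: they are stable under squares,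
    hence under products by polarisation. Bounding the variables is thus enough. *)
Lemma qmodule_archimedean :
  (forall a, exists N, M (N *: 1 - pvar a ^+ 2)) -> forall p, bd p.
Proof.
move=> Mvar p; have M1 : M 1 by case: qM.
have bC (c : R) : bd (c *: 1).
  apply: order_boundedZ => //; exists 1; rewrite scale1r; last exact: MD.
  by rewrite subrr; exact: qmodule0.
have b0 : bd 0 by have := bC 0; rewrite scale0r.
have b1 : bd 1 by have := bC 1; rewrite scale1r.
rewrite (mpolyE p); elim/big_ind : _ => //.
  by move=> x y; exact: order_boundedD.
move=> m _; apply: order_boundedZ => //; rewrite mpolyXE_id.
elim/big_ind : _ => //; first by move=> x y; exact: qmodule_boundedM.
move=> a _; have [N MN] := Mvar a.
elim: (fun_of_multinom m a) => [|k ih]; first by rewrite expr0.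
by rewrite exprS; apply: qmodule_boundedM => //; exact: qmodule_boundedV MN.
Qed.

(* Subtracts the fixed amount [1/c^2] from [r] as long as [r >= 0]. *)
Lemma qmodule_descent f s r c : 0 <= r -> 0 < c -> sos s ->
  M (s * f - 1) -> M ((2 * c) *: 1 - s) ->
  M ((2 * c - 1) *: 1 - s ^+ 2 * f) ->
  M (f + r *: 1) -> M (f + (r - c ^- 2) *: 1).
Proof.
move=> r0 c0 ss Msf Ms Mssf Mf.
have -> : f + (r - c ^- 2) *: 1 = (c ^- 2) *: (
    (c *: 1 - s) ^+ 2 * (f + r *: 1) + (2 * c) *: (s * f - 1)
    + r *: (s * ((2 * c) *: 1 - s)) + ((2 * c - 1) *: 1 - s ^+ 2 * f)).
  have cn0 : c != 0 by rewrite gt_eqF.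
  have E : mpolyC n (c ^- 2) * mpolyC n c ^+ 2 = 1.
    rewrite -rmorphXn -mpolyCM -mpolyC1; congr mpolyC.
    by rewrite mulVf// expf_neq0.
  rewrite -!mul_mpolyC mpolyCB mpolyCM mpolyCB mpolyC_nat mpolyC1 mpolyCM mpolyC_nat.
  move: (mpolyC n (c ^- 2)) (mpolyC n c) (mpolyC n r) E => d e t E.
  have -> : f + (t - d) * 1 = d * e ^+ 2 * (f + t * 1) - d.
    by rewrite E mul1r; ring.
  ring.
have M1 : M 1 by case: qM.
apply: MZ; first by rewrite invr_ge0 exprn_ge0// ltW.
apply: (MD) => //; apply: (MD); last first.
  by apply: MZ => //; exact: qmodule_sosM.
apply: (MD); first exact: qmodule_sqrM.
by apply: MZ => //; rewrite mulr_ge0// ltW.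
Qed.

(** The archimedean property puts some f + r0 in [M]. Each descent lowers the constant by the same
    amount, so 0 is reached after finitely many. *)
Lemma qmodule_pos f s : (forall p, bd p) -> sos s -> M (s * f - 1) -> M f.
Proof.
move=> archi ss Msf.
have [N1 MN1 _] := archi s; have [N2 MN2 _] := archi (s ^+ 2 * f).
have [r0 _ Mr0] := archi f.
(* Large enough for 2 c - s and 2 c - 1 - s^2 f to lie in [M], as the descent requires. *)
pose c := 1 + `|N1| + `|N2|; pose d := c ^- 2.
have c0 : 0 < c by rewrite /c -addrA ltr_pwDl// addr_ge0.
have d0 : 0 < d by rewrite invr_gt0 exprn_gt0.
have Ms : M ((2 * c) *: 1 - s).
  apply: bd_le MN1; rewrite /c.
  by have := ler_norm N1; have := normr_ge0 N1; have := normr_ge0 N2; lra.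
have Mssf : M ((2 * c - 1) *: 1 - s ^+ 2 * f).
  apply: bd_le MN2; rewrite /c.
  by have := ler_norm N2; have := normr_ge0 N1; have := normr_ge0 N2; lra.
(* Cut off at 0, since the descent only starts from a nonnegative constant. *)
pose u k := Num.max 0 (r0 - k%:R * d).
have Mle a b : a <= b -> M (f + a *: 1) -> M (f + b *: 1).
  move=> ab; rewrite !(addrC f) -[f]opprK; exact: bd_le.
have Mu k : M (f + u k *: 1).
  elim: k => [|k ih].
    apply: (Mle r0); last by rewrite addrC.
    by rewrite /u mul0r subr0 le_max lexx orbT.
  have u0 : 0 <= u k by rewrite le_max lexx.
  apply: Mle (qmodule_descent u0 c0 ss Msf Ms Mssf ih).
  rewrite -/d /u -natr1 mulrDl mul1r opprD addrA.
  move: (r0 - _) => a; rewrite lerBlDr ge_max; apply/andP; split.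
    by rewrite addr_ge0 ?(ltW d0)// le_max lexx.
  by rewrite -lerBlDr le_max lexx orbT.
have [k kd] : exists k, u k = 0.
  exists (Num.truncn (`|r0| / d)).+1; apply/max_idPl; rewrite subr_le0.
  have := truncnS_gt (`|r0| / d); rewrite ltr_pdivrMr// => /ltW.
  by apply: le_trans; exact: ler_norm.
by have := Mu k; rewrite kd scale0r addr0.
Qed.

End Archimedean.

(** Adjoin -f to the module. If this produces -1, then -1 = m - s f and [qmodule_pos] applies;
    otherwise [qmodule_point] gives a point of the set at which f is not positive. *)
Theorem putinar gs f :
  (forall a, exists N, qgen gs (N *: 1 - pvar a ^+ 2)) ->
  (forall z, nonneg_set gs z -> 0 < peval f z) -> qgen gs f.
Proof.
move=> gsvar fpos; have qQ := qgen_qmodule gs.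
have archi := qmodule_archimedean qQ gsvar.
have qM := qmodule_adjoin qQ (- f); set M := (X in qmodule X) in qM.
have QM : qgen gs `<=` M.
  move=> p Qp; exists p, 0; split=> //; first exact: sos0.
  by rewrite mul0r addr0.
have MNf : M (- f).
  exists 0, 1; split; [exact: qmodule0| |by rewrite mul1r add0r].
  by have := sos_sqr (1 : A); rewrite expr1n.
have [[m [s [Qm ss E]]]|MN1] := pselect (M (- 1)).
  apply: (qmodule_pos qQ archi ss); suff -> : s * f - 1 = m by [].
  by rewrite E mulrN addrC subrK.
have [p|z zM] := qmodule_point qM MN1.
  by have [N QN _] := archi p; exists N; exact: QM.
have /fpos f0 : nonneg_set gs z by move=> g ggs; apply/zM/QM/qgen_mem.
by have := zM _ MNf; rewrite /peval mevalN oppr_ge0 leNgt f0.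
Qed.

End Putinar.

(** * The Riesz representation theorem on compact sets *)

Section Separation.
Variables (R : realType) (T : Type) (K : set T).
Local Notation V := (T -> R).

Definition bounded_on (f : V) := exists C, forall x, K x -> `|f x| <= C.

(** Linearity is asked on all functions bounded on [K], whether continuous or not, because
    indicators of arbitrary sets are evaluated later. Positivity is tested on [K] only, so that
    [L f] depends on the restriction of [f] to [K]. *)
Definition positive_functional (L : V -> R) := [/\
  forall f g, bounded_on f -> bounded_on g ->
    L (fun x => f x + g x) = L f + L g,
  forall a f, bounded_on f -> L (fun x => a * f x) = a * L f &
  forall f, bounded_on f -> (forall x, K x -> 0 <= f x) -> 0 <= L f].

Lemma bounded_onD f g :
  bounded_on f -> bounded_on g -> bounded_on (fun x => f x + g x).
Proof.
move=> [C fC] [D gD]; exists (C + D) => x Kx.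
by apply: le_trans (ler_normD _ _) _; apply: lerD; [exact: fC|exact: gD].
Qed.

Lemma bounded_onM f g :
  bounded_on f -> bounded_on g -> bounded_on (fun x => f x * g x).
Proof.
move=> [C fC] [D gD]; exists (C * D) => x Kx.
by rewrite normrM; apply: ler_pM => //; [exact: fC|exact: gD].
Qed.

Lemma bounded_on_cst a : bounded_on (fun=> a).
Proof. by exists `|a|. Qed.

Lemma bounded_onZ a f : bounded_on f -> bounded_on (fun x => a * f x).
Proof. exact/bounded_onM/bounded_on_cst. Qed.

Lemma bounded_onN f : bounded_on f -> bounded_on (fun x => - f x).
Proof. by move=> [C fC]; exists C => x Kx; rewrite normrN; exact: fC. Qed.

Lemma bounded_onB f g :
  bounded_on f -> bounded_on g -> bounded_on (fun x => f x - g x).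
Proof. by move=> bf /bounded_onN; exact: bounded_onD. Qed.

Lemma bounded_on_eq f g : (forall x, K x -> f x = g x) ->
  bounded_on f -> bounded_on g.
Proof. by move=> fg [C fC]; exists C => x Kx; rewrite -fg//; exact: fC. Qed.

Section PositiveFunctional.
Variable L : V -> R.
Hypothesis pL : positive_functional L.

Lemma functionalD f g : bounded_on f -> bounded_on g ->
  L (fun x => f x + g x) = L f + L g.
Proof. by case: pL => h _ _; exact: h. Qed.

Lemma functionalZ a f : bounded_on f -> L (fun x => a * f x) = a * L f.
Proof. by case: pL => _ h _; exact: h. Qed.

Lemma functional_ge0 f : bounded_on f -> (forall x, K x -> 0 <= f x) -> 0 <= L f.
Proof. by case: pL => _ _ h; exact: h. Qed.

Lemma functionalN f : bounded_on f -> L (fun x => - f x) = - L f.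
Proof.
move=> bf; rewrite -mulN1r -functionalZ//; congr L.
by apply/funext => x; rewrite mulN1r.
Qed.

Lemma functionalB f g : bounded_on f -> bounded_on g ->
  L (fun x => f x - g x) = L f - L g.
Proof.
by move=> bf bg; rewrite functionalD ?functionalN//; exact: bounded_onN.
Qed.

Lemma functional_le f g : bounded_on f -> bounded_on g ->
  (forall x, K x -> f x <= g x) -> L f <= L g.
Proof.
move=> bf bg fg; rewrite -subr_ge0 -functionalB//; apply: functional_ge0.
  exact: bounded_onB.
by move=> x Kx; rewrite subr_ge0 fg.
Qed.

Lemma functional_eq f g : bounded_on f ->
  (forall x, K x -> f x = g x) -> L f = L g.
Proof.
move=> bf fg; have bg := bounded_on_eq fg bf.
by apply/eqP; rewrite eq_le; apply/andP; split;
  apply: functional_le => // x Kx; rewrite fg.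
Qed.

Lemma functional_cst a : L (fun=> a) = a * L (fun=> 1).
Proof.
rewrite -functionalZ; last exact: bounded_on_cst.
by congr L; apply/funext => x; rewrite mulr1.
Qed.

Lemma functional0 : L (fun=> 0) = 0.
Proof. by rewrite functional_cst mul0r. Qed.

Lemma functional_norm f g : bounded_on f -> bounded_on g ->
  (forall x, K x -> `|f x| <= g x) -> `|L f| <= L g.
Proof.
move=> bf bg fg; rewrite ler_norml -functionalN//; apply/andP; split;
  apply: functional_le => //; first exact: bounded_onN.
  by move=> x /fg; rewrite ler_norml => /andP[].
by move=> x /fg; rewrite ler_norml => /andP[].
Qed.

Lemma functional_sum (I : Type) (r : seq I) (P : pred I) (F : I -> V) :
  (forall i, P i -> bounded_on (F i)) ->
  L (fun x => \sum_(i <- r | P i) F i x) = \sum_(i <- r | P i) L (F i).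
Proof.
move=> bF; elim: r => [|i r ih].
  rewrite big_nil -[RHS]functional0; congr L.
  by apply/funext => x; rewrite big_nil.
rewrite big_cons; case: ifPn => Pi; last first.
  by rewrite -ih; congr L; apply/funext => x; rewrite big_cons (negbTE Pi).
rewrite -ih -functionalD; last 2 first.
- exact: bF.
- elim: r {ih} => [|j r ih].
    by apply: bounded_on_eq (bounded_on_cst 0) => x _; rewrite big_nil.
  case: (boolP (P j)) => Pj.
    apply: bounded_on_eq (bounded_onD (bF _ Pj) ih) => x _.
    by rewrite big_cons Pj.
  by apply: bounded_on_eq ih => x _; rewrite big_cons (negbTE Pj).
by congr L; apply/funext => x; rewrite big_cons Pi.
Qed.

End PositiveFunctional.

Let cone (M : set V) := (forall f g, M f -> M g -> M (f + g)) /\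
  (forall (a : R) f, 0 <= a -> M f -> M (a *: (f : T -> R^o))).

(** The functions f with f + w nonnegative on [K] for some w in [W] form a cone that contains the
    functions nonnegative on [K] and all -w; it avoids -1 by hypothesis. A maximal cone of this kind
    is total, and its state is the functional. *)
Lemma separating_state (W : set V) :
  W (fun=> 0) -> (forall f g, W f -> W g -> W (fun x => f x + g x)) ->
  (forall a f, 0 <= a -> W f -> W (fun x => a * f x)) ->
  (forall f, W f -> bounded_on f) ->
  ~ (exists2 w, W w & forall x, K x -> 1 <= w x) ->
  exists L, [/\ positive_functional L, L (fun=> 1) = 1 &
    forall w, W w -> L w <= 0].
Proof.
move=> W0 WD WZ Wb noW.
pose one : T -> R^o := fun=> 1.
pose C0 : set V := [set f | exists2 w, W w & forall x, K x -> 0 <= f x + w x].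
have coneC0 : cone C0.
  split.
    move=> f g [w Ww fw] [v Wv gv]; exists (fun x => w x + v x); first exact: WD.
    by move=> x Kx; rewrite addrACA addr_ge0 ?fw ?gv.
  move=> a f a0 [w Ww fw]; exists (fun x => a * w x); first exact: WZ.
  move=> x Kx; have -> : (a *: (f : T -> R^o)) x + a * w x = a * (f x + w x).
    by rewrite mulrDr.
  by rewrite mulr_ge0// fw.
have C0pos f : (forall x, K x -> 0 <= f x) -> C0 f.
  by move=> f0; exists (fun=> 0) => // x Kx; rewrite addr0 f0.
have C0N1 : ~ C0 (- one).
  move=> [w Ww w1]; apply: noW; exists w => // x /w1.
  by rewrite addrC subr_ge0.
have [||F [X0 FX0] FP totF|M [[coneM MN1] C0M maxM]] :=
    @zorn_above _ [set X | cone X /\ ~ X (- one)] C0.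
- by split.
- by exists one; apply: C0pos => x _; exact: ler01.
- split; last by move=> [X FX]; case: (FP X FX).
  split.
    move=> x y [X FX Xx] [Y FY Yy]; case: (totF X Y FX FY) => XY.
      exists Y => //; have [[YD _] _] := FP Y FY; apply: YD => //; exact: XY.
    exists X => //; have [[XD _] _] := FP X FX; apply: XD => //; exact: XY.
  move=> a x a0 [X FX Xx]; exists X => //.
  by have [[_ XZ] _] := FP X FX; exact: XZ.
have [MD MZ] := coneM.
have C0_0 : M (0 : T -> R^o) by apply: C0M; apply: C0pos.
have notin (f : T -> R^o) : ~ M f ->
    exists m a, [/\ M m, 0 <= a & - one = m + a *: f].
  move=> Mf; apply: contrapT => noN1; apply: Mf.
  pose B := [set g : V | exists m a, [/\ M m, 0 <= a & g = m + a *: f]].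
  apply: (maxM B).
  - move=> m Mm; exists m, 0; split=> //.
    by rewrite scale0r addr0.
  - split=> //; split.
      move=> _ _ [m [a [Mm a0 ->]]] [m' [a' [Mm' a0' ->]]].
      exists (m + m'), (a + a'); split; [exact: MD|exact: addr_ge0|].
      by rewrite scalerDl addrACA.
    move=> a _ a0 [m [a' [Mm a0' ->]]].
    exists (a *: (m : T -> R^o)), (a * a'); split; [exact: MZ|exact: mulr_ge0|].
    by rewrite scalerDr scalerA.
  - by exists 0, 1; rewrite scale1r add0r.
have Mtot (f : T -> R^o) : M f \/ M (- f).
  apply: contrapT => /not_orP[Mf MNf].
  have [m [a [Mm a0 E]]] := notin _ Mf.
  have [m' [a' [Mm' a0' E']]] := notin _ MNf.
  have [a00|an0] := eqVneq a 0.
    by apply: MN1; rewrite E a00 scale0r addr0.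
  have aa' : 0 < a' + a.
    by rewrite ltr_wpDl// lt_neqAle eq_sym an0.
  apply: MN1.
  (* Eliminating f from -1 = m + a f and -1 = m' - a' f leaves -1 as a nonnegative combination of m
     and m'. *)
  have -> : - one = (a' + a)^-1 *: (a' *: (m : T -> R^o) + a *: (m' : T -> R^o)).
    have -> : a' *: (m : T -> R^o) + a *: (m' : T -> R^o) = (a' + a) *: (- one).
      rewrite scalerDl {1}E E' !scalerDr !scalerN !scalerA (mulrC a' a).
      by rewrite addrACA subrr addr0.
    by rewrite scalerA mulVf ?scale1r// gt_eqF.
  apply: (MZ); first by rewrite invr_ge0 ltW.
  by apply: (MD); exact: MZ.
have bd (f : T -> R^o) : bounded_on f -> order_bounded one M f.
  move=> [C fC]; exists C; apply: C0M; apply: C0pos => x Kx.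
    have : 0 <= C * 1 - f x; last by [].
    by rewrite mulr1 subr_ge0; apply: le_trans (ler_norm _) (fC x Kx).
  have : 0 <= C * 1 + f x; last by [].
  by have /ler_normlP[] := fC x Kx; lra.
exists (cone_state one M); split; first split.
- by move=> f g bf bg; apply: cone_stateD => //; exact: bd.
- by move=> a f bf; apply: cone_stateZ => //; exact: bd.
- move=> f bf f0; apply: cone_state_ge0 => //; first exact: bd.
  by apply: C0M; exact: C0pos.
- have -> : (fun=> 1) = (1 *: one) :> (T -> R^o) by rewrite scale1r.
  exact: cone_state_unit.
move=> w Ww; rewrite -oppr_ge0; have bw := bd w (Wb _ Ww).
rewrite -cone_stateN//; apply: cone_state_ge0 => //.
  exact: order_boundedN.
by apply: C0M; exists w => // x _; rewrite addrC subrr.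
Qed.

End Separation.

(** * Continuity and Riemann sums *)

Lemma compact_uniform_continuity (R : realType) (V : normedModType R)
    (f : V -> R) (A : set V) (e : R) : continuous f -> compact A -> 0 < e ->
  exists2 d, 0 < d & forall x y, A x -> `|x - y| < d -> `|f x - f y| < e.
Proof.
move=> cf /compact_near_coveringP cA e0.
pose P (d : R) (x : V) := forall y, `|x - y| < d -> `|f x - f y| < e.
have /(_ _)[|d /= d0 Hd] := cA R (0 : R)^'+ P _.
- move=> x Ax.
  have /cvgrPdist_lt/(_ (e / 2)) := cf x; rewrite divr_gt0// => /(_ isT).
  move=> /nbhs_normP[d /= d0 xd].
  near=> x' r => /= y x'y.
  have xx' : `|x - x'| < d / 2.
    by near: x'; apply: cvgr_dist_lt => //; rewrite divr_gt0.
  have rd : r < d / 2 by near: r; apply: nbhs_right_lt; rewrite divr_gt0.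
  have h1 : `|f x - f x'| < e / 2.
    by apply: xd => /=; apply: lt_trans xx' _; rewrite ltr_pdivrMr// ltr_pMr// ltr1n.
  have h2 : `|f x - f y| < e / 2.
    apply: xd => /=; rewrite -(subrKA x').
    by apply: le_lt_trans (ler_normD _ _) _; lra.
  rewrite -(subrKA (f x)); apply: le_lt_trans (ler_normD _ _) _.
  by rewrite (distrC (f x')); lra.
- exists (d / 2); first by rewrite divr_gt0.
  move=> x y Ax; apply: Hd => //; last by rewrite divr_gt0.
  by rewrite /= sub0r normrN gtr0_norm ?divr_gt0// ltr_pdivrMr//; lra.
Unshelve. all: by end_near. Qed.

Lemma sum_continuous (R : realType) (V : topologicalType) (I : Type) (r : seq I)
    (P : pred I) (F : I -> V -> R) :
  (forall i, P i -> continuous (F i)) ->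
  continuous (fun x => \sum_(i <- r | P i) F i x).
Proof.
move=> cF x; apply: cvg_big; first exact: add_continuous.
by move=> i Pi; exact: cF.
Qed.

Section RealValuedContinuous.
Variables (R : realType) (V : topologicalType).
Implicit Types f g : V -> R.

Lemma addf_continuous f g : continuous f -> continuous g ->
  continuous (fun x => f x + g x).
Proof. by move=> cf cg x; apply: cvgD; [exact: cf|exact: cg]. Qed.

Lemma subf_continuous f g : continuous f -> continuous g ->
  continuous (fun x => f x - g x).
Proof. by move=> cf cg x; apply: cvgB; [exact: cf|exact: cg]. Qed.

Lemma mulf_continuous f g : continuous f -> continuous g ->
  continuous (fun x => f x * g x).
Proof. by move=> cf cg x; apply: cvgM; [exact: cf|exact: cg]. Qed.

Lemma cstf_continuous (a : R) : continuous (fun _ : V => a).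
Proof. by move=> x; exact: cvg_cst. Qed.

Lemma scalef_continuous a f : continuous f -> continuous (fun x => a * f x).
Proof. exact/mulf_continuous/cstf_continuous. Qed.

Lemma compf_continuous (U : topologicalType) (h : V -> U) (f : U -> R) :
  continuous h -> continuous f -> continuous (fun x => f (h x)).
Proof. by move=> ch cf x; apply: continuous_comp; [exact: ch|exact: cf]. Qed.

End RealValuedContinuous.

Lemma row_coord_le (R : realType) d (x : 'rV[R]_d) j : `|x ord0 j| <= `|x|.
Proof.
have /mapP[i Hi ->] : `|x ord0 j| \in [seq `|x y.1 y.2| | y : 'I_1 * 'I_d].
  by apply/mapP; exists (ord0, j) => //=; rewrite mem_enum.
by rewrite [leRHS]/Num.norm /= mx_normrE; apply/bigmax_geP; right => /=; exists i.
Qed.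

Lemma row_norm_lt (R : realType) d (x : 'rV[R]_d) e : 0 < e ->
  (forall j, `|x ord0 j| < e) -> `|x| < e.
Proof.
move=> e0 xe; rewrite [ltLHS]/Num.norm /= mx_normrE.
by apply/bigmax_ltP; split=> // -[i j] _ /=; rewrite ord1.
Qed.

Lemma riemann_sum_error (R : realType) (g J F : nat -> R) (e : R) M :
  (forall k, (k < M)%N -> `|J k.+1 - J k - g k * (F k.+1 - F k)| <=
     e * (F k.+1 - F k)) ->
  `|J M - J 0 - \sum_(k < M) g k * (F k.+1 - F k)| <= e * (F M - F 0).
Proof.
elim: M => [_|M ih h].
  by rewrite big_ord0 !subrr mulr0 normr0.
rewrite big_ord_recr/=.
have -> : J M.+1 - J 0 - (\sum_(k < M) g k * (F k.+1 - F k) +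
    g M * (F M.+1 - F M)) =
  (J M - J 0 - \sum_(k < M) g k * (F k.+1 - F k)) +
  (J M.+1 - J M - g M * (F M.+1 - F M)) by ring.
apply: le_trans (ler_normD _ _) _.
have -> : e * (F M.+1 - F 0) = e * (F M - F 0) + e * (F M.+1 - F M) by ring.
by apply: lerD; [apply: ih => k kM; apply: h; exact: ltnW|exact: h].
Qed.

Lemma abel_summation (R : realType) (g D : nat -> R) M : D 0 = 0 -> D M = 0 ->
  \sum_(k < M) g k * (D k.+1 - D k) =
  - \sum_(k < M) (g k.+1 - g k) * D k.+1.
Proof.
move=> D0 DM; apply/eqP; rewrite -addr_eq0 -big_split/=; apply/eqP.
rewrite (eq_bigr (fun k : 'I_M => g k.+1 * D k.+1 - g k * D k)); last first.
  by move=> k _; ring.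
have := telescope_sumr (fun k => g k * D k) (leq0n M).
by rewrite big_mkord => ->; rewrite D0 DM !mulr0 subrr.
Qed.

(** * The distribution of a function under a positive functional *)

Section Distribution.
Variables (R : realType) (T : Type) (K : set T) (L : (T -> R) -> R).
Hypotheses (pL : positive_functional K L) (L1 : L (fun=> 1) = 1).
Variable psi : T -> R.
Hypothesis psi01 : forall x, K x -> 0 <= psi x <= 1.

Let ind (s : R) (x : T) : R := (psi x <= s)%R%:R.

Let bind s : bounded_on K (ind s).
Proof. by exists 1 => x _; rewrite /ind; case: (psi x <= s); rewrite ?normr1 ?normr0. Qed.

Let df (s : R) := L (ind s).

Let df_homo s t : s <= t -> df s <= df t.
Proof.
move=> st; apply: (functional_le pL) => // x _; rewrite /ind.
by case: (leP (psi x) s) => // xs; rewrite (le_trans xs st).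
Qed.

Let df0 s : s < 0 -> df s = 0.
Proof.
move=> s0; rewrite -(functional0 pL); apply: (functional_eq pL) => // x Kx.
rewrite /ind leNgt (lt_le_trans s0)//.
by case/andP: (psi01 Kx).
Qed.

Let df1 s : 1 <= s -> df s = 1.
Proof.
move=> s1; rewrite -L1; apply: (functional_eq pL) => // x Kx.
by rewrite /ind (le_trans _ s1)//; case/andP: (psi01 Kx).
Qed.

Let df_ge0 s : 0 <= df s.
Proof. by apply: (functional_ge0 pL) => // x _; exact: ler0n. Qed.

(** The right limit of [df]. As [L] need not be countably additive on indicators, [df] itself may
    fail to be right-continuous, which a Lebesgue-Stieltjes measure requires. *)
Let dfr (s : R) := locked (inf [set df t | t in `]s, +oo[]).

Let dfr_lb s : has_inf [set df t | t in `]s, +oo[].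
Proof.
split; last by exists 0 => _ [t _ <-].
by exists (df (s + 1)), (s + 1) => //=; rewrite in_itv/= andbT ltrDl.
Qed.

Let dfr_le s t : s < t -> dfr s <= df t.
Proof.
move=> st; rewrite /dfr -lock; apply: ge_inf; first by case: (dfr_lb s).
by exists t => //=; rewrite in_itv/= andbT.
Qed.

Let dfr_ge s a : (forall t, s < t -> a <= df t) -> a <= dfr s.
Proof.
move=> h; rewrite /dfr -lock; apply: lb_le_inf; first by case: (dfr_lb s).
by move=> _ [t + <-]; rewrite /= in_itv/= andbT => /h.
Qed.

Let df_le_dfr s : df s <= dfr s.
Proof. by apply: dfr_ge => t st; apply: df_homo; exact: ltW. Qed.

Let dfr_homo : nondecreasing dfr.
Proof.
move=> s t st; apply: dfr_ge => u tu; apply: dfr_le; exact: le_lt_trans tu.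
Qed.

Let dfrN1 : dfr (-1) = 0.
Proof.
apply/eqP; rewrite eq_le; apply/andP; split; last exact: le_trans (df_le_dfr _).
by apply: (le_trans (dfr_le (t := - 2^-1) _)); rewrite ?df0//; lra.
Qed.

Let dfr2 : dfr 2 = 1.
Proof.
apply/eqP; rewrite eq_le; apply/andP; split.
  by apply: (le_trans (dfr_le (t := 3) _)); rewrite ?df1//; lra.
by apply: le_trans (df_le_dfr 2); rewrite df1//; lra.
Qed.

Let dfr_right_continuous : right_continuous dfr.
Proof.
move=> s; apply/cvgrPdist_le => e e0.
have [u su Fu] : exists2 u, s < u & df u < dfr s + e.
  apply: contrapT => no; have : dfr s + e <= dfr s; last by rewrite leNgt ltrDl e0.
  apply: dfr_ge => t st; rewrite leNgt; apply/negP => Ft; apply: no.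
  by exists t.
near=> t.
have st : s < t by [].
have tu : t < u by near: t; exact: nbhs_right_lt.
rewrite ler0_norm; last by rewrite subr_le0; apply: dfr_homo; exact: ltW.
rewrite opprB lerBlDl; apply: le_trans (ltW Fu); exact: dfr_le.
Unshelve. all: by end_near. Qed.

HB.instance Definition _ :=
  isCumulative.Build R _ R dfr dfr_homo dfr_right_continuous.

Let dfrN : dfr @ -oo --> (0 : R).
Proof.
apply: cvg_near_cst; near=> s.
have s0 : s < 0 by near: s; exact: nbhs_ninfty_lt.
apply/eqP; rewrite eq_le; apply/andP; split; last exact: le_trans (df_le_dfr s).
by rewrite -(df0 (s := s / 2)) ?dfr_le//; lra.
Unshelve. all: by end_near. Qed.

Let dfry : dfr @ +oo --> (1 : R).
Proof.
apply: cvg_near_cst; near=> s.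
have s1 : 1 <= s by near: s; exact: nbhs_pinfty_ge.
apply/eqP; rewrite eq_le; apply/andP; split.
  by rewrite -(df1 (s := s + 1)) ?dfr_le//; lra.
by rewrite -(df1 s1).
Unshelve. all: by end_near. Qed.

HB.instance Definition _ := isCumulativeBounded.Build R 0 1 dfr dfrN dfry.

Definition state_distribution : probability (measurableTypeR R) R :=
  lebesgue_stieltjes_measure dfr.

Let dist_itv a b : a <= b ->
  state_distribution `]a, b]%classic = (dfr b - dfr a)%:E.
Proof.
move=> ab; rewrite /state_distribution/= /lebesgue_stieltjes_measure.
rewrite /measure_extension measurable_mu_extE/=; last exact: is_ocitv.
by rewrite wlength_itv_bnd.
Qed.

Section Integral.
Variable g : R -> R.
Hypotheses (cg : continuous g) (bg : exists C, forall s, `|g s| <= C).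
Local Notation P := state_distribution.

Let int_cb (k : R -> R) D : continuous k -> (exists C, forall s, `|k s| <= C) ->
  measurable D -> P.-integrable D (EFin \o k).
Proof.
move=> ck [C kC] mD; apply: measurable_bounded_integrable => //.
- by rewrite (le_lt_trans (probability_le1 _ mD))// ltry.
- apply: measurable_funTS; exact: continuous_measurable_fun.
- exists C; split; first exact: num_real.
  by move=> M CM x _; apply: le_trans (kC x) (ltW CM).
Qed.

Let intg D : measurable D -> P.-integrable D (EFin \o g).
Proof. by move=> mD; apply: int_cb. Qed.

Let gpsi : bounded_on K (g \o psi).
Proof. by have [C gC] := bg; exists C => x _; exact: gC. Qed.

Let step_functional s t e : s <= t ->
  (forall r, s < r <= t -> `|g r - g s| <= e) ->
  `|L (fun x => g (psi x) * ind t x) - L (fun x => g (psi x) * ind s x)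
    - g s * (df t - df s)| <= e * (df t - df s).
Proof.
move=> st ge.
have bgi r : bounded_on K (fun x => g (psi x) * ind r x).
  exact: bounded_onM.
have bti : bounded_on K (fun x => ind t x - ind s x) by exact: bounded_onB.
rewrite -(functionalB pL)// -(functionalB pL)// -!(functionalZ pL)//.
rewrite -(functionalB pL)//; last 2 first.
- exact: bounded_onB.
- exact: bounded_onZ.
apply: (functional_norm pL).
- by apply: bounded_onB; [exact: bounded_onB|exact: bounded_onZ].
- exact: bounded_onZ.
move=> x _; rewrite -!mulrBr -mulrBl normrM.
have i0 : 0 <= ind t x - ind s x.
  rewrite subr_ge0 /ind; case: (leP (psi x) s) => // xs.
  by rewrite (le_trans xs st).
rewrite (ger0_norm i0); move: i0; rewrite /ind.
case: (leP (psi x) s) => [xs|sx].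
  by rewrite (le_trans xs st) subrr !mulr0.
case: (leP (psi x) t) => [xt|tx] _; rewrite subr0 ?mulr0// !mulr1.
by apply: ge; rewrite sx xt.
Qed.

Let step_integral s t e : -1 <= s -> s <= t ->
  (forall r, s < r <= t -> `|g r - g s| <= e) ->
  `|\int[P]_(r in `]-1, t]) g r - \int[P]_(r in `]-1, s]) g r
    - g s * (dfr t - dfr s)| <= e * (dfr t - dfr s).
Proof.
move=> s1 st ge.
have -> : `]-1, t]%classic = `]-1, s]%classic `|` `]s, t]%classic.
  by rewrite -itv_bndbnd_setU// bnd_simp.
rewrite Rintegral_setU//; last 2 first.
- by apply: intg; exact: measurableU.
- apply/disj_setPS => r [] /=; rewrite !in_itv/= => /andP[_ rs] /andP[sr _].
  by move: (le_lt_trans rs sr); rewrite ltxx.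
rewrite (addrC (\int[P]_(r in `]-1, s]) g r)) addrK.
have E : dfr t - dfr s = fine (P `]s, t]%classic) by rewrite dist_itv.
have ic (c : R) : P.-integrable `]s, t]%classic (EFin \o (fun=> c)).
  exact: finite_measure_integrable_cst.
rewrite E -!Rintegral_cst// -RintegralB//; last exact: intg.
have igs : P.-integrable `]s, t]%classic (EFin \o (fun r => g r - g s)).
  apply: int_cb => //.
    by move=> r; apply: cvgB; [exact: cg|exact: cvg_cst].
  have [C gC] := bg; exists (C + `|g s|) => r.
  by apply: le_trans (ler_normB _ _) _; rewrite lerD2r.
apply: le_trans (le_normr_Rintegral _ igs) _ => //.
apply: le_Rintegral => //.
exact: (@integrable_norm _ _ _ P _ (fun r => g r - g s)).
Qed.

(** On a fine subdivision the right side is close to a Riemann-Stieltjes sum for [df], the left side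
    to the one for [dfr]. The two sums are close to each other because [dfr] at a subdivision point
    lies between the values of [df] at this point and at the next. *)
Lemma state_distribution_integral : \int[P]_r g r = L (g \o psi).
Proof.
(* All the mass lies in this interval. It exceeds [0, 1] on both sides, so that [df] and [dfr] agree
   at its ends. *)
have -> : \int[P]_r g r = \int[P]_(r in `]-1, 2]) g r.
  rewrite -(setUv `]-1, 2]%classic) Rintegral_setU//; last 3 first.
  - exact: measurableC.
  - by rewrite setUv; exact: intg.
  - by apply/disj_setPS; rewrite setICr.
  suff -> : \int[P]_(r in ~` `]-1, 2]) g r = 0 by rewrite addr0.
  rewrite /Rintegral null_set_integral//.
  - exact: measurableC.
  - by apply/measurable_EFinP; apply: measurable_funTS; exact: continuous_measurable_fun.
  - have mD : measurable (`]-1, 2]%classic : set (measurableTypeR R)) by [].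
    have := probability_setC P mD; rewrite dist_itv; last lra.
    by rewrite dfr2 dfrN1 subr0 subee.
have [C gC] := bg.
apply/eqP; rewrite -subr_eq0 -normr_le0; apply/ler_addgt0Pr => e e0.
(* One third for each Riemann sum and one third for the difference of the two sums. *)
rewrite add0r; pose e' := e / 3; have e'0 : 0 < e' by rewrite divr_gt0.
have [d d0 gd] := compact_uniform_continuity cg (@segment_compact R (-1) 2) e'0.
have [M M0 Md] : exists2 M : nat, (0 < M)%N & 3 / M%:R < d.
  exists (Num.truncn (3 / d)).+1 => //; rewrite ltr_pdivrMr// mulrC -ltr_pdivrMr//.
  exact: truncnS_gt.
pose h : R := 3 / M%:R; pose t (k : nat) : R := k%:R * h - 1.
have h0 : 0 < h by rewrite divr_gt0// ltr0n.
have t0 : t 0 = -1 by rewrite /t mul0r sub0r.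
have tM : t M = 2.
  by rewrite /t /h mulrCA divff ?mulr1 ?pnatr_eq0 -?lt0n//; lra.
have tS k : t k.+1 = t k + h by rewrite /t -natr1; ring.
have tlt k : t k < t k.+1 by rewrite tS ltrDl.
have tge k : -1 <= t k by rewrite /t lerBrDr addNr mulr_ge0// ltW.
have tle k : (k <= M)%N -> t k <= 2.
  by move=> kM; rewrite -tM /t lerD2r ler_wpM2r ?ler_nat// ltW.
have osc k r : (k < M)%N -> t k < r <= t k.+1 -> `|g r - g (t k)| <= e'.
  move=> kM /andP[tr rt]; rewrite distrC; apply/ltW/gd.
    by rewrite /= in_itv/= tge tle// ltnW.
  rewrite ltr0_norm ?subr_lt0// opprB; apply: le_lt_trans Md.
  by rewrite lerBlDl -tS.
pose J1 k := L (fun x => g (psi x) * ind (t k) x).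
pose J2 k := \int[P]_(r in `]-1, t k]) g r.
have E1 := @riemann_sum_error R (g \o t) J1 (df \o t) e' M
  (fun k kM => step_functional (ltW (tlt k)) (fun r => osc k r kM)).
have E2 := @riemann_sum_error R (g \o t) J2 (dfr \o t) e' M
  (fun k kM => step_integral (tge k) (ltW (tlt k)) (fun r => osc k r kM)).
have J10 : J1 0 = 0.
  rewrite -(functional0 pL); apply: (functional_eq pL); first exact: bounded_onM.
  move=> x Kx; rewrite /ind t0 leNgt (lt_le_trans (y := 0)) ?mulr0//.
  by case/andP: (psi01 Kx).
have J1M : J1 M = L (g \o psi).
  apply: (functional_eq pL); first exact: bounded_onM.
  move=> x Kx; rewrite /ind tM (le_trans (y := 1)) ?mulr1//.
    by case/andP: (psi01 Kx).
  by rewrite ler1n.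
have J20 : J2 0 = 0 by rewrite /J2 t0 set_itvoc0 Rintegral_set0.
have J2M : J2 M = \int[P]_(r in `]-1, 2]) g r by rewrite /J2 tM.
rewrite -J2M -J1M.
pose D k := dfr (t k) - df (t k).
have D_ge0 k : 0 <= D k by rewrite subr_ge0 df_le_dfr.
have df01 : df (t 0) = 0 by rewrite t0 df0.
have dfM1 : df (t M) = 1 by rewrite tM df1//; lra.
have dfr01 : dfr (t 0) = 0 by rewrite t0.
have dfrM1 : dfr (t M) = 1 by rewrite tM.
have D0 : D 0 = 0 by rewrite /D df01 dfr01 subrr.
have DM : D M = 0 by rewrite /D dfM1 dfrM1 subrr.
(* Summation by parts moves the differences onto [g], whose increments are at most [e']; the factors
   [D k.+1] are bounded by increments of [df], which telescope to at most 1. *)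
have E3 : `|\sum_(k < M) g (t k) * (D k.+1 - D k)| <= e'.
  rewrite (abel_summation (fun k => g (t k)) D0 DM) normrN.
  apply: le_trans (ler_norm_sum _ _ _) _.
  apply: (@le_trans _ _ (\sum_(k < M) e' * (df (t k.+2) - df (t k.+1)))).
    apply: ler_sum => k _; rewrite normrM; apply: ler_pM => //.
      by apply: osc => //; rewrite tlt lexx.
    by rewrite ger0_norm// lerD2r; exact: dfr_le.
  rewrite -mulr_sumr.
  have := telescope_sumr (fun k => df (t k.+1)) (leq0n M).
  rewrite big_mkord => ->; rewrite ger_pMr//.
  rewrite lerBlDr; apply: (@le_trans _ _ 1); last by rewrite lerDl.
  by rewrite df1//; apply: le_trans (ltW (tlt M)); rewrite tM; lra.
have -> : J2 M - J1 M =
  (J2 M - J2 0 - \sum_(k < M) (g \o t) k * ((dfr \o t) k.+1 - (dfr \o t) k))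
  - (J1 M - J1 0 - \sum_(k < M) (g \o t) k * ((df \o t) k.+1 - (df \o t) k))
  + \sum_(k < M) g (t k) * (D k.+1 - D k).
  have -> : \sum_(k < M) g (t k) * (D k.+1 - D k) =
     \sum_(k < M) (g \o t) k * ((dfr \o t) k.+1 - (dfr \o t) k) -
     \sum_(k < M) (g \o t) k * ((df \o t) k.+1 - (df \o t) k).
    by rewrite -sumrB; apply: eq_bigr => k _; rewrite /D/=; ring.
  by rewrite J10 J20; ring.
move: E1 E2; rewrite /= df01 dfM1 dfr01 dfrM1 subr0 mulr1 => E1 E2.
apply: le_trans (ler_normD _ _) _.
have -> : e = e' + e' + e' by rewrite /e'; lra.
apply: lerD => //; apply: le_trans (ler_normB _ _) _; exact: lerD.
Qed.

End Integral.

End Distribution.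

(** * Expansions with geometric weights *)

Section Expansion.
Variables (R : realType) (q : R).
Hypothesis q01 : 0 < q < 1.
Implicit Type a : nat -> R.

Definition expansion_partial a n := \sum_(k < n) (1 - q) * q ^+ k * a k.

Definition expansion a := locked (sup (range (expansion_partial a))).

Definition digits a := forall k, 0 <= a k <= 1.

Let q0 : 0 <= q. Proof. by case/andP: q01 => /ltW. Qed.
Let q1 : 0 <= 1 - q. Proof. by rewrite subr_ge0; case/andP: q01 => _ /ltW. Qed.

Lemma expansion_partial_le a n m : digits a ->
  expansion_partial a m <= expansion_partial a n + q ^+ n.
Proof.
move=> a01; have pos i : 0 <= (1 - q) * q ^+ i by rewrite mulr_ge0 ?exprn_ge0.
have mono k l : expansion_partial a k <= expansion_partial a (k + l)%N.
  elim: l => [|l ih]; first by rewrite addn0.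
  rewrite addnS /expansion_partial big_ord_recr/= (le_trans ih)// lerDl.
  by rewrite mulr_ge0//; case/andP: (a01 (k + l)%N).
have bnd l : expansion_partial a (n + l)%N <=
    expansion_partial a n + q ^+ n - q ^+ (n + l).
  elim: l => [|l ih]; first by rewrite addn0 addrK.
  rewrite addnS /expansion_partial big_ord_recr/=.
  apply: (@le_trans _ _ (expansion_partial a n + q ^+ n - q ^+ (n + l)
     + (1 - q) * q ^+ (n + l) * 1)).
    by apply: lerD => //; apply: ler_wpM2l => //; case/andP: (a01 (n + l)%N).
  by rewrite exprS mulr1 mulrBl mul1r addrA subrK.
have [mn|/ltnW nm] := leqP m n.
  apply: (@le_trans _ _ (expansion_partial a n)); last by rewrite lerDl exprn_ge0.
  by rewrite -(subnKC mn).
rewrite -(subnKC nm); apply: le_trans (bnd _) _.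
by rewrite gerBl exprn_ge0.
Qed.

Let has_sup_expansion a : digits a -> has_sup (range (expansion_partial a)).
Proof.
move=> a01; split; first by exists (expansion_partial a 0), 0%N.
exists (expansion_partial a 0 + q ^+ 0) => _ [m _ <-].
exact: expansion_partial_le.
Qed.

Lemma expansion_approx a n : digits a ->
  `|expansion a - expansion_partial a n| <= q ^+ n.
Proof.
move=> a01; have hs := has_sup_expansion a01.
rewrite ger0_norm.
  rewrite lerBlDl /expansion -lock; apply: ge_sup; first by case: hs.
  by move=> _ [m _ <-]; exact: expansion_partial_le.
rewrite subr_ge0 /expansion -lock; apply: ub_le_sup; first by case: hs.
by exists n.
Qed.

Lemma expr_small e : 0 < e -> exists n, q ^+ n < e.
Proof.
move=> e0; have : (q ^+ n @[n --> \oo] --> 0).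
  by apply: cvg_expr; rewrite ger0_norm//; case/andP: q01.
move=> /cvgrPdist_lt/(_ e e0)[N _ /(_ N (leqnn N))]; rewrite /= sub0r normrN.
by rewrite ger0_norm ?exprn_ge0// => qe; exists N.
Qed.

Lemma expansion_unique a x : digits a ->
  (forall n, `|x - expansion_partial a n| <= q ^+ n) -> x = expansion a.
Proof.
move=> a01 xa; apply/eqP; rewrite -subr_eq0 -normr_le0.
apply/ler_addgt0Pr => e e0; rewrite add0r.
have [n qn] := expr_small (divr_gt0 e0 (@ltr0n R 2)).
rewrite -(subrKA (expansion_partial a n)).
apply: le_trans (ler_normD _ _) _.
have := expansion_approx n a01; rewrite distrC; have := xa n; lra.
Qed.

Lemma expansionS a : digits a ->
  expansion a = (1 - q) * a 0%N + q * expansion (fun k => a k.+1).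
Proof.
move=> a01; have a01' : digits (fun k => a k.+1) by move=> k; exact: a01.
apply/esym/expansion_unique => // -[|n]; last first.
  rewrite /expansion_partial big_ord_recl/= expr0 mulr1 opprD addrACA subrr add0r.
  under eq_bigr do rewrite /bump/= add1n exprS mulrCA -mulrA.
  rewrite -mulr_sumr -mulrBr normrM ger0_norm// exprS ler_wpM2l//.
  exact: expansion_approx.
have := expansion_approx 0 a01'; rewrite /expansion_partial !big_ord0 !subr0 expr0.
move=> h; apply: le_trans (ler_normD _ _) _.
rewrite !normrM (ger0_norm q0) (ger0_norm q1).
have /andP[a0 a1] := a01 0%N; rewrite (ger0_norm a0).
have := ler_wpM2l q0 h; have := ler_wpM2l q1 a1; lra.
Qed.

Lemma expansion_itv a : digits a -> 0 <= expansion a <= 1.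
Proof.
move=> a01; have := expansion_approx 0 a01.
rewrite /expansion_partial big_ord0 subr0 expr0 ler_norml => /andP[_ ->].
rewrite andbT /expansion -lock.
have [_ ub] := has_sup_expansion a01.
by apply: (ub_le_sup ub); exists 0%N => //; rewrite /expansion_partial big_ord0.
Qed.

Lemma expansion_continuous (a : nat -> R -> R) :
  (forall k, continuous (a k)) -> (forall s, digits (a^~ s)) ->
  continuous (fun s => expansion (a^~ s)).
Proof.
move=> ca a01 s; apply/cvgrPdist_lt => e e0.
have [n qn] := expr_small (divr_gt0 e0 (@ltr0n R 3)).
have cp : continuous (fun s => expansion_partial (a^~ s) n).
  apply: sum_continuous => k _ r; apply: cvgMl_tmp; exact: ca.
have /cvgrPdist_lt/(_ (e / 3)) := cp s; rewrite divr_gt0// => /(_ isT) H.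
near=> r.
have hr : `|expansion_partial (a^~ s) n - expansion_partial (a^~ r) n| < e / 3.
  by near: r.
have := expansion_approx n (a01 s); have := expansion_approx n (a01 r).
rewrite distrC => h1 h2.
rewrite -(subrKA (expansion_partial (a^~ s) n)).
rewrite -[X in _ + X](subrKA (expansion_partial (a^~ r) n)).
apply: le_lt_trans (ler_normD _ _) _.
have := ler_normD (expansion_partial (a^~ s) n - expansion_partial (a^~ r) n)
  (expansion_partial (a^~ r) n - expansion (a^~ r)).
lra.
Unshelve. all: by end_near. Qed.

End Expansion.

(** * Schoenberg's space-filling curve *)

Section SpaceFillingCurve.
Variable R : realType.

(* Schoenberg's function: continuous, of period 2, equal to 0 on [0, 1/3] and
   to 1 on [2/3, 1]. *)
Definition plateau (y : R) : R :=
  Num.max 0 (Num.min 1 (2^-1 - cos (pi * y) / (2 * cos (pi / 3)))).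

Let c3 : 0 < cos (pi / 3) :> R.
Proof.
by apply: cos_gt0_pihalf; have := pi_gt0 R; lra.
Qed.

Lemma plateau_itv y : 0 <= plateau y <= 1.
Proof. by rewrite /plateau le_max lexx/= ge_max ler01 ge_min lexx. Qed.

Lemma plateau_continuous : continuous plateau.
Proof.
move=> y; pose h y : R := 2^-1 - cos (pi * y) / (2 * cos (pi / 3)).
have ch : {for y, continuous h}.
  apply: cvgB; first exact: cvg_cst.
  apply: cvgMr_tmp; apply: (@continuous_comp _ _ _ (fun y => pi * y) cos).
    by apply: cvgMl_tmp; exact: cvg_id.
  exact: continuous_cos.
have : {for y, continuous ((fun=> 0) \max ((fun=> 1) \min (h : R -> R^o)))}.
  apply: continuous_max; first exact: cvg_cst.
  by apply: continuous_min; first exact: cvg_cst.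
by [].
Qed.

Lemma plateau_periodic y (m : nat) : plateau (y + (2 * m)%:R) = plateau y.
Proof.
rewrite /plateau; congr (Num.max 0 (Num.min 1 (_ - _ / _))).
have -> : (pi : R) * (y + (2 * m)%:R) = pi * y + ((pi : R) *+ 2) *+ m.
  by rewrite mulrDr natrM mulrA !mulr_natr.
exact: (periodicn (@cosD2pi R)).
Qed.

Let cos_third y : 0 <= y <= 3^-1 -> cos (pi / 3) <= cos (pi * y) :> R.
Proof.
move=> /andP[y0 y3]; have pi0 := pi_gt0 R.
have h : pi * y <= pi / 3 by rewrite ler_wpM2l// ltW.
have h0 : 0 <= pi * y by rewrite mulr_ge0// ltW.
by rewrite leNgt ltr_cos ?in_itv/= -?leNgt//; lra.
Qed.

Lemma plateau0 y : 0 <= y <= 3^-1 -> plateau y = 0.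
Proof.
move=> /cos_third h; apply/max_idPl; rewrite ge_min; apply/orP; right.
rewrite subr_le0 ler_pdivlMr; last by rewrite mulr_gt0.
by rewrite mulrA mulVf ?mul1r ?pnatr_eq0.
Qed.

Lemma plateau1 y : 2 / 3 <= y <= 1 -> plateau y = 1.
Proof.
move=> /andP[y2 y1].
have /cos_third h : 0 <= 1 - y <= 3^-1 by lra.
have E : cos (pi * (1 - y)) = - cos (pi * y).
  by rewrite mulrBr mulr1 addrC cosDpi cosN.
rewrite E in h.
suff h1 : 1 <= 2^-1 - cos (pi * y) / (2 * cos (pi / 3)).
  by rewrite /plateau (min_idPl h1); apply/max_idPr.
rewrite lerBrDr -lerBrDl ler_pdivrMr; last by rewrite mulr_gt0.
move: (cos (pi / 3)) (cos (pi * y)) c3 h => c c' c0 h; lra.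
Qed.

(** s is the Cantor point with ternary digits 2 c_k. Multiplication by 3^i shifts the digits and
    adds an even integer, which the period 2 ignores; the remainder lies in [0, 1/3] or in [2/3, 1]
    according to c_i. *)
Lemma ternary_code (c : nat -> bool) :
  exists2 s : R, 0 <= s <= 1 & forall i, plateau (3 ^+ i * s) = (c i)%:R.
Proof.
have q01 : 0 < (3^-1 : R) < 1 by lra.
pose a i k : R := (c (i + k)%N)%:R.
have a01 i : digits (a i) by move=> k; rewrite /a; case: (c _); rewrite ?lexx ?ler01.
pose t i := expansion 3^-1 (a i).
have tS i : t i.+1 + 2 * (c i)%:R = 3 * t i.
  have a0 : a i 0%N = (c i)%:R by rewrite /a addn0.
  rewrite /t (expansionS q01 (a01 i)) a0.
  have -> : (fun k => a i k.+1) = a i.+1.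
    by apply/funext => k; rewrite /a addnS addSn.
  lra.
have tP i : plateau (t i) = (c i)%:R.
  have t1 : 0 <= t i <= 1 by exact: expansion_itv.
  have t2 : 0 <= t i.+1 <= 1 by exact: expansion_itv.
  have := tS i; case: (c i) => /= h.
    by rewrite plateau1//; lra.
  by rewrite plateau0//; lra.
exists (t 0%N); first exact: expansion_itv.
move=> i; rewrite -tP.
suff [m ->] : exists m : nat, 3 ^+ i * t 0%N = t i + (2 * m)%:R.
  exact: plateau_periodic.
elim: i => [|i [m ih]]; first by exists 0%N; rewrite expr0 mul1r addr0.
exists (c i + 3 * m)%N; rewrite exprS -mulrA ih mulrDr -tS.
by rewrite !(natrM, natrD, mulnDr); ring.
Qed.

(** The digits follow the orbit of x under doubling, [r n] being the remainder after n digits scaled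
    by 2^n. The comparison with 1/2 is large, so x = 1 gets all digits 1 and the orbit stays in
    [0, 1]. *)
Lemma binary_code (x : R) : 0 <= x <= 1 ->
  exists c : nat -> bool, x = expansion 2^-1 (fun k => (c k)%:R).
Proof.
move=> x01; pose step (r : R) := 2 * r - (2^-1 <= r)%R%:R.
pose r k := iter k step x.
have rS k : r k.+1 = step (r k) by [].
have r01 k : 0 <= r k <= 1.
  elim: k => [//|k]; rewrite rS /step.
  by case: (leP 2^-1 (r k)) => /= h1 h2; lra.
exists (fun k => 2^-1 <= r k); apply: expansion_unique; first lra.
  by move=> k; case: (_ <= r k); rewrite ?lexx ?ler01.
move=> n; suff -> : x - expansion_partial 2^-1 (fun k => (2^-1 <= r k)%R%:R) n =
    2^-1 ^+ n * r n.
  have /andP[r0 r1] := r01 n.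
  rewrite ger0_norm; last by rewrite mulr_ge0// exprn_ge0// invr_ge0.
  by rewrite ler_piMr// exprn_ge0// invr_ge0.
rewrite /expansion_partial; elim: n => [|n ih].
  by rewrite big_ord0 subr0 expr0 mul1r.
rewrite rS big_ord_recr/= opprD addrA ih exprS /step.
have -> : 1 - 2^-1 = 2^-1 :> R by lra.
by move: (2^-1 ^+ n) (r n) ((2^-1 <= r n)%R%:R : R) => a b c; lra.
Qed.

Lemma row_continuous (T : topologicalType) d (f : T -> 'rV[R]_d) :
  (forall j, continuous (fun s => f s ord0 j)) -> continuous f.
Proof.
move=> cf s; apply/cvg_ballP => e e0.
have H : \forall t \near s, forall j, ball (f s ord0 j) e (f t ord0 j).
  apply: filter_forall => j; have /cvg_ballP := cf j s; exact.
by apply: filterS H => t Ht; split=> // i j; rewrite ord1; exact: Ht.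
Qed.

(** Coordinate j takes its k-th digit from the plateau function at scale 3^(k d + j), so a single
    ternary code prescribes all digits of all coordinates. The bound by [C] holds on the whole line,
    which keeps continuous functions bounded along the curve. *)
Theorem space_filling_curve d (C : R) : 0 < C ->
  exists gamma : R -> 'rV[R]_d, [/\ continuous gamma,
    forall s j, `|gamma s ord0 j| <= C &
    forall x : 'rV[R]_d, (forall j, `|x ord0 j| <= C) ->
      exists2 s, 0 <= s <= 1 & gamma s = x].
Proof.
move=> C0; have q01 : 0 < (2^-1 : R) < 1 by lra.
pose a (j : 'I_d) (k : nat) (s : R) := plateau (3 ^+ (k * d + j) * s).
have ca j k : continuous (a j k).
  move=> s.
  rewrite /continuous_at; apply: (@continuous_comp R R R (fun s => 3 ^+ (k * d + j) * s) plateau s);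
    last exact: plateau_continuous.
  by apply: cvgMl_tmp; exact: cvg_id.
have a01 j s : digits ((a j)^~ s) by move=> k; exact: plateau_itv.
exists (fun s => \row_j (2 * C * expansion 2^-1 ((a j)^~ s) - C)); split.
- apply: row_continuous => j; under eq_fun do rewrite mxE.
  move=> s; apply: cvgB; last exact: cvg_cst.
  by apply: cvgMl_tmp; exact: expansion_continuous.
- move=> s j; rewrite mxE; have /andP[e0 e1] := expansion_itv q01 (a01 j s).
  rewrite ler_norml; have := ler_wpM2l (ltW C0) e1; have := mulr_ge0 (ltW C0) e0.
  lra.
move=> x xC; pose y j := (x ord0 j + C) / (2 * C).
have y01 j : 0 <= y j <= 1.
  have := xC j; rewrite ler_norml => /andP[x1 x2].
  by rewrite divr_ge0 ?ler_pdivrMr//=; lra.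
have /choice[b yb] := fun j => binary_code (y01 j).
(* The digit sequences of the coordinates are interleaved; the default [false] is reached only when
   d = 0. *)
pose c m := if insub (m %% d)%N is Some j then b j (m %/ d)%N else false.
have [s s01 sc] := ternary_code c.
exists s => //; apply/rowP => j; rewrite mxE.
have -> : expansion 2^-1 ((a j)^~ s) = y j.
  rewrite yb; congr expansion; apply/funext => k; rewrite /a sc /c.
  have jd := ltn_ord j; have d0 : (0 < d)%N by exact: leq_ltn_trans jd.
  rewrite modnMDl modn_small// divnMDl// divn_small// addn0.
  by rewrite valK.
by rewrite /y mulrC divfK ?addrK// gt_eqF// mulr_gt0.
Qed.

End SpaceFillingCurve.

Lemma compact_bounded_on (R : realType) (V : topologicalType)
    (f : V -> R) (A : set V) : continuous f -> compact A -> bounded_on A f.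
Proof.
move=> cf cA.
have /compact_bounded [M [_ /(_ (M + 1))]] : compact (f @` A).
  by apply: continuous_compact => //; exact: continuous_subspaceT.
rewrite ltrDl ltr01 => /(_ isT) h; exists (M + 1) => x Ax; apply: h.
by exists x.
Qed.

(** * Integrals of continuous functions over a compact set *)

Section BorelContinuous.
Variables (R : realType) (d : nat).

Lemma borel_open (A : set 'rV[R]_d) : open A -> measurable (A : set (borel R d)).
Proof. by move=> oA; exact: sub_gen_smallest. Qed.

Lemma borel_closed (A : set 'rV[R]_d) : closed A ->
  measurable (A : set (borel R d)).
Proof.
move=> cA; rewrite -(setCK A); apply: measurableC; apply: borel_open.
exact: closed_openC.
Qed.

Lemma borel_continuous (f : 'rV[R]_d -> R) : continuous f ->
  measurable_fun setT (f : borel R d -> R).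
Proof.
move=> /continuousP cf; apply: (measurability _ (RGenOpens.measurableE R)).
move=> _ [_ [a [b ->] <-]]; rewrite setTI; apply: borel_open.
exact/cf/interval_open.
Qed.

Lemma curve_measurable (gamma : R -> 'rV[R]_d) : continuous gamma ->
  measurable_fun setT (gamma : measurableTypeR R -> borel R d).
Proof.
move=> /continuousP cg; 
apply: (@measurability _ _ (measurableTypeR R) (borel R d) setT gamma
  (@open 'rV[R]_d)) => //.
by move=> _ [B oB <-]; rewrite setTI; apply: open_measurable; exact: cg.
Qed.

End BorelContinuous.

Section CompactPairing.
Variables (R : realType) (d : nat).
Variables (mu : {finite_measure set (borel R d) -> \bar R}) (K : set 'rV[R]_d).
Hypotheses (cK : compact K) (muK : concentrated mu K).
Implicit Types f g : 'rV[R]_d -> R.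

Let mK : measurable (K : set (borel R d)).
Proof.
apply: borel_closed.
exact: (compact_closed (@norm_hausdorff R 'rV[R]_d) cK).
Qed.

Let KE : [set: borel R d] `\` ~` K = K.
Proof. by rewrite setDE setCK setTI. Qed.

Lemma compact_integrable f : continuous f -> mu.-integrable setT (EFin \o f).
Proof.
move=> cf; have mf := borel_continuous cf.
have mNK : measurable (~` K : set (borel R d)) by exact: measurableC.
have mEf : measurable_fun setT (EFin \o (f : borel R d -> R)).
  exact/measurable_EFinP.
apply/(negligible_integrable mNK measurableT mEf muK).
rewrite KE; apply: measurable_bounded_integrable => //.
- by rewrite ltey_eq fin_num_measure.
- exact: measurable_funTS.
- have [C fC] := compact_bounded_on cf cK; exists C; split; first exact: num_real.
  by move=> M CM x Kx; apply: le_trans (fC x Kx) (ltW CM).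
Qed.

Lemma pairingE f : continuous f -> pairing mu f = \int[mu]_(x in K) f x.
Proof.
move=> cf; rewrite /pairing /Rintegral; congr fine.
have mNK : measurable (~` K : set (borel R d)) by exact: measurableC.
by rewrite (negligible_integral mNK measurableT (compact_integrable cf) muK) KE.
Qed.

Lemma pairingD f g : continuous f -> continuous g ->
  pairing mu (fun x => f x + g x) = pairing mu f + pairing mu g.
Proof. by move=> cf cg; apply: RintegralD => //; exact: compact_integrable. Qed.

Lemma pairingB f g : continuous f -> continuous g ->
  pairing mu (fun x => f x - g x) = pairing mu f - pairing mu g.
Proof. by move=> cf cg; apply: RintegralB => //; exact: compact_integrable. Qed.

Lemma pairingZ a f : continuous f ->
  pairing mu (fun x => a * f x) = a * pairing mu f.
Proof. by move=> cf; apply: RintegralZl => //; exact: compact_integrable. Qed.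

Lemma pairing_ge0 f : continuous f -> (forall x, K x -> 0 <= f x) ->
  0 <= pairing mu f.
Proof. by move=> cf f0; rewrite pairingE//; exact: Rintegral_ge0. Qed.

Lemma pairing_le f g : continuous f -> continuous g ->
  (forall x, K x -> f x <= g x) -> pairing mu f <= pairing mu g.
Proof.
move=> cf cg fg; rewrite -subr_ge0 -pairingB//; apply: pairing_ge0.
  exact: subf_continuous.
by move=> x Kx; rewrite subr_ge0 fg.
Qed.

End CompactPairing.

Lemma pairing_mscale (R : realType) d (P : {finite_measure set (borel R d) -> \bar R})
    (c : {nonneg R}) (f : 'rV[R]_d -> R) : continuous f ->
  P.-integrable setT (EFin \o f) ->
  pairing (mscale c P) f = c%:num * pairing P f.
Proof.
move=> cf iPf; have mf := borel_continuous cf.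
have mEf : measurable_fun setT (EFin \o (f : borel R d -> R)).
  exact/measurable_EFinP.
rewrite /pairing /Rintegral integralE.
rewrite ge0_integral_mscale//; last exact: measurable_funepos.
rewrite ge0_integral_mscale//; last exact: measurable_funeneg.
rewrite -muleBr//; last first.
  apply: fin_num_adde_defl; rewrite fin_numN.
  exact: integrable_neg_fin_num.
by rewrite -integralE fineM//; exact: integrable_fin_num.
Qed.

Section DistanceToSet.
Variables (R : realType) (V : normedModType R) (K : set V).

Definition set_dist (x : V) : R := locked (inf [set `|x - y| | y in K]).

Hypothesis K0 : K !=set0.

Let dist_has_inf x : has_inf [set `|x - y| | y in K].
Proof.
split; last by exists 0 => _ [y _ <-].
by have [y Ky] := K0; exists `|x - y|, y.
Qed.

Lemma set_dist_ge0 x : 0 <= set_dist x.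
Proof.
rewrite /set_dist -lock; apply: lb_le_inf; first by case: (dist_has_inf x).
by move=> _ [y _ <-].
Qed.

Lemma set_dist0 x : K x -> set_dist x = 0.
Proof.
move=> Kx; apply/eqP; rewrite eq_le set_dist_ge0 andbT /set_dist -lock.
apply: ge_inf; first by case: (dist_has_inf x).
by exists x => //; rewrite subrr normr0.
Qed.

Lemma set_dist_lipschitz x y : `|set_dist x - set_dist y| <= `|x - y|.
Proof.
wlog : x y / set_dist y <= set_dist x => [hw|yx].
  have [|/ltW xy] := leP (set_dist y) (set_dist x); first exact: hw.
  by rewrite distrC [leRHS]distrC; exact: hw.
rewrite ger0_norm ?subr_ge0// lerBlDr -lerBlDl.
rewrite {2}/set_dist -lock; apply: lb_le_inf; first by case: (dist_has_inf y).
move=> _ [z Kz <-]; rewrite lerBlDl.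
apply: le_trans (ler_distD y x z); rewrite /set_dist -lock.
by apply: ge_inf; [case: (dist_has_inf x)|exists z].
Qed.

Lemma set_dist_continuous : continuous set_dist.
Proof.
move=> x; apply/cvgrPdist_lt => e e0; near=> y.
by apply: le_lt_trans (set_dist_lipschitz x y) _; near: y; exact: cvgr_dist_lt.
Unshelve. all: by end_near. Qed.

Lemma set_dist_gt0 x : closed K -> ~ K x -> 0 < set_dist x.
Proof.
move=> cK nKx; rewrite lt_neqAle set_dist_ge0 andbT eq_sym; apply/eqP => d0.
apply: nKx; apply: cK => B /nbhs_normP[e /= e0 eB].
apply: contrapT => KB; have : e <= set_dist x; last by rewrite d0 leNgt e0.
rewrite /set_dist -lock; apply: lb_le_inf; first by case: (dist_has_inf x).
move=> _ [y Ky <-]; rewrite leNgt; apply/negP => xy; apply: KB.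
by exists y; split => //; exact: eB.
Qed.

End DistanceToSet.

(** * Measures representing positive functionals *)

Section RieszRepresentation.
Variables (R : realType) (d : nat) (K : set 'rV[R]_d).
Hypothesis cK : compact K.

Let clK : closed K.
Proof. exact: (compact_closed (@norm_hausdorff R 'rV[R]_d) cK). Qed.

Let riesz_state (L : ('rV[R]_d -> R) -> R) :
  positive_functional K L -> L (fun=> 1) = 1 ->
  exists2 P : probability (borel R d) R,
    forall f, continuous f -> P.-integrable setT (EFin \o f) &
    forall f, continuous f -> pairing P f = L f.
Proof.
move=> pL L1.
have [C C0 KC] : exists2 C, 0 < C & forall x, K x -> forall j, `|x ord0 j| <= C.
  have [M [_ /(_ (`|M| + 1))]] := compact_bounded cK.
  rewrite (le_lt_trans (ler_norm M)) ?ltrDl// => /(_ isT) h.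
  exists (`|M| + 1) => [|x /h]; first by rewrite ltr_pwDr.
  by move=> xM j; apply: le_trans xM; exact: row_coord_le.
have [gamma [cg gC gsurj]] := space_filling_curve d C0.
(* [psi] is an arbitrary choice function; the measurability required by the pushforward is that of
   the continuous curve [gamma]. *)
have /choice[psi psiP] : forall x : 'rV[R]_d, exists s,
    K x -> 0 <= s <= 1 /\ gamma s = x.
  move=> x; have [Kx|nKx] := pselect (K x); last by exists 0.
  by have [s s01 <-] := gsurj x (KC x Kx); exists s.
have psi01 x : K x -> 0 <= psi x <= 1 by move=> /psiP[].
pose Q := state_distribution pL L1 psi01.
have mg := curve_measurable cg.
pose X : {mfun measurableTypeR R >-> borel R d} :=
  MeasurableFun.Pack (MeasurableFun.Class
    (isMeasurableFun.Build _ _ (measurableTypeR R) (borel R d) gamma mg)).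
have cfg (f : 'rV[R]_d -> R) : continuous f -> continuous (f \o gamma).
  by move=> cf; exact: (compf_continuous cg cf).
have bfg (f : 'rV[R]_d -> R) : continuous f -> exists B, forall s, `|(f \o gamma) s| <= B.
  move=> cf.
  have cube : compact [set x : 'rV[R]_d | forall j, `[- C, C]%classic (x ord0 j)].
    by apply: (@rV_compact R d (fun=> `[- C, C]%classic)) => _; exact: segment_compact.
  have [B fB] := compact_bounded_on cf cube; exists B => s; apply: fB => j /=.
  by rewrite in_itv/= -ler_norml gC.
have ifg (f : 'rV[R]_d -> R) : continuous f -> Q.-integrable setT (EFin \o (f \o gamma)).
  move=> cf; apply: measurable_bounded_integrable => //.
  - by rewrite (le_lt_trans (probability_le1 Q measurableT))// ltry.
  - by apply: continuous_measurable_fun; exact: cfg.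
  - have [B fB] := bfg f cf; exists B; split; first exact: num_real.
    by move=> M BM s _; apply: le_trans (fB s) (ltW BM).
have mf (f : 'rV[R]_d -> R) : continuous f -> measurable_fun setT (EFin \o (f : borel R d -> R)).
  by move=> cf; apply/measurable_EFinP; exact: borel_continuous.
exists (distribution Q X) => f cf.
  by apply: integrable_pushforward => //; [exact: mf|exact: ifg].
transitivity (\int[Q]_s (f \o gamma) s).
  rewrite /pairing /Rintegral; congr fine.
  exact: (@integral_pushforward _ _ _ _ _ _ mg Q setT _ (mf f cf) (ifg f cf) measurableT).
rewrite state_distribution_integral; [|exact: cfg|exact: bfg].
apply: (functional_eq pL).
  by have [B fB] := bfg f cf; exists B => x _; exact: fB.
by move=> x Kx /=; have [_ ->] := psiP x Kx.
Qed.

Theorem riesz_representation (L : ('rV[R]_d -> R) -> R) :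
  positive_functional K L ->
  exists2 mu : {finite_measure set (borel R d) -> \bar R}, concentrated mu K &
    forall f, continuous f -> pairing mu f = L f.
Proof.
move=> pL; have L1_ge0 : 0 <= L (fun=> 1).
  by apply: (functional_ge0 pL) => [|x _]; [exact: bounded_on_cst|exact: ler01].
have bf (f : 'rV[R]_d -> R) : continuous f -> bounded_on K f.
  by move=> cf; exact: compact_bounded_on.
have [L10|L1_neq0] := eqVneq (L (fun=> 1)) 0.
  exists (mscale (0%R)%:nng (dirac (0 : borel R d))).
    by rewrite /concentrated/= /mscale/= mul0e.
  move=> f cf; have mf := borel_continuous cf.
  rewrite pairing_mscale//; last first.
    apply/integrableP; split; first exact/measurable_EFinP.
    have mEf : measurable_fun setT (EFin \o (f : borel R d -> R)).
      exact/measurable_EFinP.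
    rewrite integral_dirac//; last exact: measurableT_comp.
    by rewrite diracT mul1e/= ltry.
  rewrite mul0r; have [C fC] := bf f cf; apply/esym/eqP; rewrite -normr_le0.
  rewrite -(mulr0 C) -L10 -(functional_cst pL).
  by apply: (functional_norm pL) => //; [exact: bf|exact: bounded_on_cst].
have L1_gt0 : 0 < L (fun=> 1) by rewrite lt_neqAle eq_sym L1_neq0.
set m := L (fun=> 1) in L1_ge0 L1_neq0 L1_gt0.
have K0 : K !=set0.
  apply: contrapT => noK; move/eqP : L1_neq0; apply; rewrite -(functional0 pL).
  apply: (functional_eq pL); first exact: bounded_on_cst.
  by move=> x Kx; case: noK; exists x.
have [||P iP PL] := riesz_state (L := fun f => m^-1 * L f).
- split.
  + by move=> f g ff gg; rewrite (functionalD pL)// mulrDr.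
  + by move=> a f ff; rewrite (functionalZ pL)// mulrCA.
  + move=> f ff f0; rewrite mulr_ge0 ?invr_ge0//; exact: (functional_ge0 pL).
- by rewrite mulVf.
pose mu : {finite_measure set (borel R d) -> \bar R} := mscale (NngNum L1_ge0) P.
have muL (f : 'rV[R]_d -> R) : continuous f -> pairing mu f = L f.
  by move=> cf; rewrite /mu pairing_mscale//=; [rewrite PL// mulVKf|exact: iP].
exists mu => //.
(* Concentration is tested on the distance to [K]: its integral is the value of the functional on a
   function vanishing on [K], hence 0, and it is positive off the closed set [K]. *)
have cd := set_dist_continuous K0.
have d0 : pairing P (set_dist K) = 0.
  rewrite PL// -(mulr0 m^-1); congr (_ * _); rewrite -(functional0 pL).
  apply: (functional_eq pL); first exact: bf.
  by move=> x Kx; rewrite set_dist0.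
have md : measurable_fun setT (EFin \o (set_dist K : borel R d -> R)).
  by apply/measurable_EFinP; exact: borel_continuous.
have : (\int[P]_x `|(EFin \o set_dist K) x|)%E = 0%E.
  have dE : (\int[P]_x `|(EFin \o set_dist K) x| = \int[P]_x (set_dist K x)%:E)%E.
    by apply: eq_integral => x _ /=; rewrite ger0_norm// set_dist_ge0.
  rewrite dE -[LHS]fineK; first by rewrite -/(Rintegral _ _ _); congr EFin.
  exact: integrable_fin_num (iP _ cd).
move=> /(ae_eq_integral_abs P measurableT md)[N [mN PN0 subN]].
rewrite /concentrated /mu/= /mscale/=.
suff -> : P (~` K) = 0%E by rewrite mule0.
apply/eqP; rewrite -measure_le0 -PN0; apply: le_measure; rewrite ?inE//.
  by apply: measurableC; exact: borel_closed.
move=> x nKx; apply: subN => /(_ I)/= [] d00.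
by have := set_dist_gt0 K0 clK nKx; rewrite d00 ltxx.
Qed.

End RieszRepresentation.

(** * Density of polynomials in C^1 *)

Section Casteljau.
Variable R : realType.
Implicit Types (F G : nat -> R) (s : R) (n : nat).

(* De Casteljau's recursion for the value at s of the Bernstein polynomial with
   coefficients F 0, ..., F n. *)
Fixpoint casteljau n F s : R :=
  if n is m.+1 then
    (1 - s) * casteljau m F s + s * casteljau m (fun k => F k.+1) s
  else F 0%N.

Lemma casteljauD n F G s :
  casteljau n (fun k => F k + G k) s = casteljau n F s + casteljau n G s.
Proof. by elim: n F G => [//|n ih] F G /=; rewrite !ih; ring. Qed.

Lemma casteljauZ n a F s :
  casteljau n (fun k => a * F k) s = a * casteljau n F s.
Proof. by elim: n F => [//|n ih] F /=; rewrite !ih; ring. Qed.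

Lemma casteljau_cst n a s : casteljau n (fun=> a) s = a.
Proof. by elim: n => [//|n ih] /=; rewrite !ih; ring. Qed.

Lemma casteljau_eq n F G s : (forall k, (k <= n)%N -> F k = G k) ->
  casteljau n F s = casteljau n G s.
Proof.
elim: n F G => [|n ih] F G FG /=; first exact: FG.
congr (_ * _ + _ * _); apply: ih => k kn; apply: FG => //; exact: leqW.
Qed.

Lemma casteljau_le n F G s : 0 <= s <= 1 -> (forall k, (k <= n)%N -> F k <= G k) ->
  casteljau n F s <= casteljau n G s.
Proof.
move=> /andP[s0 s1]; elim: n F G => [|n ih] F G FG /=; first exact: FG.
apply: lerD; apply: ler_wpM2l; rewrite ?subr_ge0//; apply: ih => k kn;
  apply: FG => //; exact: leqW.
Qed.

(** For c = - n s this is the variance n s (1 - s) of the binomial law. The shift c is left free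
    because the recursion replaces k by k + 1. *)
Lemma casteljau_second_moment n c s :
  casteljau n (fun k => (k%:R + c) ^+ 2) s = (n%:R * s + c) ^+ 2 + n%:R * s * (1 - s).
Proof.
elim: n c => [|n ih] c /=; first by ring.
have -> : (fun k => (k.+1%:R + c) ^+ 2) = (fun k : nat => (k%:R + (1 + c)) ^+ 2).
  by apply/funext => k; rewrite -natr1 addrA.
rewrite !ih -natr1; ring.
Qed.

(** Bernstein's argument by Chebyshev's inequality. The nodes may move by 1/n so that the estimate
    also covers derivatives, whose nodes come from the mean value theorem. *)
Lemma casteljau_approx (h : R -> R) (eta : nat -> R) s n e B d :
  0 <= s <= 1 -> 0 < d -> 0 <= e -> (0 < n)%N -> n%:R^-1 < d / 2 ->
  (forall k, (k <= n)%N -> 0 <= eta k <= 1 /\ `|eta k - k%:R / n%:R| <= n%:R^-1) ->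
  (forall r, 0 <= r <= 1 -> `|h r| <= B) ->
  (forall r, 0 <= r <= 1 -> `|r - s| < d -> `|h r - h s| <= e) ->
  `|casteljau n (fun k => h (eta k)) s - h s| <= e + 8 * B / d ^+ 2 / n%:R.
Proof.
move=> s01 d0 e0 n0 nd etaP hB hd; have [s0 s1] := andP s01.
have nR : 0 < n%:R :> R by rewrite ltr0n.
have B0 : 0 <= B by apply: le_trans (hB s s01).
(* Chosen so that c (d / 2)^2 = 2 B, the trivial bound used when k / n is at distance at least d / 2
   from s. *)
set c := 8 * B / d ^+ 2.
have c0 : 0 <= c by rewrite divr_ge0// ?exprn_ge0 ?mulr_ge0// ltW.
pose G (k : nat) := e + c / n%:R ^+ 2 * (k%:R - n%:R * s) ^+ 2.
have GE : casteljau n G s = e + c / n%:R ^+ 2 * (n%:R * s * (1 - s)).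
  rewrite /G (casteljauD n (fun=> e)) casteljau_cst casteljauZ; congr (_ + _ * _).
  by rewrite (casteljau_second_moment n (- (n%:R * s))) subrr expr0n/= add0r.
have Gle : casteljau n G s <= e + c / n%:R.
  rewrite GE lerD2l.
  have -> : c / n%:R ^+ 2 * (n%:R * s * (1 - s)) = c / n%:R * (s * (1 - s)).
    by field; rewrite gt_eqF.
  apply: ler_piMr; first by apply: divr_ge0 => //; exact: ltW.
  by apply: mulr_ile1; rewrite ?subr_ge0 ?gerBl.
have key k : (k <= n)%N -> `|h (eta k) - h s| <= G k.
  move=> kn; have [eta01 etak] := etaP k kn.
  have [near_|far] := ltP `|eta k - s| d.
    apply: le_trans (hd _ eta01 near_) _; rewrite lerDl mulr_ge0 ?sqr_ge0//.
    by rewrite divr_ge0// sqr_ge0.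
  have dk : d / 2 <= `|k%:R / n%:R - s|.
    have := ler_distD (k%:R / n%:R) (eta k) s; lra.
  apply: (@le_trans _ _ (B + B)).
    by apply: le_trans (ler_normB _ _) _; apply: lerD; exact: hB.
  have dk2 : (d / 2) ^+ 2 <= (k%:R / n%:R - s) ^+ 2.
    rewrite -[leRHS]real_normK ?num_real// ler_sqr ?nnegrE//.
    by rewrite divr_ge0// ltW.
  have E : c / n%:R ^+ 2 * (k%:R - n%:R * s) ^+ 2 = c * (k%:R / n%:R - s) ^+ 2.
    by field; rewrite gt_eqF.
  rewrite /G E; apply: (@le_trans _ _ (c * (d / 2) ^+ 2)).
    have -> : c * (d / 2) ^+ 2 = B + B by rewrite /c; field; rewrite gt_eqF.
    by [].
  by apply: ler_wpDl => //; exact: ler_wpM2l.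
have Ehs : casteljau n (fun k => h (eta k)) s - h s =
    casteljau n (fun k => h (eta k) + - h s) s.
  by rewrite casteljauD casteljau_cst.
rewrite Ehs; apply: le_trans Gle; rewrite ler_norml; apply/andP; split.
  rewrite -mulN1r -casteljauZ; apply: casteljau_le => // k /key.
  by rewrite ler_norml mulN1r => /andP[].
by apply: casteljau_le => // k /key; rewrite ler_norml => /andP[].
Qed.

End Casteljau.

Section PointwiseDerivative.
Variables (R : realType) (V : normedModType R).
Implicit Types (f g : V -> R) (x v : V).

Lemma is_derive_addf f g x v (df dg : R) :
  is_derive x v f df -> is_derive x v g dg ->
  is_derive x v (fun y => f y + g y) (df + dg).
Proof. by move=> hf hg; exact: (@is_deriveD _ _ _ f g x v df dg). Qed.

Lemma is_derive_subf f g x v (df dg : R) :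
  is_derive x v f df -> is_derive x v g dg ->
  is_derive x v (fun y => f y - g y) (df - dg).
Proof. by move=> hf hg; exact: (@is_deriveB _ _ _ f g x v df dg). Qed.

Lemma is_derive_mulf f g x v (df dg : R) :
  is_derive x v f df -> is_derive x v g dg ->
  is_derive x v (fun y => f y * g y) (df * g x + f x * dg).
Proof.
move=> hf hg; have := @is_deriveM _ _ f g x v df dg hf hg.
by rewrite /GRing.scale/= addrC (mulrC (g x)).
Qed.

Lemma is_derive_cstf (a : R) x v : is_derive x v (fun=> a) 0.
Proof. exact: is_derive_cst. Qed.

(** Coefficients and argument both vary with the point. The second term is the classical derivative,
    n times the polynomial of degree n - 1 on the forward differences; for n = 0 the factor n
    cancels it. *)
Lemma is_derive_casteljau n (F : nat -> V -> R) (s : V -> R) x v (F' : nat -> R) s' :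
  (forall k, is_derive x v (F k) (F' k)) -> is_derive x v s s' ->
  is_derive x v (fun y => casteljau n (fun k => F k y) (s y))
    (casteljau n F' (s x) +
     s' * (n%:R * casteljau n.-1 (fun k => F k.+1 x - F k x) (s x))).
Proof.
move=> + hs; elim: n F F' => [|n ih] F F' hF /=.
  by rewrite mul0r mulr0 addr0; exact: hF.
have h0 := ih F F' hF.
have h1 := ih (fun k => F k.+1) (fun k => F' k.+1) (fun k => hF k.+1).
have hs1 := is_derive_subf (is_derive_cstf 1 x v) hs.
have := is_derive_addf (is_derive_mulf hs1 h0) (is_derive_mulf hs h1).
move=> /is_derive_eq; apply; rewrite sub0r.
have dlt : casteljau n (fun k => F k.+1 x - F k x) (s x) =
   casteljau n (fun k => F k.+1 x) (s x) - casteljau n (fun k => F k x) (s x).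
  rewrite -[X in _ - X]mul1r -mulNr -casteljauZ -casteljauD.
  by apply: casteljau_eq => k _; rewrite mulN1r.
case: n {ih h0 h1} dlt => [|n] dlt.
  by rewrite /=; ring.
have E : casteljau n.+1 (fun k => F k.+1 x - F k x) (s x) =
  (1 - s x) * casteljau n (fun k => F k.+1 x - F k x) (s x) +
  s x * casteljau n (fun k => F k.+2 x - F k.+1 x) (s x) by [].
have -> : forall X : R, n.+2%:R * X = n.+1%:R * X + X by move=> X; rewrite -natr1; ring.
by rewrite {2}dlt E [n.+1.-1]/=; ring.
Qed.

End PointwiseDerivative.

(** * Functions with continuous partial derivatives *)

Section PartiallyC1.
Variables (R : realType) (d : nat).
Local Notation V := 'rV[R]_d.
Local Notation basis a := (delta_mx ord0 a : 'rV[R]_d).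
Implicit Types (f g : V -> R) (a b : 'I_d) (x : V).

(** A directional derivative only sees the function along one line, so it can be carried to another
    function, or another space, with the same values there. *)
Lemma is_derive_transfer (U W : normedModType R) (f : U -> R) (g : W -> R)
    (x v : U) (y w : W) (df : R) :
  (forall h : R, f (h *: v + x) = g (h *: w + y)) ->
  is_derive y w g df -> is_derive x v f df.
Proof.
move=> fg [gd gE].
have E : (fun h : R => h^-1 *: ((f \o shift x) (h *: v) - f x)) =
         (fun h => h^-1 *: ((g \o shift y) (h *: w) - g y)).
  apply/funext => h /=; rewrite fg; congr (_ *: (_ - _)).
  by have := fg 0; rewrite !scale0r !add0r.
by split; rewrite /derivable /derive E.
Qed.

Definition update a (r : R) x : V := \row_b (if b == a then r else x ord0 b).

Lemma update_id a x : update a (x ord0 a) x = x.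
Proof. by apply/rowP => b; rewrite mxE; case: eqP => [->|]. Qed.

Lemma update_shift a b r h x : a != b ->
  update a r (h *: basis b + x) = h *: basis b + update a r x.
Proof.
move=> ab; apply/rowP => c; rewrite !mxE eqxx/=.
by case: (eqVneq c a) => [->|//]; rewrite (negbTE ab) mulr0 add0r.
Qed.

Lemma update_shift_same a r h x : update a r (h *: basis a + x) = update a r x.
Proof.
apply/rowP => c; rewrite !mxE eqxx/=.
by case: (eqVneq c a) => [//|_]; rewrite mulr0 add0r.
Qed.

Lemma update_direction a r h x :
  update a (h *: (1 : R^o) + r) x = h *: basis a + update a r x.
Proof.
apply/rowP => c; rewrite !mxE eqxx/= /GRing.scale/= mulr1.
by case: (eqVneq c a) => [_|_]; rewrite ?mulr1// mulr0 add0r.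
Qed.

Lemma update_update a r r' x : update a r (update a r' x) = update a r x.
Proof. by apply/rowP => b; rewrite !mxE; case: eqP. Qed.

Lemma update_comm a b r r' x : a != b ->
  update a r (update b r' x) = update b r' (update a r x).
Proof.
move=> ab; apply/rowP => c; rewrite !mxE.
by case: (eqVneq c a) => [->|//]; rewrite (negbTE ab).
Qed.

Lemma update_continuous a r : continuous (update a r).
Proof.
apply: row_continuous => b; under eq_fun do rewrite mxE.
case: (b == a); first exact: cstf_continuous.
exact: coord_continuous.
Qed.

Lemma update_dist a r x : `|x - update a r x| <= `|x ord0 a - r|.
Proof.
apply/ler_addgt0Pr => e e0; apply/ltW; apply: row_norm_lt => [|b].
  by rewrite ltr_wpDl.
rewrite !mxE; case: eqP => [->|_]; first by rewrite ltrDl.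
by rewrite subrr normr0 ltr_wpDl.
Qed.

Lemma is_derive_coord x a b :
  is_derive x (basis a) (fun y : V => y ord0 b) (a == b)%:R.
Proof.
pose c : R := (a == b)%:R.
apply: (@is_derive_transfer V R _ (fun t : R => t * c + x ord0 b) x (basis a) 0 1).
  move=> h; rewrite !mxE eqxx/= addr0 /c eq_sym.
  by rewrite /GRing.scale/= mulr1.
have := is_derive_addf (is_derive_mulf (is_derive_id (0 : R) 1) (is_derive_cstf c (0 : R) 1))
  (is_derive_cstf (x ord0 b) (0 : R) 1).
by move=> /is_derive_eq; apply; rewrite mulr0 !addr0 mul1r.
Qed.

Lemma is_derive_update_same f a r x :
  is_derive x (basis a) (fun y => f (update a r y)) 0.
Proof.
apply: (@is_derive_transfer V V _ (fun=> f (update a r x)) x (basis a) x (basis a)).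
by move=> h; rewrite update_shift_same.
Qed.

Lemma is_derive_update f a b r x df : a != b ->
  is_derive (update a r x) (basis b) f df ->
  is_derive x (basis b) (fun y => f (update a r y)) df.
Proof.
by move=> ab; apply: is_derive_transfer => h; rewrite update_shift.
Qed.

Lemma is_derive_along f a r x df :
  is_derive (update a r x) (basis a) f df ->
  is_derive r 1 (fun t => f (update a t x)) df.
Proof. by apply: is_derive_transfer => h; rewrite update_direction. Qed.

(* C^1 in the sense of partial derivatives only. *)
Definition pC1 f := continuous f /\ forall a,
  (forall x, derivable f x (basis a)) /\
  continuous (fun x => 'D_(basis a) f x).

Lemma pC1_is_derive f a x : pC1 f -> is_derive x (basis a) f ('D_(basis a) f x).
Proof. by move=> [_ /(_ a)[df _]]; exact: derivableP. Qed.

Lemma pC1_intro f (df : 'I_d -> V -> R) : continuous f ->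
  (forall a x, is_derive x (basis a) f (df a x)) ->
  (forall a, continuous (df a)) -> pC1 f.
Proof.
move=> cf fdf cdf; split=> // a; split; first by move=> x; case: (fdf a x).
have -> : (fun x => 'D_(basis a) f x) = df a.
  by apply/funext => x; case: (fdf a x).
exact: cdf.
Qed.

Lemma C1_pC1 f : C1 f -> pC1 f.
Proof.
move=> [df cf]; split; first by move=> x; exact: differentiable_continuous.
by move=> a; split; [move=> x; exact: diff_derivable|exact: cf].
Qed.

Lemma pC1D f g : pC1 f -> pC1 g -> pC1 (fun x => f x + g x).
Proof.
move=> Cf Cg; have [cf df] := Cf; have [cg dg] := Cg.
apply: (pC1_intro (df := fun a x => 'D_(basis a) f x + 'D_(basis a) g x)).
- exact: addf_continuous.
- by move=> a x; apply: is_derive_addf; exact: pC1_is_derive.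
- by move=> a; apply: addf_continuous; [case: (df a)|case: (dg a)].
Qed.

Lemma pC1M f g : pC1 f -> pC1 g -> pC1 (fun x => f x * g x).
Proof.
move=> Cf Cg; have [cf df] := Cf; have [cg dg] := Cg.
apply: (pC1_intro (df := fun a x => 'D_(basis a) f x * g x + f x * 'D_(basis a) g x)).
- exact: mulf_continuous.
- by move=> a x; apply: is_derive_mulf; exact: pC1_is_derive.
- by move=> a; apply: addf_continuous; apply: mulf_continuous => //;
    [case: (df a)|case: (dg a)].
Qed.

Lemma pC1_update f a r : pC1 f -> pC1 (fun x => f (update a r x)).
Proof.
move=> Cf; have [cf df] := Cf; have cu : continuous (update a r) by exact: update_continuous.
apply: (pC1_intro (df := fun b x =>
  if a == b then 0 else 'D_(basis b) f (update a r x))).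
- exact: (compf_continuous cu cf).
- move=> b x; case: (eqVneq a b) => [<-|ab]; first exact: is_derive_update_same.
  by apply: is_derive_update => //; exact: pC1_is_derive.
- move=> b; case: (eqVneq a b) => [_|_]; first exact: cstf_continuous.
  by have [_ cb] := df b; exact: (compf_continuous cu cb).
Qed.

Lemma pC1_mvt f a r r' x : pC1 f -> r < r' ->
  exists2 c, r < c < r' &
    f (update a r' x) - f (update a r x) =
    'D_(basis a) f (update a c x) * (r' - r).
Proof.
move=> Cf rr'.
have [||c] := @MVT R (fun t => f (update a t x))
  (fun t => 'D_(basis a) f (update a t x)) r r' rr'.
- by move=> t _; apply: is_derive_along; exact: pC1_is_derive.
- apply: continuous_subspaceT => t.
  have : is_derive t 1 (fun t => f (update a t x)) ('D_(basis a) f (update a t x)).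
    by apply: is_derive_along; exact: pC1_is_derive.
  by case=> /derivable1_diffP dt _; exact: differentiable_continuous.
- by rewrite in_itv/= => cr E; exists c.
Qed.

End PartiallyC1.

(** * Polynomials as functions *)

Section PolynomialFunctions.
Variables (R : realType) (d : nat).
Implicit Types (p q : mpoly d R) (x : 'rV[R]_d).

Lemma pevalD p q x : peval (p + q) x = peval p x + peval q x.
Proof. exact: mevalD. Qed.

Lemma pevalM p q x : peval (p * q) x = peval p x * peval q x.
Proof. exact: mevalM. Qed.

Lemma pevalB p q x : peval (p - q) x = peval p x - peval q x.
Proof. exact: mevalB. Qed.

Lemma pevalZ c p x : peval (c *: p) x = c * peval p x.
Proof. exact: mevalZ. Qed.

Lemma pevalC (c : R) x : peval (mpolyC d c) x = c.
Proof. exact: mevalC. Qed.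

Lemma peval0 x : peval 0 x = 0.
Proof. exact: meval0. Qed.

Lemma peval_pvar a x : peval (pvar a) x = x ord0 a.
Proof. exact: mevalXU. Qed.

Lemma pevalX p k x : peval (p ^+ k) x = peval p x ^+ k.
Proof. exact: (rmorphXn (meval (fun a => x ord0 a))). Qed.

Lemma peval_sum (I : Type) (r : seq I) (P : pred I) (F : I -> mpoly d R) x :
  peval (\sum_(i <- r | P i) F i) x = \sum_(i <- r | P i) peval (F i) x.
Proof. exact: (raddf_sum (meval (fun a => x ord0 a))). Qed.

Lemma peval_psubst n' (s : 'I_d -> mpoly n' R) p (z : 'rV[R]_n') :
  peval (psubst s p) z = peval p (\row_a peval (s a) z).
Proof.
rewrite /peval /psubst comp_mpoly_meval; apply: meval_eq => a.
by rewrite mxE tnth_mktuple.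
Qed.

Lemma mpoly_ind_ring (P : mpoly d R -> Prop) :
  (forall c, P (mpolyC d c)) -> (forall a, P (pvar a)) ->
  (forall p q, P p -> P q -> P (p + q)) ->
  (forall p q, P p -> P q -> P (p * q)) -> forall p, P p.
Proof.
move=> PC PX PD PM p.
have P0 : P 0 by have := PC 0; rewrite mpolyC0.
have P1 : P 1 by have := PC 1; rewrite mpolyC1.
rewrite (mpolyE p).
elim/big_ind : _ => [//| |m _]; first exact: PD.
rewrite -mul_mpolyC; apply: (PM) => //; rewrite mpolyXE_id.
elim/big_ind : _ => [//| |a _]; first exact: PM.
elim: (fun_of_multinom m a) => [|k ih]; last by rewrite exprS; exact: (PM _ _ (PX a) ih).
by rewrite expr0.
Qed.

Lemma is_derive_peval p x a :
  is_derive x (delta_mx ord0 a : 'rV[R]_d) (peval p) (peval (mderiv a p) x).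
Proof.
elim/mpoly_ind_ring: p => [c|b|p q ihp ihq|p q ihp ihq].
- have -> : peval (mpolyC d c) = fun=> c by apply/funext => y; rewrite pevalC.
  by rewrite mderivC peval0; exact: is_derive_cstf.
- have -> : peval (pvar b) = fun y : 'rV[R]_d => y ord0 b.
    by apply/funext => y; rewrite peval_pvar.
  apply: is_derive_eq (is_derive_coord x a b) _.
  rewrite /pvar mderivX mnm1E pevalZ eq_sym.
  case: eqP => [->|_]; last by rewrite mul0r.
  by rewrite -[X in mnm_sub X _]add0m addmK mpolyX0 /peval meval1 mulr1.
- have -> : peval (p + q) = fun y => peval p y + peval q y.
    by apply/funext => y; rewrite pevalD.
  by rewrite mderivD pevalD; exact: is_derive_addf.
- have -> : peval (p * q) = fun y => peval p y * peval q y.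
    by apply/funext => y; rewrite pevalM.
  by rewrite mderivM pevalD !pevalM; exact: is_derive_mulf.
Qed.

Lemma derive_peval p x a :
  'D_(delta_mx ord0 a) (peval p) x = peval (mderiv a p) x.
Proof. by have [_] := is_derive_peval p x a. Qed.

Lemma peval_differentiable p x : differentiable (peval p) x.
Proof.
elim/mpoly_ind_ring: p => [c|b|p q ihp ihq|p q ihp ihq].
- have -> : peval (mpolyC d c) = fun=> c by apply/funext => y; rewrite pevalC.
  exact: differentiable_cst.
- have -> : peval (pvar b) = fun y : 'rV[R]_d => y ord0 b.
    by apply/funext => y; rewrite peval_pvar.
  exact: differentiable_coord.
- have -> : peval (p + q) = peval p + peval q.
    by apply/funext => y; rewrite pevalD.
  exact: differentiableD.
- have -> : peval (p * q) = peval p * peval q.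
    by apply/funext => y; rewrite pevalM.
  exact: differentiableM.
Qed.

Lemma peval_continuous p : continuous (peval p).
Proof. by move=> x; apply: differentiable_continuous; exact: peval_differentiable. Qed.

Lemma C1_peval p : C1 (peval p).
Proof.
split; first exact: peval_differentiable.
move=> a; under eq_fun do rewrite derive_peval; exact: peval_continuous.
Qed.

End PolynomialFunctions.

(** * Bernstein approximation, one coordinate at a time *)

Section Density.
Variables (R : realType) (d : nat) (C : R).
Hypothesis C0 : 0 < C.
Local Notation V := 'rV[R]_d.
Local Notation basis a := (delta_mx ord0 a : 'rV[R]_d).
Implicit Types (f g : V -> R) (a b : 'I_d) (x : V) (S : seq 'I_d).

Definition cube : set V := [set x | forall j, `|x ord0 j| <= C].

Lemma cube_compact : compact cube.
Proof.
have -> : cube = [set x : V | forall j, `[- C, C]%classic (x ord0 j)].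
  apply/seteqP; split=> x /= h j; first by rewrite /= in_itv/= -ler_norml.
  by have := h j; rewrite /= in_itv/= -ler_norml.
by apply: (@rV_compact R d (fun=> `[- C, C]%classic)) => _; exact: segment_compact.
Qed.

Let node (r : R) := 2 * C * r - C.
Let param a x := (x ord0 a + C) / (2 * C).

Let C2 : 0 < 2 * C. Proof. by rewrite mulr_gt0. Qed.

Let param01 a x : cube x -> 0 <= param a x <= 1.
Proof.
move=> /(_ a); rewrite ler_norml => /andP[x1 x2].
by rewrite /param ler_pdivrMr// divr_ge0//=; lra.
Qed.

Let node_param a x : node (param a x) = x ord0 a.
Proof. by rewrite /node /param mulrC divfK ?addrK// gt_eqF. Qed.

(** The degree has to serve all x and all perturbed nodes at once, since the nodes given by the mean
    value theorem depend on x. *)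
Lemma bernstein_approx g a e : continuous g -> 0 < e ->
  exists N0, forall N, (N0 <= N)%N -> forall x, cube x -> forall eta : nat -> R,
    (forall k, (k <= N)%N -> 0 <= eta k <= 1 /\ `|eta k - k%:R / N%:R| <= N%:R^-1) ->
    `|casteljau N (fun k => g (update a (node (eta k)) x)) (param a x) - g x| <= e.
Proof.
move=> cg e0; have e20 : 0 < e / 2 by rewrite divr_gt0.
have [d0 d0_gt0 gd] := compact_uniform_continuity cg cube_compact e20.
have [B0 gB0] := compact_bounded_on cg cube_compact.
pose B := `|B0|; have gB x : cube x -> `|g x| <= B.
  by move=> /gB0 h; apply: le_trans h (ler_norm _).
pose dd := d0 / (2 * C); have dd0 : 0 < dd by rewrite divr_gt0.
pose M := Num.max (2 / dd) (2 * (8 * B / dd ^+ 2) / e).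
exists (Num.truncn M).+1 => N NM x Kx eta etaP.
have N0 : (0 < N)%N by exact: leq_trans NM.
have NR : 0 < N%:R :> R by rewrite ltr0n.
have MN : M < N%:R.
  by apply: lt_le_trans (truncnS_gt M) _; rewrite ler_nat.
have MN1 : 2 / dd < N%:R by apply: le_lt_trans MN; rewrite le_max lexx.
have MN2 : 2 * (8 * B / dd ^+ 2) / e < N%:R.
  by apply: le_lt_trans MN; rewrite le_max lexx orbT.
have Nd : N%:R^-1 < dd / 2.
  by rewrite -[dd / 2]invrK invfM invrK mulrC ltf_pV2// posrE divr_gt0.
have := @casteljau_approx R (fun r => g (update a (node r) x)) eta
  (param a x) N (e / 2) B dd (param01 a Kx) dd0 (ltW e20) N0 Nd etaP.
rewrite node_param update_id => /(_ _ _)/le_trans; apply.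
- move=> r /andP[r0 r1]; apply: gB => j; rewrite mxE; case: eqP => _; last exact: Kx.
  have h0 : 0 <= 2 * C * r by rewrite mulr_ge0// ltW.
  have h1 : 2 * C * r <= 2 * C * 1 by rewrite ler_wpM2l// ltW.
  by rewrite ler_norml /node; lra.
- move=> r r01 rs; apply: ltW; rewrite distrC; apply: gd => //.
  apply: le_lt_trans (update_dist a (node r) x) _.
  rewrite -(node_param a x) /node opprB addrA subrK -mulrBr normrM gtr0_norm//.
  by rewrite mulrC -ltr_pdivlMr// distrC.
- rewrite -lerBrDl; have -> : e - e / 2 = e / 2 by lra.
  rewrite ler_pdivrMr//; move: MN2; rewrite ltr_pdivrMr//.
  by move: (8 * B / dd ^+ 2) (N%:R : R) => u w; lra.
Qed.

Definition bernstein n a f x :=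
  casteljau n (fun k => f (update a (node (k%:R / n%:R)) x)) (param a x).

Let is_derive_param a b x :
  is_derive x (basis b) (param a) ((b == a)%:R / (2 * C)).
Proof.
have := is_derive_mulf (is_derive_addf (is_derive_coord x b a)
  (is_derive_cstf C x (basis b))) (is_derive_cstf (2 * C)^-1 x (basis b)).
by move=> /is_derive_eq; apply; rewrite mulr0 !addr0.
Qed.

(** Derivatives along other coordinates commute with the Bernstein operator. Along [a], the
    coefficients become forward differences, which the mean value theorem turns into values of the
    partial derivative at intermediate points: a Bernstein sum with perturbed nodes. *)
Lemma bernstein_pC1_approx f a e : pC1 f -> 0 < e ->
  exists n, forall x, cube x ->
    `|bernstein n a f x - f x| <= e /\
    forall b, `|'D_(basis b) (bernstein n a f) x - 'D_(basis b) f x| <= e.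
Proof.
move=> Cf e0; have [cf df] := Cf.
have [N0 H0] := bernstein_approx a cf e0.
have /choice[N1 H1] : forall b, exists N1, forall N, (N1 <= N)%N -> forall x, cube x ->
    forall eta : nat -> R, (forall k, (k <= N)%N ->
      0 <= eta k <= 1 /\ `|eta k - k%:R / N%:R| <= N%:R^-1) ->
    `|casteljau N (fun k => 'D_(basis b) f (update a (node (eta k)) x)) (param a x)
      - 'D_(basis b) f x| <= e.
  by move=> b; have [_ cb] := df b; exact: (bernstein_approx a cb e0).
(* The approximant has degree N + 1 because its derivative along [a] has degree N. *)
pose N := (N0 + \max_b N1 b).+1; exists N.+1 => x Kx.
have N0R : 0 < N%:R :> R by rewrite ltr0n.
have NR : 0 < N.+1%:R :> R by rewrite ltr0n.
have N1N b : (N1 b <= N)%N.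
  by apply: leqW; apply: leq_trans (leq_addl _ _); exact: leq_bigmax.
have nodeP k : (k <= N.+1)%N -> 0 <= (k%:R / N.+1%:R : R) <= 1 /\
    `|k%:R / N.+1%:R - k%:R / N.+1%:R : R| <= N.+1%:R^-1.
  move=> kN; rewrite subrr normr0 invr_ge0 ler0n divr_ge0 ?ler0n//=.
  by rewrite ler_pdivrMr// mul1r ler_nat.
split.
  apply: (H0 N.+1 _ x Kx (fun k => k%:R / N.+1%:R)) => //.
  by apply: leqW; apply: leqW; exact: leq_addr.
move=> b; case: (eqVneq a b) => [<-|ab]; last first.
  have : is_derive x (basis b) (bernstein N.+1 a f)
    (casteljau N.+1 (fun k => 'D_(basis b) f (update a (node (k%:R / N.+1%:R)) x))
       (param a x)).
    have h := @is_derive_casteljau R _ N.+1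
      (fun k y => f (update a (node (k%:R / N.+1%:R)) y)) (param a) x (basis b) _ _
      (fun k => is_derive_update ab (pC1_is_derive b _ Cf)) (is_derive_param a b x).
    by apply: is_derive_eq h _; rewrite eq_sym (negbTE ab) !mul0r addr0.
  case=> _ ->; apply: (H1 b N.+1 _ x Kx (fun k => k%:R / N.+1%:R)) => //.
  exact: leqW.
have mvt k : exists eta, [/\ k%:R / N.+1%:R <= eta <= k.+1%:R / N.+1%:R &
    f (update a (node (k.+1%:R / N.+1%:R)) x) - f (update a (node (k%:R / N.+1%:R)) x)
    = (2 * C / N.+1%:R) * 'D_(basis a) f (update a (node eta) x)].
  have lt_node : node (k%:R / N.+1%:R) < node (k.+1%:R / N.+1%:R).
    by rewrite ltrD2r ltr_pM2l// ltr_pM2r ?invr_gt0// ltr_nat.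
  have [c /andP[c1 c2] E] := pC1_mvt a x Cf lt_node.
  exists ((c + C) / (2 * C)); split.
    have := ltW c1; have := ltW c2; rewrite /node lerBrDr lerBlDr => h2 h1.
    by rewrite ler_pdivlMr// ler_pdivrMr// mulrC h1 mulrC h2.
  rewrite E; have -> : node ((c + C) / (2 * C)) = c.
    by rewrite /node mulrC divfK ?addrK// gt_eqF.
  rewrite mulrC; congr (_ * _); rewrite /node -natr1; field.
  by rewrite nat1r gt_eqF.
have /choice[eta etaP] := mvt.
have : is_derive x (basis a) (bernstein N.+1 a f)
  (casteljau N (fun k => 'D_(basis a) f (update a (node (eta k)) x)) (param a x)).
  have h := @is_derive_casteljau R _ N.+1
      (fun k y => f (update a (node (k%:R / N.+1%:R)) y)) (param a) x (basis a)
      (fun=> 0) _ (fun k => is_derive_update_same f a _ x) (is_derive_param a a x).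
  apply: is_derive_eq h _; rewrite casteljau_cst add0r eqxx [N.+1.-1]/=.
  rewrite (@casteljau_eq R N _ (fun k => (2 * C / N.+1%:R) *
    'D_(basis a) f (update a (node (eta k)) x))).
    rewrite casteljauZ (_ : true%:R = 1 :> R)//; field.
    by rewrite nat1r !gt_eqF.
  by move=> k _; have [_ ->] := etaP k.
case=> _ ->; apply: (H1 a N _ x Kx eta) => // k kN.
have [/andP[e1 e2] _] := etaP k.
have k1 : k.+1%:R / N.+1%:R <= 1 :> R.
  by rewrite ler_pdivrMr// mul1r ler_nat.
have k0 : 0 <= k%:R / N.+1%:R :> R by rewrite divr_ge0.
(* The node k / N of degree N lies between the same two consecutive nodes of degree N + 1 as
   [eta k], so they differ by at most 1 / N. *)
have kk : k%:R / N.+1%:R <= (k%:R / N%:R : R) <= k.+1%:R / N.+1%:R.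
  apply/andP; split.
    by rewrite ler_wpM2l// lef_pV2 ?posrE// ler_nat.
  rewrite ler_pdivrMr// mulrAC ler_pdivlMr// -!natrM ler_nat.
  by rewrite mulnS mulSn leq_add2r.
have kS : k.+1%:R / N.+1%:R = k%:R / N.+1%:R + N.+1%:R^-1 :> R.
  by rewrite -natr1 mulrDl mul1r.
have NN : N.+1%:R^-1 <= N%:R^-1 :> R by rewrite lef_pV2 ?posrE// ler_nat.
split; first by rewrite (le_trans k0 e1) (le_trans e2 k1).
have aux (u u1 u2 u3 u4 : R) : u1 <= u -> u <= u1 + u3 -> u3 <= u4 ->
    u1 <= u2 <= u1 + u3 -> `|u - u2| <= u4.
  by move=> h1 h2 h3 /andP[h4 h5]; rewrite ler_norml; lra.
by apply: (aux _ _ _ _ _ e1 _ NN); rewrite -kS.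
Qed.

(* Sums of products of a polynomial and a function that satisfies [P] and does
   not depend on the coordinates listed in [S]. *)
Inductive semipoly (P : (V -> R) -> Prop) S : (V -> R) -> Prop :=
| SemipolyM c q : P c -> (forall a r x, a \in S -> c (update a r x) = c x) ->
    semipoly P S (fun x => c x * peval q x)
| SemipolyD f g : semipoly P S f -> semipoly P S g ->
    semipoly P S (fun x => f x + g x).

Lemma pC1_peval (p : mpoly d R) : pC1 (peval p).
Proof. exact/C1_pC1/C1_peval. Qed.

Lemma semipoly_pC1 S f : semipoly (@pC1 R d) S f -> pC1 f.
Proof.
elim=> [c q Cc _|{}f g _ Cf _ Cg]; last exact: pC1D.
exact: (pC1M Cc (pC1_peval q)).
Qed.

Lemma semipoly_continuous S f :
  semipoly (fun c => continuous c) S f -> continuous f.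
Proof.
elim=> [c q Cc _|{}f g _ Cf _ Cg]; last exact: addf_continuous.
by apply: mulf_continuous => //; exact: peval_continuous.
Qed.

Section Semipoly.
Variable P : (V -> R) -> Prop.
Hypothesis P_update : forall c a r, P c -> P (fun x => c (update a r x)).

Lemma semipoly_mul S f p : semipoly P S f ->
  semipoly P S (fun x => peval p x * f x).
Proof.
elim=> [c q Cc Sc|{}f g _ Cf _ Cg].
  rewrite (_ : (fun=> _) = fun x => c x * peval (p * q) x); first exact: SemipolyM.
  by apply/funext => x; rewrite pevalM mulrCA.
rewrite (_ : (fun=> _) = fun x => peval p x * f x + peval p x * g x).
  exact: SemipolyD.
by apply/funext => x; rewrite mulrDr.
Qed.

Lemma semipoly_update S a r f : semipoly P S f ->
  semipoly P (a :: S) (fun x => f (update a r x)).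
Proof.
elim=> [c q Cc Sc|{}f g _ Cf _ Cg]; last exact: SemipolyD.
pose q' := psubst (fun b => if b == a then mpolyC d r else pvar b) q.
rewrite (_ : (fun=> _) = fun x => c (update a r x) * peval q' x).
  apply: SemipolyM; first exact: P_update.
  move=> b r' x; rewrite inE; case: (eqVneq b a) => [-> _|ba /= bS].
    by rewrite update_update.
  by rewrite update_comm 1?eq_sym// Sc.
apply/funext => x; rewrite peval_psubst; congr (_ * peval q _).
by apply/rowP => b; rewrite !mxE; case: eqP => _; rewrite ?pevalC ?peval_pvar.
Qed.

Lemma semipoly_bernstein S n a f : semipoly P S f ->
  semipoly P (a :: S) (bernstein n a f).
Proof.
move=> Sf; pose sigma := (2 * C)^-1 *: (pvar a + mpolyC d C).
have sigmaE x : param a x = peval sigma x.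
  by rewrite pevalZ pevalD peval_pvar pevalC mulrC.
have gen m (F : nat -> V -> R) : (forall k, semipoly P (a :: S) (F k)) ->
    semipoly P (a :: S) (fun x => casteljau m (fun k => F k x) (param a x)).
  elim: m F => [|m ih] F SF; first exact: SF.
  rewrite (_ : (fun=> _) = fun x =>
    peval (1 - sigma) x * casteljau m (fun k => F k x) (param a x) +
    peval sigma x * casteljau m (fun k => F k.+1 x) (param a x)).
    apply: SemipolyD; apply: semipoly_mul; first exact: ih.
    exact: (ih (fun k => F k.+1)).
  by apply/funext => x; rewrite /= pevalB -(mpolyC1 d R) pevalC -sigmaE.
apply: (gen n (fun k x => f (update a (node (k%:R / n%:R)) x))) => k.
exact: semipoly_update.
Qed.

Lemma semipoly_self f : P f -> semipoly P [::] f.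
Proof.
move=> Pf; rewrite (_ : f = fun x => f x * peval 1 x); first exact: SemipolyM.
by apply/funext => x; rewrite -(mpolyC1 d R) pevalC mulr1.
Qed.

Lemma semipoly_peval f : semipoly P (enum 'I_d) f -> exists p, f = peval p.
Proof.
elim=> [c q _ Sc|{}f g _ [p ->] _ [q ->]]; last first.
  by exists (p + q); apply/funext => x; rewrite pevalD.
exists (c 0 *: q); apply/funext => x; rewrite pevalZ; congr (_ * _).
have E s : c (foldr (fun a y => update a 0 y) x s) = c x.
  by elim: s => [//|a s ih] /=; rewrite Sc ?mem_enum.
rewrite -(E (enum 'I_d)); congr c; apply/rowP => j; rewrite mxE.
have : j \in enum 'I_d by rewrite mem_enum.
elim: (enum 'I_d) => [//|a s ih]; rewrite inE /= mxE.
by case: eqP => //= _ /ih.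
Qed.

End Semipoly.

Let near_half (e u w z : R) : `|u - w| <= e / 2 -> `|z - w| <= e / 2 ->
  `|u - z| <= e.
Proof.
move=> h1 h2; apply: le_trans (ler_distD w u z) _.
by rewrite (distrC w); lra.
Qed.

(** Each Bernstein step makes the current approximant polynomial in one more coordinate and spends
    half of the allowed error. The C^1 version runs the same induction. *)
Theorem polynomial_density v e : continuous v -> 0 < e ->
  exists p : mpoly d R, forall x, cube x -> `|v x - peval p x| <= e.
Proof.
move=> cv e0; pose P (c : V -> R) := continuous c.
have Pu c a r : P c -> P (fun x => c (update a r x)).
  have cu : continuous (update a r : V -> V) by exact: update_continuous.
  by move=> cc; exact: (compf_continuous cu cc).
have H S : forall e, 0 < e -> exists2 f, semipoly P S f & forall x, cube x ->
    `|v x - f x| <= e.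
  elim: S => [|a S ih] {e0}e e0.
    exists v => [|x _]; first exact: semipoly_self.
    by rewrite subrr normr0 ltW.
  have e2 : 0 < e / 2 by rewrite divr_gt0.
  have [f Sf fv] := ih _ e2.
  have [N HN] := bernstein_approx a (semipoly_continuous Sf) e2.
  exists (bernstein N.+1 a f); first exact: semipoly_bernstein.
  move=> x Kx; apply: near_half (fv x Kx) _.
  apply: (HN N.+1 _ x Kx (fun k => k%:R / N.+1%:R)) => // k kN.
  have NR : 0 < N.+1%:R :> R by rewrite ltr0n.
  rewrite subrr normr0 invr_ge0 ler0n divr_ge0 ?ler0n//=.
  by rewrite ler_pdivrMr// mul1r ler_nat.
have [f /semipoly_peval[p ->] fv] := H (enum 'I_d) e e0.
by exists p.
Qed.

Theorem polynomial_C1_density v e : pC1 v -> 0 < e ->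
  exists p : mpoly d R, forall x, cube x ->
    `|v x - peval p x| <= e /\
    forall a, `|'D_(basis a) v x - peval (mderiv a p) x| <= e.
Proof.
move=> Cv e0; pose P := @pC1 R d.
have Pu c a r : P c -> P (fun x => c (update a r x)) by exact: pC1_update.
have H S : forall e, 0 < e -> exists2 f, semipoly P S f & forall x, cube x ->
    `|v x - f x| <= e /\
    forall a, `|'D_(basis a) v x - 'D_(basis a) f x| <= e.
  elim: S => [|a S ih] {e0}e e0.
    exists v => [|x _]; first exact: semipoly_self.
    by rewrite subrr normr0; split=> [|a]; rewrite ?subrr ?normr0 ltW.
  have e2 : 0 < e / 2 by rewrite divr_gt0.
  have [f Sf fv] := ih _ e2.
  have [n nf] := bernstein_pC1_approx a (semipoly_pC1 Sf) e2.
  exists (bernstein n a f); first exact: semipoly_bernstein.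
  move=> x Kx; have [h1 h2] := fv x Kx; have [h3 h4] := nf x Kx.
  by split=> [|b]; [exact: near_half h1 h3|exact: near_half (h2 b) (h4 b)].
have [f /semipoly_peval[p ->] fv] := H (enum 'I_d) e e0.
exists p => x Kx; have [h1 h2] := fv x Kx; split=> // a.
by rewrite -derive_peval.
Qed.

End Density.

(** * A theorem of the alternative with measures *)

Section MeasureAlternative.
Variables (R : realType) (I : finType) (N : I -> nat).
Variable K : forall i, set 'rV[R]_(N i).
Arguments K : clear implicits.
Hypothesis cK : forall i, compact (K i).
Local Notation family := (forall i, 'rV[R]_(N i) -> R).

Let pt := {i : I & 'rV[R]_(N i)}.
Let Kpt : set pt := [set p | K (tag p) (tagged p)].
Let flat (f : family) (p : pt) : R := f (tag p) (tagged p).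
Let single i (f : 'rV[R]_(N i) -> R) : family :=
  @dfwith I (fun i => 'rV[R]_(N i) -> R) (fun _ _ => 0) i f.

Let single_sum (f : family) (p : pt) : flat f p = \sum_i flat (single (f i)) p.
Proof.
rewrite (bigD1 (tag p))//= /flat /single dfwithin big1 ?addr0// => i ip.
by rewrite dfwithout// eq_sym.
Qed.

Let bounded_flat (f : family) : (forall i, bounded_on (K i) (f i)) ->
  bounded_on Kpt (flat f).
Proof.
move=> /choice[C fC]; exists (\sum_i `|C i|) => -[i x] Kx.
apply: le_trans (fC i x Kx) _; apply: le_trans (ler_norm _) _.
by rewrite (bigD1 i)//= lerDl sumr_ge0.
Qed.

Let bounded_single i (f : 'rV[R]_(N i) -> R) : bounded_on (K i) f ->
  bounded_on Kpt (flat (single f)).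
Proof.
move=> bf; apply: bounded_flat => j; rewrite /single.
case: (eqVneq i j) => [<-|ij]; first by rewrite dfwithin.
by rewrite dfwithout//; exact: bounded_on_cst.
Qed.

(** A family is one function on the disjoint union of the [K i], so a single functional is separated
    and normalised once. Its restrictions to the summands are then represented one by one, as they
    live in different dimensions. *)
Theorem measure_alternative (W : set family) :
  W (fun _ _ => 0) ->
  (forall f g, W f -> W g -> W (fun i x => f i x + g i x)) ->
  (forall a f, 0 <= a -> W f -> W (fun i x => a * f i x)) ->
  (forall f i, W f -> continuous (f i)) ->
  ~ (exists2 w, W w & forall i x, K i x -> 1 <= w i x) ->
  exists mu : forall i, {finite_measure set (borel R (N i)) -> \bar R},
    [/\ forall i, concentrated (mu i) (K i),
        \sum_i pairing (mu i) (fun=> 1) = 1 &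
        forall w, W w -> \sum_i pairing (mu i) (w i) <= 0].
Proof.
move=> W0 WD WZ Wc noW.
have Wb w i : W w -> bounded_on (K i) (w i).
  by move=> Ww; apply: compact_bounded_on => //; exact: Wc.
have [|||||L [pL L1 LW]] := @separating_state R pt Kpt
    [set F | exists2 w, W w & F = flat w].
- by exists (fun _ _ => 0).
- by move=> _ _ [w Ww ->] [v Wv ->]; exists (fun i x => w i x + v i x) => //; exact: WD.
- by move=> a _ a0 [w Ww ->]; exists (fun i x => a * w i x) => //; exact: WZ.
- by move=> _ [w Ww ->]; apply: bounded_flat => i; exact: Wb.
- move=> [_ [w Ww ->] w1]; apply: noW; exists w => // i x Kx.
  exact: (w1 (Tagged (fun i => 'rV[R]_(N i)) x)).
pose Li i (f : 'rV[R]_(N i) -> R) := L (flat (single f)).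
have pLi i : positive_functional (K i) (@Li i).
  split.
  - move=> f g bf bg; rewrite -(functionalD pL); try exact: bounded_single.
    congr L; apply/funext => -[j x]; rewrite /flat/= /single.
    case: (eqVneq i j) => [E|ij]; last by rewrite !dfwithout// addr0.
    by case: j / E x => x; rewrite !dfwithin.
  - move=> a f bf; rewrite -(functionalZ pL); last exact: bounded_single.
    congr L; apply/funext => -[j x]; rewrite /flat/= /single.
    case: (eqVneq i j) => [E|ij]; last by rewrite !dfwithout// mulr0.
    by case: j / E x => x; rewrite !dfwithin.
  - move=> f bf f0; apply: (functional_ge0 pL); first exact: bounded_single.
    move=> -[j x]; rewrite /Kpt /flat/= /single.
    case: (eqVneq i j) => [E|ij]; last by rewrite dfwithout.
    by case: j / E x => x Kx; rewrite dfwithin f0.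
have LE (f : family) : (forall i, bounded_on (K i) (f i)) ->
    L (flat f) = \sum_i Li i (f i).
  move=> bf; rewrite -(functional_sum pL); last by move=> i _; exact: bounded_single.
  by congr L; apply/funext => p; exact: single_sum.
have riesz i := cid2 (riesz_representation (@cK i) (pLi i)).
pose mu i := projT1 (riesz i).
have muK i : concentrated (mu i) (K i) by rewrite /mu; case: (riesz i).
have muL i f : continuous f -> pairing (mu i) f = Li i f.
  by rewrite /mu; case: (riesz i) => m /= _; exact.
exists mu; split=> //.
  rewrite (eq_bigr (fun i => Li i (fun=> 1))); last first.
    by move=> i _; apply: muL; exact: cstf_continuous.
  rewrite -(LE (fun _ _ => 1)); last by move=> i; exact: bounded_on_cst.
  by rewrite -L1; congr L; apply/funext => p.
move=> w Ww; rewrite (eq_bigr (fun i => Li i (w i))); last first.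
  by move=> i _; apply: muL; exact: Wc.
rewrite -LE; last by move=> i; exact: Wb.
by apply: LW; exists w.
Qed.

End MeasureAlternative.

(** * Duality for the hybrid system *)

Section Substitution.
Variables (R : realType) (k k' : nat) (s : 'I_k -> mpoly k' R).
Implicit Types p q : mpoly k R.

Lemma psubstD p q : psubst s (p + q) = psubst s p + psubst s q.
Proof. exact: raddfD. Qed.

Lemma psubstB p q : psubst s (p - q) = psubst s p - psubst s q.
Proof. exact: raddfB. Qed.

Lemma psubstM p q : psubst s (p * q) = psubst s p * psubst s q.
Proof. exact: (rmorphM (comp_mpoly [tuple s a | a < k])). Qed.

Lemma psubstX p j : psubst s (p ^+ j) = psubst s p ^+ j.
Proof. exact: (rmorphXn (comp_mpoly [tuple s a | a < k])). Qed.

Lemma psubst1 : psubst s 1 = 1.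
Proof. exact: (rmorph1 (comp_mpoly [tuple s a | a < k])). Qed.

Lemma psubstZ (c : R) p : psubst s (c *: p) = c *: psubst s p.
Proof. exact: comp_mpolyZ. Qed.

Lemma psubst_sum (I : Type) (r : seq I) (P : pred I) (F : I -> mpoly k R) :
  psubst s (\sum_(i <- r | P i) F i) = \sum_(i <- r | P i) psubst s (F i).
Proof. exact: (raddf_sum (comp_mpoly [tuple s a | a < k])). Qed.

Lemma psubst_pvar a : psubst s (pvar a) = s a.
Proof.
by rewrite /psubst comp_mpolyXU (nth_map a) ?size_enum_ord// nth_ord_enum.
Qed.

Lemma psubst_qgen (gs : seq (mpoly k R)) p :
  qgen gs p -> qgen [seq psubst s g | g <- gs] (psubst s p).
Proof.
have sosS q : sos q -> sos (psubst s q).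
  move=> [qs ->]; exists [seq psubst s q | q <- qs].
  by rewrite big_map psubst_sum; apply: eq_bigr => r _; rewrite psubstX.
move=> [s0 [t [S0 St ->]]]; have qM := qgen_qmodule [seq psubst s g | g <- gs].
rewrite psubstD; apply: (qmoduleD qM).
  by apply: (qmodule_sos qM); exact: sosS.
rewrite psubst_sum; elim/big_ind : _ => [|x y|l _].
- exact: (qmodule0 qM).
- exact: (qmoduleD qM).
- rewrite psubstM; apply: (qmodule_sosM qM); first exact: sosS.
  by apply: qgen_mem; apply: map_f; exact: mem_nth.
Qed.

Lemma psubst_ball (N : R) a :
  psubst s (N *: 1 - pvar a ^+ 2) = N *: 1 - s a ^+ 2.
Proof. by rewrite psubstB psubstZ psubst1 psubstX psubst_pvar. Qed.

End Substitution.

(** * Polynomial descriptions of the constraint sets *)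

Section PolynomialData.
Variables (R : realType) (S : hybrid_system R).
Implicit Types i : mode S.
Local Notation n := (@dim R S).
Local Notation m := (cdim S).
Local Notation T := (horizon S).

Lemma peval_tx_to_txu i (p : mpoly (1 + n i) R) (z : 'rV[R]_(1 + n i + m)) :
  peval (tx_to_txu p) z = peval p (lsubmx z).
Proof.
rewrite peval_psubst; congr peval; apply/rowP => a.
by rewrite !mxE peval_pvar.
Qed.

Lemma peval_x_to_tx i (p : mpoly (n i) R) (z : 'rV[R]_(1 + n i)) :
  peval (x_to_tx p) z = peval p (rsubmx z).
Proof.
rewrite peval_psubst; congr peval; apply/rowP => a.
by rewrite !mxE peval_pvar.
Qed.

Lemma peval_u_to_txu i (p : mpoly m R) (z : 'rV[R]_(1 + n i + m)) :
  peval (u_to_txu i p) z = peval p (rsubmx z).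
Proof.
rewrite peval_psubst; congr peval; apply/rowP => a.
by rewrite !mxE peval_pvar.
Qed.

Lemma peval_htau k (a : 'I_k) (z : 'rV[R]_k) :
  peval (htau S a) z = z ord0 a * (T - z ord0 a).
Proof. by rewrite pevalM pevalB pevalC peval_pvar. Qed.

Lemma peval_plie i (v : mpoly (1 + n i) R) z : peval (plie v) z = lie (peval v) z.
Proof.
rewrite pevalD peval_tx_to_txu /lie derive_peval; congr (_ + _).
rewrite peval_sum; apply: eq_bigr => l _.
by rewrite pevalM peval_tx_to_txu derive_peval.
Qed.

Lemma peval_pfinal i (v : mpoly (1 + n i) R) x :
  peval (pfinal v) x = peval v (tx T x).
Proof.
rewrite peval_psubst; congr peval; apply/rowP => a; rewrite !mxE.
by case: fintype.split => b; rewrite ?pevalC ?peval_pvar ?mxE.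
Qed.

Lemma peval_preset i i' (v : mpoly (1 + n i') R) (z : 'rV[R]_(1 + n i)) :
  peval (preset i v) z = peval v (reset_map_t i' z).
Proof.
rewrite peval_psubst; congr peval; apply/rowP => a; rewrite !mxE.
case: fintype.split => b; rewrite ?peval_pvar ?mxE ?ord1//.
by rewrite peval_x_to_tx.
Qed.

Definition occ_gens i : seq (mpoly (1 + n i + m) R) :=
  htau_txu i :: [seq tx_to_txu (x_to_tx g) | g <- hX i]
                ++ [seq u_to_txu i g | g <- hU S].

Definition grd_gens i i' : seq (mpoly (1 + n i) R) :=
  htau_tx i :: [seq x_to_tx g | g <- hS i i'].

Hypothesis hS : standing_assumptions S.

Let T0 : 0 < T. Proof. exact: horizon_gt0. Qed.

Let htau_itv (t : R) : (0 <= t * (T - t)) = (0 <= t <= T).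
Proof.
apply/idP/idP => [|/andP[t0 tT]]; last by rewrite mulr_ge0// subr_ge0.
by have := T0; nra.
Qed.

Lemma occ_set_gens i : @occ_set R S i = nonneg_set (occ_gens i).
Proof.
apply/seteqP; split=> z /=.
  move=> [t01 dz uz] g; rewrite inE => /predU1P[->|].
    by rewrite /htau_txu peval_htau htau_itv; move: t01; rewrite !mxE.
  rewrite mem_cat => /orP[] /mapP[h hin ->].
    by rewrite peval_tx_to_txu peval_x_to_tx; exact: dz.
  by rewrite peval_u_to_txu; exact: uz.
move=> h; split.
- have := h (htau_txu i); rewrite inE eqxx => /(_ isT).
  by rewrite peval_htau htau_itv !mxE.
- move=> g gin; have := h (tx_to_txu (x_to_tx g)).
  rewrite peval_tx_to_txu peval_x_to_tx; apply.
  by rewrite inE mem_cat (map_f (fun g => tx_to_txu (x_to_tx g)) gin) orbT.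
- move=> g gin; have := h (u_to_txu i g).
  rewrite peval_u_to_txu; apply.
  by rewrite inE mem_cat (map_f (@u_to_txu R S i) gin) !orbT.
Qed.

(** The boundary of the domain is not among the generators; [guard_description] recovers it from
    them. *)
Lemma guard_set_gens i i' : edge i i' ->
  @guard_set R S i i' = nonneg_set (grd_gens i i').
Proof.
move=> e; apply/seteqP; split=> z /=.
  move=> [t01 [_ gz]] g; rewrite inE => /predU1P[->|/mapP[h hin ->]].
    by rewrite /htau_tx peval_htau htau_itv; move: t01; rewrite !mxE.
  by rewrite peval_x_to_tx; exact: gz.
move=> h; have gz : nonneg_set (Defs.hS i i') (rsubmx z).
  move=> g gin; have := h (x_to_tx g); rewrite peval_x_to_tx; apply.
  by rewrite inE (map_f (@x_to_tx R S i) gin) orbT.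
split; last by split=> //; exact: (guard_description hS e).
have := h (htau_tx i); rewrite inE eqxx => /(_ isT).
by rewrite peval_htau htau_itv !mxE.
Qed.

Definition archimedean k (gs : seq (mpoly k R)) :=
  forall a, exists N, qgen gs (N *: 1 - pvar a ^+ 2).

Let qgen_sub k (gs gs' : seq (mpoly k R)) : {subset gs <= gs'} ->
  qgen gs `<=` qgen gs'.
Proof.
move=> sub _ [s0 [s [S0 Ss ->]]]; have qM := qgen_qmodule gs'.
apply: (qmoduleD qM); first exact: (qmodule_sos qM).
elim/big_ind : _ => [|x y|l _]; first exact: (qmodule0 qM).
  exact: (qmoduleD qM).
by apply: (qmodule_sosM qM) => //; apply/qgen_mem/sub/mem_nth.
Qed.

(* [M - x_a^2] is the ball polynomial plus the squares of the other variables. *)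
Lemma archimedean_ball k (gs : seq (mpoly k R)) M :
  ball_poly k M \in gs -> archimedean gs.
Proof.
move=> /qgen_mem ball a; exists M; have qM := qgen_qmodule gs.
have -> : M *: 1 - pvar a ^+ 2 =
    ball_poly k M + \sum_(b < k | b != a) pvar b ^+ 2.
  by rewrite /ball_poly (bigD1 a)//= -mul_mpolyC mulr1; ring.
apply: (qmoduleD qM) => //; elim/big_ind : _ => [|x y|b _].
- exact: (qmodule0 qM).
- exact: (qmoduleD qM).
- exact: (qmodule_sqr qM).
Qed.

(* [T^2 - t^2 = 2 t (T - t) + (t - T)^2] *)
Let htau_qgen k (a : 'I_k) (gs : seq (mpoly k R)) : htau S a \in gs ->
  exists N, qgen gs (N *: 1 - pvar a ^+ 2).
Proof.
move=> /qgen_mem h; exists (T ^+ 2); have qM := qgen_qmodule gs.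
have -> : T ^+ 2 *: 1 - pvar a ^+ 2 =
    2 *: htau S a + (pvar a - mpolyC k T) ^+ 2.
  by rewrite /htau -!mul_mpolyC (rmorphXn (@mpolyC k R)) mpolyC_nat; ring.
apply: (qmoduleD qM); last exact: (qmodule_sqr qM).
exact: (qmoduleZ qM).
Qed.

Lemma archimedean_target i : archimedean (hT i).
Proof. by have [M] := putinar_target hS i; exact: archimedean_ball. Qed.

Lemma archimedean_grd i i' : edge i i' -> archimedean (grd_gens i i').
Proof.
move=> e; have [M /archimedean_ball Mg] := putinar_guard hS e.
move=> a; rewrite -(splitK a); case: fintype.split => b /=.
  by rewrite ord1; apply: htau_qgen; rewrite inE eqxx.
have [N /(psubst_qgen (fun l => pvar (rshift 1 l)))] := Mg b.
rewrite psubst_ball => h; exists N; apply: qgen_sub h => g gin.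
by rewrite inE gin orbT.
Qed.

Lemma archimedean_occ i : archimedean (occ_gens i).
Proof.
have [M /archimedean_ball Mx] := putinar_dom hS i.
have [M' /archimedean_ball Mu] := putinar_control hS.
move=> a; rewrite -(splitK a); case: fintype.split => b /=; last first.
  have [N /(psubst_qgen (fun l => pvar (rshift (1 + n i) l)))] := Mu b.
  rewrite psubst_ball => h; exists N; apply: qgen_sub h => g gin.
  by rewrite inE mem_cat gin !orbT.
rewrite -(splitK b); case: fintype.split => c /=.
  by rewrite ord1; apply: htau_qgen; rewrite inE eqxx.
have [N /(psubst_qgen (fun l => pvar (rshift 1 l)))] := Mx c.
move=> /(psubst_qgen (fun l => pvar (lshift m l))).
rewrite psubst_ball psubstB psubstZ psubst1 psubstX psubst_pvar.
move=> h; exists N; apply: qgen_sub h => g.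
by rewrite -map_comp => gin; rewrite inE mem_cat gin orbT.
Qed.

(** Members of the quadratic module are nonnegative on the set, so the archimedean certificates
    bound every coordinate there. *)
Lemma archimedean_compact k (gs : seq (mpoly k R)) :
  archimedean gs -> compact (nonneg_set gs).
Proof.
move=> gsA; have qpos p : qgen gs p -> forall z, nonneg_set gs z -> 0 <= peval p z.
  move=> [s0 [s [S0 Ss ->]]] z gz.
  have sos_ge0 q : sos q -> 0 <= peval q z.
    move=> [qs ->]; rewrite peval_sum; apply: sumr_ge0 => q' _.
    by rewrite pevalX sqr_ge0.
  rewrite pevalD; apply: addr_ge0; first exact: sos_ge0.
  rewrite peval_sum; apply: sumr_ge0 => l _; rewrite pevalM.
  by apply: mulr_ge0; [exact: sos_ge0|apply: gz; exact: mem_nth].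
have /choice[N HN] := gsA.
apply: (subclosed_compact _ (@cube_compact R k (1 + \sum_a `|N a|))).
  have -> : nonneg_set gs = \bigcap_(g in [set g | g \in gs]) (peval g @^-1` [set y | 0 <= y]).
    by apply/seteqP; split=> z /=.
  apply: closed_bigI => g _; apply: closed_comp; last exact: closed_ge.
  by move=> z _; exact: peval_continuous.
move=> z gz a; have := qpos _ (HN a) z gz.
rewrite pevalB pevalZ pevalX peval_pvar -(mpolyC1 k R) pevalC mulr1 subr_ge0 => h.
have h1 : N a <= \sum_a `|N a|.
  by apply: le_trans (ler_norm _) _; rewrite (bigD1 a)//= lerDl sumr_ge0.
have h2 : 0 <= \sum_a `|N a| by rewrite sumr_ge0.
rewrite ler_norml; move: h h1 h2; move: (z ord0 a) (N a) (\sum_a _) => x y s; nra.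
Qed.

End PolynomialData.

(** * Balance equations and weak duality *)

Section HybridCalculus.
Variables (R : realType) (S : hybrid_system R).
Implicit Types i : mode S.
Local Notation n := (@Defs.dim R S).
Local Notation m := (cdim S).
Local Notation T := (horizon S).

Lemma lsubmx_continuous k l : continuous (@lsubmx R 1 k l).
Proof.
apply: row_continuous => j.
rewrite (_ : (fun=> _) = fun z : 'rV[R]_(k + l) => z ord0 (lshift l j)).
  exact: coord_continuous.
by apply/funext => z; rewrite mxE.
Qed.

Lemma rsubmx_continuous k l : continuous (@rsubmx R 1 k l).
Proof.
apply: row_continuous => j.
rewrite (_ : (fun=> _) = fun z : 'rV[R]_(k + l) => z ord0 (rshift k j)).
  exact: coord_continuous.
by apply/funext => z; rewrite mxE.
Qed.

Lemma row_mx_continuous (X : topologicalType) k l (f : X -> 'rV[R]_k)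
    (g : X -> 'rV[R]_l) :
  continuous f -> continuous g -> continuous (fun z => row_mx (f z) (g z)).
Proof.
move=> cf cg; apply: row_continuous => j.
have cc p (a : 'I_p) : continuous (fun z : 'rV[R]_p => z ord0 a).
  exact: coord_continuous.
rewrite -(splitK j); case: fintype.split => a /=.
  rewrite (_ : (fun=> _) = fun z => f z ord0 a).
    exact: (compf_continuous cf (cc k a)).
  by apply/funext => z; rewrite row_mxEl.
rewrite (_ : (fun=> _) = fun z => g z ord0 a).
  exact: (compf_continuous cg (cc l a)).
by apply/funext => z; rewrite row_mxEr.
Qed.

Lemma tx_continuous k (t : R) : continuous (@tx R k t).
Proof.
apply: row_mx_continuous; last by move=> x A.
by apply: row_continuous => j; exact: cstf_continuous.
Qed.

Lemma reset_map_t_continuous i i' : continuous (@reset_map_t R S i i').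
Proof.
have cl : continuous (@lsubmx R 1 1 (n i)) by exact: lsubmx_continuous.
have cr : continuous (@rsubmx R 1 1 (n i)) by exact: rsubmx_continuous.
apply: row_mx_continuous => //; apply: row_continuous => l.
rewrite (_ : (fun=> _) = fun z => peval (reset i l) (rsubmx z)).
  by apply: (compf_continuous cr); exact: peval_continuous.
by apply/funext => z; rewrite mxE.
Qed.

Lemma reset_map_continuous i i' : continuous (@reset_map R S i i').
Proof.
apply: row_continuous => l.
rewrite (_ : (fun=> _) = peval (reset i l)); first exact: peval_continuous.
by apply/funext => z; rewrite mxE.
Qed.

Lemma lie_continuous i (v : 'rV[R]_(1 + n i) -> R) : pC1 v -> continuous (lie v).
Proof.
move=> [_ dv]; have cl : continuous (@lsubmx R 1 (1 + n i) m).
  exact: lsubmx_continuous.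
apply: addf_continuous.
  by have [_ c] := dv (lshift (n i) ord0); exact: (compf_continuous cl c).
apply: sum_continuous => l _; apply: mulf_continuous; last exact: peval_continuous.
by have [_ c] := dv (rshift 1 l); exact: (compf_continuous cl c).
Qed.

Lemma lieB i (v w : 'rV[R]_(1 + n i) -> R) z : pC1 v -> pC1 w ->
  lie (fun x => v x - w x) z = lie v z - lie w z.
Proof.
move=> Cv Cw.
have D a : 'D_(delta_mx ord0 a) (fun x => v x - w x) (lsubmx z) =
    'D_(delta_mx ord0 a) v (lsubmx z) - 'D_(delta_mx ord0 a) w (lsubmx z).
  by have [_] := is_derive_subf (pC1_is_derive a (lsubmx z) Cv)
    (pC1_is_derive a (lsubmx z) Cw).
rewrite /lie D; under eq_bigr do rewrite D mulrBl.
by rewrite sumrB; ring.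
Qed.

Lemma lie_bound i (v : 'rV[R]_(1 + n i) -> R) z e :
  (forall a, `|'D_(delta_mx ord0 a) v (lsubmx z)| <= e) ->
  `|lie v z| <= e * (1 + \sum_l `|peval (vfield l) z|).
Proof.
move=> ve; rewrite /lie mulrDr mulr1; apply: le_trans (ler_normD _ _) _.
apply: lerD; first exact: ve.
rewrite mulr_sumr; apply: le_trans (ler_norm_sum _ _ _) _.
by apply: ler_sum => l _; rewrite normrM; apply: ler_wpM2r.
Qed.

(** Trades the cast inside [mu0] for a point of mode [i], so that linearity in the test function is
    immediate in both cases. *)
Lemma mu0P i :
  (exists2 x, existT (fun i => 'rV[R]_(n i)) i x = init S &
     forall f, continuous f -> pairing (mu0 i) f = f x) \/
  (forall f, pairing (mu0 i) f = 0).
Proof.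
rewrite /mu0 /untag; case: eqP => [e|_]; [left|right] => [|f]; last first.
  by rewrite /pairing /Rintegral integral_measure_zero.
exists (etagged e).
  by case: (init S) e => j x /= e; case: i / e.
move=> f cf; rewrite /pairing /Rintegral integral_dirac//.
  by rewrite diracE mem_set// mul1e.
by apply/measurable_EFinP; exact: borel_continuous.
Qed.

(** Flows entering a mode are regrouped by the mode they leave. *)
Lemma edge_exchange (a b : mode S -> mode S -> R) :
  \sum_i (\sum_(i' | edge i' i) a i' i - \sum_(i' | edge i i') b i i') =
  \sum_i \sum_(i' | edge i i') (a i i' - b i i').
Proof.
rewrite sumrB (exchange_big_dep xpredT)//= -sumrB.
by apply: eq_bigr => i _; rewrite sumrB.
Qed.

Hypothesis hS : standing_assumptions S.

Lemma occ_compact i : compact (@occ_set R S i).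
Proof.
by rewrite occ_set_gens//; apply: archimedean_compact; exact: archimedean_occ.
Qed.

Lemma guard_set_compact i i' : edge i i' -> compact (@guard_set R S i i').
Proof.
move=> e; rewrite guard_set_gens//; apply: archimedean_compact.
exact: archimedean_grd.
Qed.

Section Measures.
Variable mu : measures S.
Hypotheses (muX : forall i, concentrated (occ mu i) (occ_set (i:=i)))
  (muT : forall i, concentrated (ter mu i) (target (i:=i)))
  (muS : forall i i', edge i i' ->
     concentrated (grd mu i i') (guard_set (i:=i) i')).

(* Left minus right side of the equality constraint of (P). *)
Definition balance i (v : 'rV[R]_(1 + n i) -> R) : R :=
  pairing (mu0 i) (fun x => v (tx 0 x)) + pairing (occ mu i) (lie v)
  - pairing (ter mu i) (fun x => v (tx T x))
  + (\sum_(i' | edge i' i) pairing (grd mu i' i) (v \o @reset_map_t R S i' i)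
     - \sum_(i' | edge i i') pairing (grd mu i i') v).

Lemma balance0 i (v : 'rV[R]_(1 + n i) -> R) : balance v = 0 <->
  pairing (mu0 i) (fun x => v (tx 0 x)) + pairing (occ mu i) (lie v)
        + \sum_(i' | edge i' i) pairing (grd mu i' i) (v \o @reset_map_t R S i' i)
        = pairing (ter mu i) (fun x => v (tx T x))
          + \sum_(i' | edge i i') pairing (grd mu i i') v.
Proof.
rewrite /balance; set a := pairing _ _; set b := pairing _ _; set c := pairing _ _.
by split => h; lra.
Qed.

Let ctx (i : mode S) (t : R) (v : 'rV[R]_(1 + n i) -> R) :
  continuous v -> continuous (fun x => v (tx t x)).
Proof.
have ct : continuous (@tx R (n i) t) by exact: tx_continuous.
by move=> cv; exact: (compf_continuous ct cv).
Qed.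

Let creset i i' (v : 'rV[R]_(1 + n i') -> R) :
  continuous v -> continuous (v \o @reset_map_t R S i i').
Proof.
have cr : continuous (@reset_map_t R S i i') by exact: reset_map_t_continuous.
by move=> cv; exact: (compf_continuous cr cv).
Qed.

Lemma balanceB i (v w : 'rV[R]_(1 + n i) -> R) : pC1 v -> pC1 w ->
  balance (fun x => v x - w x) = balance v - balance w.
Proof.
move=> Cv Cw; have [cv _] := Cv; have [cw _] := Cw.
rewrite /balance.
have -> : pairing (mu0 i) (fun x => v (tx 0 x) - w (tx 0 x)) =
    pairing (mu0 i) (fun x => v (tx 0 x)) - pairing (mu0 i) (fun x => w (tx 0 x)).
  have [[x _ E]|E] := mu0P i; last by rewrite !E subr0.
  have c1 := @ctx i 0 v cv; have c2 := @ctx i 0 w cw.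
  by rewrite (E _ c1) (E _ c2) E//; exact: subf_continuous.
have -> : pairing (occ mu i) (lie (fun x => v x - w x)) =
    pairing (occ mu i) (lie v) - pairing (occ mu i) (lie w).
  rewrite -(pairingB (@occ_compact i) (muX i)); try exact: lie_continuous.
  by congr pairing; apply/funext => z; rewrite lieB.
have -> : pairing (ter mu i) (fun x => v (tx T x) - w (tx T x)) =
    pairing (ter mu i) (fun x => v (tx T x)) - pairing (ter mu i) (fun x => w (tx T x)).
  have c1 := @ctx i T v cv; have c2 := @ctx i T w cw.
  exact: (pairingB (target_compact hS (i:=i)) (muT i) c1 c2).
have -> : \sum_(i' | edge i' i)
    pairing (grd mu i' i) ((fun x => v x - w x) \o @reset_map_t R S i' i) =
  \sum_(i' | edge i' i) pairing (grd mu i' i) (v \o @reset_map_t R S i' i) -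
  \sum_(i' | edge i' i) pairing (grd mu i' i) (w \o @reset_map_t R S i' i).
  rewrite -sumrB; apply: eq_bigr => i' e.
  have c1 := @creset i' i v cv; have c2 := @creset i' i w cw.
  exact: (pairingB (guard_set_compact e) (muS e) c1 c2).
have -> : \sum_(i' | edge i i') pairing (grd mu i i') (fun x => v x - w x) =
  \sum_(i' | edge i i') pairing (grd mu i i') v -
  \sum_(i' | edge i i') pairing (grd mu i i') w.
  rewrite -sumrB; apply: eq_bigr => i' e.
  exact: (pairingB (guard_set_compact e) (muS e) cv cw).
have alg (x1 y1 x2 y2 x3 y3 x4 y4 x5 y5 : R) :
    x1 - y1 + (x2 - y2) - (x3 - y3) + (x4 - y4 - (x5 - y5)) =
    x1 + x2 - x3 + (x4 - x5) - (y1 + y2 - y3 + (y4 - y5)) by ring.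
exact: alg.
Qed.

(** Summed over the modes, each guard measure occurs once, tested against the jump of v across its
    reset. The constraints of (D) are exactly sign conditions on the integrands, which serves weak
    duality and the separation argument alike. *)
Lemma sum_balance (v : forall i, 'rV[R]_(1 + n i) -> R) :
  (forall i, continuous (v i)) ->
  \sum_i balance (v i) = D_objective v + \sum_i pairing (occ mu i) (lie (v i))
   - \sum_i pairing (ter mu i) (fun x => v i (tx T x))
   + \sum_i \sum_(i' | edge i i')
       pairing (grd mu i i') (fun z => v i' (reset_map_t i' z) - v i z).
Proof.
move=> cv; rewrite /balance big_split/= sumrB big_split/= edge_exchange.
congr (_ + _); apply: eq_bigr => i _; apply: eq_bigr => i' e.
have c1 := @creset i i' (v i') (cv i').
by rewrite -(pairingB (guard_set_compact e) (muS e) c1 (cv i)).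
Qed.

End Measures.

Lemma weak_duality (mu : measures S) (v : forall i, 'rV[R]_(1 + n i) -> R) :
  P_feasible mu -> D_feasible v -> D_objective v <= P_cost mu.
Proof.
move=> [muX muT muS muE] [vC vX vT vS].
have Cv i : pC1 (v i) by exact: C1_pC1.
have cv i : continuous (v i) by case: (Cv i).
have ct i : continuous (fun x => v i (tx T x)).
  have c : continuous (@tx R (n i) T) by exact: tx_continuous.
  exact: (compf_continuous c (cv i)).
have cr i i' : continuous (fun z => v i' (@reset_map_t R S i i' z)).
  have c : continuous (@reset_map_t R S i i') by exact: reset_map_t_continuous.
  exact: (compf_continuous c (cv i')).
have cp k (p : mpoly k R) : continuous (peval p) by exact: peval_continuous.
have : \sum_i balance mu (v i) = 0.
  by apply: big1 => i _; apply/balance0; exact: muE.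
rewrite (sum_balance muS cv).
have h1 : 0 <= \sum_i pairing (occ mu i) (lie (v i)) +
               \sum_i pairing (occ mu i) (peval (run_cost i)).
  rewrite -big_split/=; apply: sumr_ge0 => i _.
  have cl := lie_continuous (Cv i).
  rewrite -(pairingD (@occ_compact i) (muX i) cl (cp _ _)).
  apply: (pairing_ge0 (@occ_compact i) (muX i)); last exact: vX.
  exact: (addf_continuous cl (cp _ _)).
have h2 : \sum_i pairing (ter mu i) (fun x => v i (tx T x)) <=
          \sum_i pairing (ter mu i) (peval (end_cost i)).
  apply: ler_sum => i _.
  apply: (pairing_le (@target_compact _ _ hS i) (muT i) (ct i) (cp _ _)).
  exact: vT.
have h3 : 0 <= \sum_i \sum_(i' | edge i i')
       pairing (grd mu i i') (fun z => v i' (reset_map_t i' z) - v i z).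
  apply: sumr_ge0 => i _; apply: sumr_ge0 => i' e.
  apply: (pairing_ge0 (guard_set_compact e) (muS _ _ e)).
    by apply: subf_continuous; [exact: cr|exact: cv].
  by move=> z zS; rewrite subr_ge0; exact: vS.
rewrite /P_cost; lra.
Qed.

End HybridCalculus.

(** * From polynomial to C^1 test functions *)

Lemma pairing_norm (R : realType) d
    (mu : {finite_measure set (borel R d) -> \bar R}) (K : set 'rV[R]_d)
    (f g : 'rV[R]_d -> R) : compact K -> concentrated mu K ->
  continuous f -> continuous g -> (forall x, K x -> `|f x| <= g x) ->
  `|pairing mu f| <= pairing mu g.
Proof.
move=> cK muK cf cg fg; rewrite ler_norml; apply/andP; split; last first.
  by apply: (pairing_le cK muK) => // x /fg; rewrite ler_norml => /andP[].
rewrite -mulN1r -(pairingZ cK muK _ cg); apply: (pairing_le cK muK) => //.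
  exact: scalef_continuous.
by move=> x /fg; rewrite ler_norml mulN1r => /andP[].
Qed.

(** Stated for all large C, so that finitely many such conditions are met by one cube. *)
Lemma near_cube (R : realType) (V : topologicalType) d (K : set V)
    (f : V -> 'rV[R]_d) : compact K -> continuous f ->
  \forall C \near +oo, forall x, K x -> cube C (f x).
Proof.
move=> cK cf.
have bnd j : exists B, forall x, K x -> `|f x ord0 j| <= B.
  have cj : continuous (fun z : 'rV[R]_d => z ord0 j) by exact: coord_continuous.
  exact: (compact_bounded_on (compf_continuous cf cj) cK).
have {bnd}/choice[B fB] := bnd.
have H : \forall C \near +oo, forall j, B j <= C.
  by apply: filter_forall => j; exact: nbhs_pinfty_ge (num_real _).
by apply: filterS H => C BC x Kx j; exact: le_trans (fB j x Kx) (BC j).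
Qed.

Section PolynomialTests.
Variables (R : realType) (S : hybrid_system R).
Hypothesis hS : standing_assumptions S.
Implicit Types i : mode S.
Local Notation n := (@Defs.dim R S).
Local Notation m := (cdim S).
Local Notation T := (horizon S).

(** The balance of v is bounded by the sup norms of v and its first derivatives on a cube, with a
    factor that depends on [mu] but not on v. Subtracting a C^1-close polynomial, of balance 0,
    makes it arbitrarily small. *)
Lemma polynomial_feasible (mu : measures S) :
  (forall i, concentrated (occ mu i) (occ_set (i:=i))) ->
  (forall i, concentrated (ter mu i) (target (i:=i))) ->
  (forall i i', edge i i' -> concentrated (grd mu i i') (guard_set (i:=i) i')) ->
  (forall i (p : mpoly (1 + n i) R), balance mu (peval p) = 0) ->
  P_feasible mu.
Proof.
move=> muX muT muS mu0p; split=> // i v /C1_pC1 Cv; apply/balance0.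
have ctx t : continuous (@tx R (n i) t) by exact: tx_continuous.
have cres j : continuous (@reset_map_t R S j i) by exact: reset_map_t_continuous.
have csub : continuous (@lsubmx R 1 (1 + n i) m) by exact: lsubmx_continuous.
have cid (k : nat) : continuous (fun z : 'rV[R]_k => z) by move=> x A.
(* A cube containing every point at which [balance] evaluates v or its derivatives. The initial
   measure enters through a bound because it is either a Dirac mass or zero. *)
have [C [C0 X C_T Sin [Sout Init]]] : exists C, [/\ 0 < C,
   forall z, occ_set z -> cube C (lsubmx z : 'rV[R]_(1 + n i)),
   forall x : 'rV[R]_(n i), target x -> cube C (tx T x),
   forall j z, edge j i -> guard_set i z -> cube C (@reset_map_t R S j i z) &
   (forall j z, edge i j -> @guard_set R S i j z -> cube C z) /\
   forall f, continuous f -> (forall x, cube C (tx 0 x) -> `|f (tx 0 x)| <= 1) ->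
     `|pairing (mu0 i) (fun x : 'rV[R]_(n i) => f (tx 0 x))| <= 1].
  have H0 : \forall C \near +oo, 0 < C :> R by exact: nbhs_pinfty_gt (num_real _).
  have HX := near_cube (@occ_compact _ _ hS i) csub.
  have HT := near_cube (@target_compact _ _ hS i) (ctx T).
  have Hin : \forall C \near +oo, forall j z, edge j i -> guard_set i z ->
      cube C (@reset_map_t R S j i z).
    apply: filter_forall => j.
    have [e|ne] := boolP (edge j i); last by apply: nearW.
    have := near_cube (guard_set_compact hS e) (cres j).
    by apply: filterS => C h z _; exact: h.
  have Hout : \forall C \near +oo, forall j z, edge i j ->
      @guard_set R S i j z -> cube C z.
    apply: filter_forall => j.
    have [e|ne] := boolP (edge i j); last by apply: nearW.
    have := near_cube (guard_set_compact hS e) (@cid _).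
    by apply: filterS => C h z _; exact: h.
  have HI : \forall C \near +oo, forall f, continuous f ->
      (forall x, cube C (tx 0 x) -> `|f (tx 0 x)| <= 1) ->
     `|pairing (mu0 i) (fun x : 'rV[R]_(n i) => f (tx 0 x))| <= 1.
    have [[x _ E]|E] := mu0P i; last by apply: nearW => C f _ _; rewrite E normr0.
    have := near_cube (@compact_set1 _ x) (ctx 0).
    apply: filterS => C h f cf fle; rewrite E; last exact: (compf_continuous (ctx 0) cf).
    by apply: fle; exact: h.
  near +oo_R => C; exists C; split; last split.
  - by near: C; exact: H0.
  - by near: C; exact: HX.
  - by near: C; exact: HT.
  - by near: C; exact: Hin.
  - by near: C; exact: Hout.
  - by near: C; exact: HI.
pose sumF (z : 'rV[R]_(1 + n i + m)) := 1 + \sum_l `|peval (vfield l) z|.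
have csumF : continuous sumF.
  apply: addf_continuous; first exact: cstf_continuous.
  apply: sum_continuous => l _.
  have cl : continuous (peval (vfield (i:=i) l)) by exact: peval_continuous.
  exact: (compf_continuous cl (@norm_continuous _ _)).
pose one k (_ : 'rV[R]_k) : R := 1.
(* The factor of the estimate: 1 for the initial measure and the masses of the others, with the
   weight [sumF] where [lie] multiplies derivatives by the vector field. *)
pose M := 1 + pairing (occ mu i) sumF + pairing (ter mu i) (@one _)
  + (\sum_(j | edge j i) pairing (grd mu j i) (@one _)
     + \sum_(j | edge i j) pairing (grd mu i j) (@one _)).
suff Hbal e : 0 < e -> `|balance mu v| <= e * M.
  apply/eqP; rewrite -normr_le0; apply/ler_addgt0Pr => e e0; rewrite add0r.
  have M1 : 0 < `|M| + 1 by rewrite ltr_wpDl.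
  apply: le_trans (Hbal (e / (`|M| + 1)) (divr_gt0 e0 M1)) _.
  rewrite mulrAC ler_pdivrMr// ler_pM2l//.
  by apply: le_trans (ler_norm M) _; rewrite lerDl.
move=> e0; have [p pv] := polynomial_C1_density C0 Cv e0.
have Cp : pC1 (peval p) by exact: pC1_peval.
pose u x := v x - peval p x.
have -> : balance mu v = balance mu u.
  by rewrite (balanceB hS muX muT muS Cv Cp) mu0p subr0.
have cu : continuous u.
  by apply: subf_continuous; [case: Cv|exact: peval_continuous].
have Cu : pC1 u.
  rewrite (_ : u = fun x => v x + peval (-1%:A * p) x).
    by apply: pC1D => //; exact: pC1_peval.
  by apply/funext => x; rewrite pevalM -scaleN1r pevalZ pevalZ /peval meval1 !mulr1 mulN1r.
have u_le x : cube C x -> `|u x| <= e by move=> /pv[].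
have du_le x a : cube C x -> `|'D_(delta_mx ord0 a) u x| <= e.
  move=> Kx; have [_ ->] := is_derive_subf (pC1_is_derive a x Cv) (is_derive_peval p x a).
  by have [_] := pv x Kx.
have c1 (k : nat) : continuous (@one k : 'rV[R]_k -> R) by exact: cstf_continuous.
have ce (k : nat) : continuous ((fun z => e * @one k z) : 'rV[R]_k -> R).
  by exact: (scalef_continuous (c1 k)).
have hX : `|pairing (occ mu i) (lie u)| <= e * pairing (occ mu i) sumF.
  rewrite -(pairingZ (occ_compact hS (i:=i)) (muX i) _ csumF).
  apply: (pairing_norm (occ_compact hS (i:=i)) (muX i)).
  - exact: lie_continuous.
  - exact: scalef_continuous.
  - by move=> z zX; apply: lie_bound => a; apply: du_le; exact: X.
have hT : `|pairing (ter mu i) (fun x => u (tx T x))| <= e * pairing (ter mu i) (@one _).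
  rewrite -(pairingZ (target_compact hS (i:=i)) (muT i) _ (c1 _)).
  apply: (pairing_norm (target_compact hS (i:=i)) (muT i)) => //.
    exact: (compf_continuous (ctx T) cu).
  by move=> x xT; rewrite mulr1; apply: u_le; exact: C_T.
have hin : `|\sum_(j | edge j i) pairing (grd mu j i) (u \o @reset_map_t R S j i)| <=
   e * \sum_(j | edge j i) pairing (grd mu j i) (@one _).
  rewrite mulr_sumr; apply: le_trans (ler_norm_sum _ _ _) _; apply: ler_sum => j ej.
  rewrite -(pairingZ (guard_set_compact hS ej) (muS _ _ ej) _ (c1 _)).
  apply: (pairing_norm (guard_set_compact hS ej) (muS _ _ ej)) => //.
    exact: (compf_continuous (cres j) cu).
  by move=> z zS; rewrite mulr1; apply: u_le; exact: Sin.
have hout : `|\sum_(j | edge i j) pairing (grd mu i j) u| <=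
   e * \sum_(j | edge i j) pairing (grd mu i j) (@one _).
  rewrite mulr_sumr; apply: le_trans (ler_norm_sum _ _ _) _; apply: ler_sum => j ej.
  rewrite -(pairingZ (guard_set_compact hS ej) (muS _ _ ej) _ (c1 _)).
  apply: (pairing_norm (guard_set_compact hS ej) (muS _ _ ej)) => //.
  by move=> z zS; rewrite mulr1; apply: u_le; exact: Sout ej zS.
have hI : `|pairing (mu0 i) (fun x => u (tx 0 x))| <= e.
  have cue : continuous (fun x => e^-1 * u x) by exact: scalef_continuous.
  have := Init _ cue.
  have -> : pairing (mu0 i) (fun x => e^-1 * u (tx 0 x)) =
     e^-1 * pairing (mu0 i) (fun x => u (tx 0 x)).
    have [[x _ E]|E] := mu0P i; last by rewrite !E mulr0.
    by rewrite (E _ (compf_continuous (ctx 0) cu)) (E _ (compf_continuous (ctx 0) cue)).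
  rewrite normrM gtr0_norm ?invr_gt0// mulrC ler_pdivrMr// mul1r; apply.
  move=> x Kx; rewrite normrM gtr0_norm ?invr_gt0// mulrC ler_pdivrMr// mul1r.
  exact: u_le.
rewrite /balance /M !mulrDr mulr1.
apply: le_trans (ler_normD _ _) _; apply: lerD; last first.
  by apply: le_trans (ler_normB _ _) _; exact: lerD.
apply: le_trans (ler_normB _ _) _; apply: lerD => //.
by apply: le_trans (ler_normD _ _) _; exact: lerD.
Unshelve. all: by end_near. Qed.

End PolynomialTests.

(** * A strictly increasing direction for the dual constraints *)

Lemma mderiv_pvar (R : realType) d (a b : 'I_d) :
  mderiv a (pvar b) = (a == b)%:R *: 1 :> mpoly d R.
Proof.
rewrite /pvar mderivX mnm1E eq_sym; case: eqP => [->|_]; last by rewrite !scale0r.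
by rewrite -[X in mnm_sub X _]add0m addmK mpolyX0.
Qed.

(** A multiple of the distance to A vanishes on A and is at least 3 on the disjoint compact set B; a
    polynomial within 1 of it has the stated bounds. *)
Lemma polynomial_separation (R : realType) d (A B : set 'rV[R]_d) :
  compact A -> compact B -> A `&` B = set0 ->
  exists p : mpoly d R, (forall x, A x -> peval p x <= 1) /\
    (forall x, B x -> 2 <= peval p x).
Proof.
move=> cA cB AB0.
have [f cf [fA fB]] : exists2 f : 'rV[R]_d -> R, continuous f &
    (forall x, A x -> f x = 0) /\ (forall x, B x -> 3 <= f x).
  have [->|/set0P A0] := eqVneq A set0.
    by exists (fun=> 3) => //; exact: cstf_continuous.
  have cd : continuous (set_dist A : 'rV[R]_d -> R) by exact: set_dist_continuous.
  have [->|/set0P B0] := eqVneq B set0.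
    by exists (set_dist A) => //; split=> // x Ax; exact: set_dist0.
  have [b Bb bmin] := compact_EVT_min B0 cB (continuous_subspaceT cd).
  rewrite inE in Bb.
  have clA : closed A by exact: (compact_closed (@norm_hausdorff _ _)).
  have b0 : 0 < set_dist A b.
    apply: set_dist_gt0 => // Ab.
    by have : (A `&` B) b by []; rewrite AB0.
  exists (fun x => 3 / set_dist A b * set_dist A x).
    exact: scalef_continuous.
  split=> x; first by move=> Ax; rewrite (set_dist0 A0 Ax) mulr0.
  move=> Bx; rewrite -[leLHS](divfK (lt0r_neq0 b0)); apply: ler_wpM2l.
    by rewrite divr_ge0// ltW.
  by apply: bmin; rewrite inE.
have cid : continuous (fun z : 'rV[R]_d => z) by move=> x C.
have H0 : \forall C \near +oo, 0 < C :> R by exact: nbhs_pinfty_gt (num_real _).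
have HA := near_cube cA cid.
have HB := near_cube cB cid.
near +oo_R => C; have C0 : 0 < C by near: C; exact: H0.
have [p pf] := polynomial_density C0 cf (@ltr01 R).
exists p; split=> x Kx.
  have Cx : cube C x by move: x Kx; near: C; exact: HA.
  by have := pf x Cx; rewrite fA// ler_norml => /andP[]; lra.
have Cx : cube C x by move: x Kx; near: C; exact: HB.
by have := pf x Cx; have := fB x Kx; rewrite ler_norml => ? /andP[]; lra.
Unshelve. all: by end_near. Qed.

Section StrictDirection.
Variables (R : realType) (S : hybrid_system R).
Hypothesis hS : standing_assumptions S.
Implicit Types i : mode S.
Local Notation n := (@Defs.dim R S).
Local Notation m := (cdim S).
Local Notation T := (horizon S).

Lemma plieD i (v w : mpoly (1 + n i) R) : plie (v + w) = plie v + plie w.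
Proof.
rewrite /plie /tx_to_txu mderivD psubstD addrACA -big_split/=; congr (_ + _).
by apply: eq_bigr => l _; rewrite mderivD psubstD mulrDl.
Qed.

Lemma plieZ i a (v : mpoly (1 + n i) R) : plie (a *: v) = a *: plie v.
Proof.
rewrite /plie /tx_to_txu mderivZ psubstZ scalerDr; congr (_ + _).
rewrite scaler_sumr; apply: eq_bigr => l _.
by rewrite mderivZ psubstZ -!mul_mpolyC mulrA.
Qed.

Lemma plieC i c : plie (mpolyC (1 + n i) c) = 0.
Proof.
have sub0 : tx_to_txu (0 : mpoly (1 + n i) R) = 0 by exact: raddf0.
rewrite /plie mderivC sub0 add0r; apply: big1 => l _.
by rewrite mderivC sub0 mul0r.
Qed.

Lemma plie_time i : plie (pvar (lshift (n i) ord0) : mpoly (1 + n i) R) = 1.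
Proof.
have sub0 : tx_to_txu (0 : mpoly (1 + n i) R) = 0 by exact: raddf0.
rewrite /plie mderiv_pvar eqxx scale1r [tx_to_txu 1]psubst1 big1 ?addr0// => l _.
by rewrite mderiv_pvar eq_rlshift scale0r sub0 mul0r.
Qed.

(** The guards leaving [i] and the reset images arriving in [i] are two finite unions of compact
    sets, disjoint by [guard_reset_disjoint]. *)
Lemma guard_reset_separation i : exists p : mpoly (n i) R,
  (forall i' x, edge i i' -> @guard R S i i' x -> peval p x <= 1) /\
  (forall i' x, edge i' i -> guard i x -> 2 <= peval p (@reset_map R S i' i x)).
Proof.
pose G : set 'rV[R]_(n i) := \bigcup_(j in [set` [pred j | edge i j]]) @guard R S i j.
pose Q : set 'rV[R]_(n i) :=
  \bigcup_(j in [set` [pred j | edge j i]]) (@reset_map R S j i @` guard i).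
have cG : compact G.
  by rewrite /G bigcup_pred; apply: bigsetU_compact => j ej; exact: (guard_compact hS).
have cQ : compact Q.
  rewrite /Q bigcup_pred; apply: bigsetU_compact => j ej; apply: continuous_compact.
    by apply: continuous_subspaceT; exact: reset_map_continuous.
  exact: (guard_compact hS).
have [p [pG pQ]] : exists p : mpoly (n i) R, (forall x, G x -> peval p x <= 1) /\
    (forall x, Q x -> 2 <= peval p x).
  apply: polynomial_separation => //; apply/seteqP; split=> // x [[j ej gj] [k ek Rk]].
  by rewrite -(guard_reset_disjoint hS ek ej).
exists p; split=> j x ej gx; first by apply: pG; exists j.
by apply: pQ; exists j => //; exists x.
Qed.

(* [w_i = phi_i + b t - c] with [phi_i] separating guards from reset images:
   [b] dominates the derivative of [phi_i] along the flow and [c] the terminal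
   values. *)
Lemma strict_direction : exists w : forall i, mpoly (1 + n i) R,
  [/\ forall i z, occ_set z -> 1 <= lie (peval (w i)) z,
      forall i x, target x -> peval (w i) (tx T x) <= - 1 &
      forall i i' z, edge i i' -> guard_set i' z ->
        1 <= peval (w i') (reset_map_t i' z) - peval (w i) z].
Proof.
pose phi i := projT1 (cid (guard_reset_separation i)).
have phiP i := projT2 (cid (guard_reset_separation i)).
pose t i : mpoly (1 + n i) R := pvar (lshift (n i) ord0).
pose flow i := plie (x_to_tx (phi i)).
have /choice[b bP] : forall i, exists b, forall z, occ_set z -> `|peval (flow i) z| <= b.
  move=> i; apply: compact_bounded_on; [exact: peval_continuous|exact: occ_compact].
have /choice[c cP] : forall i, exists c, forall x, target x -> `|peval (phi i) x| <= c.
  move=> i; apply: compact_bounded_on; [exact: peval_continuous|exact: (target_compact hS)].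
(* Both constants are common to all modes, so that b t - c cancels across a reset and only the gap 2
   - 1 of the separating polynomials remains. *)
pose b' := 1 + \sum_i `|b i|; pose c' := 1 + b' * T + \sum_i `|c i|.
have le_sum (f : mode S -> R) i : f i <= \sum_i `|f i|.
  by apply: le_trans (ler_norm _) _; rewrite (bigD1 i)//= lerDl sumr_ge0.
pose w i := x_to_tx (phi i) + (b' *: t i - mpolyC (1 + n i) c').
have wE i z : peval (w i) z =
    peval (phi i) (rsubmx z) + (b' * lsubmx z ord0 ord0 - c').
  by rewrite pevalD pevalB pevalZ pevalC peval_pvar peval_x_to_tx !mxE.
exists w; split=> [i z zX|i x xT|i i' z e [zt gz]].
- have Cw : pC1 (peval (w i)) by exact: pC1_peval.
  have : lie (peval (w i)) z = peval (flow i) z + b'.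
    have p1 : peval (1 : mpoly (1 + n i + m) R) z = 1.
      by rewrite -mpolyC1 pevalC.
    rewrite -peval_plie plieD -mpolyCN plieD plieZ plie_time plieC addr0.
    by rewrite pevalD pevalZ p1 mulr1.
  move=> ->; have := bP i z zX; rewrite ler_norml => /andP[h _].
  by have := le_sum b i; rewrite /b'; lra.
- rewrite wE row_mxKl row_mxKr mxE.
  have := cP i x xT; rewrite ler_norml => /andP[_ h].
  by have := le_sum c i; rewrite /c'; lra.
- rewrite !wE row_mxKl row_mxKr.
  have [_ /(_ i _ e gz) h1] := phiP i'; have [/(_ i' _ e gz) h2 _] := phiP i.
  lra.
Qed.

End StrictDirection.

(** * Strict polynomial solutions of the dual *)

Section StrictPolynomialDual.
Variables (R : realType) (S : hybrid_system R).
Hypothesis hS : standing_assumptions S.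
Implicit Types i : mode S.
Local Notation n := (@Defs.dim R S).
Local Notation m := (cdim S).
Local Notation T := (horizon S).
Local Notation polys := (forall i, mpoly (1 + n i) R).
Local Notation objective v := (D_objective (fun i => peval (v i))).

Let cinit i (p : mpoly (1 + n i) R) :
  continuous ((fun x => peval p (tx 0 x)) : 'rV[R]_(n i) -> R).
Proof.
have ct : continuous (@tx R (n i) 0) by exact: tx_continuous.
have cp : continuous (peval p) by exact: peval_continuous.
exact: (compf_continuous ct cp).
Qed.

Lemma objectiveD (v w : polys) :
  objective (fun i => v i + w i) = objective v + objective w.
Proof.
rewrite /D_objective -big_split/=; apply: eq_bigr => i _.
have [[x _ E]|E] := mu0P i; last by rewrite !E addr0.
rewrite (E _ (@cinit i (v i))) (E _ (@cinit i (w i))) (E _ (@cinit i (v i + w i))).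
exact: pevalD.
Qed.

Lemma objectiveZ a (v : polys) : objective (fun i => a *: v i) = a * objective v.
Proof.
rewrite /D_objective mulr_sumr; apply: eq_bigr => i _.
have [[x _ E]|E] := mu0P i; last by rewrite !E mulr0.
rewrite (E _ (@cinit i (v i))) (E _ (@cinit i (a *: v i))).
exact: pevalZ.
Qed.

(* [inl tt] stands for the objective, the other indices for the constraints of
   (D) on occupation, terminal and guard measures; [ipoly c t v] lists the
   objective of v minus t c and the slacks of the constraints when the costs are
   multiplied by t. *)
Let idx : finType := (unit + (mode S + (mode S + mode S * mode S)))%type.

Let idim (a : idx) : nat :=
  match a with
  | inl _ => 0
  | inr (inl i) => (1 + n i + m)%N
  | inr (inr (inl i)) => n i
  | inr (inr (inr e)) => (1 + n e.1)%N
  end.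

(** The objective sits on the one point of R^0, where a measure amounts to a number. Pairs that are
    not edges get the empty set. *)
Let iset (a : idx) : set 'rV[R]_(idim a) :=
  match a with
  | inl _ => setT
  | inr (inl i) => @occ_set R S i
  | inr (inr (inl i)) => @target R S i
  | inr (inr (inr e)) => [set z | edge e.1 e.2 /\ @guard_set R S e.1 e.2 z]
  end.

Arguments iset : clear implicits.

Let ipoly (c t : R) (v : polys) (a : idx) : mpoly (idim a) R :=
  match a return mpoly (idim a) R with
  | inl _ => mpolyC 0 (objective v - t * c)
  | inr (inl i) => plie (v i) + t *: run_cost i
  | inr (inr (inl i)) => t *: end_cost i - pfinal (v i)
  | inr (inr (inr e)) => if edge e.1 e.2 then preset e.1 (v e.2) - v e.1 else 0
  end.

Let iset_compact a : compact (iset a).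
Proof.
case: a => [[]|[i|[i|[i i']]]] /=.
- have -> : [set: 'rV[R]_0] = nonneg_set [::] by apply/seteqP; split.
  by apply: archimedean_compact => -[].
- exact: occ_compact.
- exact: (target_compact hS).
- have [e|_] := boolP (edge i i').
    rewrite (_ : mkset _ = guard_set i'); first exact: guard_set_compact.
    by apply/seteqP; split=> z //= [].
  rewrite (_ : mkset _ = set0); first exact: compact0.
  by apply/seteqP; split=> z //= [].
Qed.

Let ipolyD c t t' v w a :
  ipoly c (t + t') (fun i => v i + w i) a = ipoly c t v a + ipoly c t' w a.
Proof.
case: a => [[]|[i|[i|[i i']]]] /=.
- by rewrite objectiveD -mpolyCD; congr mpolyC; ring.
- by rewrite plieD scalerDl addrACA.
- by rewrite /pfinal psubstD scalerDl opprD addrACA.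
- by case: ifP => _; rewrite ?addr0// /preset psubstD opprD addrACA.
Qed.

Let ipolyZ c s t v a : ipoly c (s * t) (fun i => s *: v i) a = s *: ipoly c t v a.
Proof.
case: a => [[]|[i|[i|[i i']]]] /=.
- by rewrite objectiveZ -mul_mpolyC -mpolyCM; congr mpolyC; ring.
- by rewrite plieZ -!mul_mpolyC mpolyCM; ring.
- by rewrite /pfinal psubstZ -!mul_mpolyC mpolyCM; ring.
- by case: ifP => _; rewrite ?scaler0// /preset psubstZ scalerBr.
Qed.

(** The multiplier t of the costs turns the slacks into a cone, to which [measure_alternative]
    applies. It has to be positive to be divided out; in the other branch it is the mass l of the
    objective that has to be. *)
Lemma strict_polynomial_dual c : (c%:E < P_value S)%E ->
  exists v : polys, [/\ c < objective v,
    forall i z, occ_set z -> 0 < peval (plie (v i) + run_cost i) z,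
    forall i x, target x -> 0 < peval (end_cost i - pfinal (v i)) x &
    forall i i' z, edge i i' -> guard_set i' z ->
      0 < peval (preset i (v i') - v i) z].
Proof.
move=> cP.
suff [t [v [t0 tv]]] : exists t v, 0 < t /\
    forall a x, iset a x -> 0 < peval (ipoly c t v a) x.
  have tV0 : 0 < t^-1 by rewrite invr_gt0.
  have tv1 a x : iset a x -> 0 < peval (ipoly c 1 (fun i => t^-1 *: v i) a) x.
    move=> ax; rewrite -(mulVf (lt0r_neq0 t0)) ipolyZ pevalZ.
    by apply: mulr_gt0 => //; exact: tv.
  exists (fun i => t^-1 *: v i); split=> [|i z zX|i x xT|i i' z e zS].
  - by have := tv1 (inl tt) 0 I; rewrite pevalC subr_gt0 mul1r.
  - by have := tv1 (inr (inl i)) z zX; rewrite /= scale1r.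
  - by have := tv1 (inr (inr (inl i))) x xT; rewrite /= scale1r.
  - by have := tv1 (inr (inr (inr (i, i')))) z (conj e zS); rewrite /= e.
have cip t v a : continuous (peval (ipoly c t v a)) by exact: peval_continuous.
pose W : set (forall a, 'rV[R]_(idim a) -> R) :=
  [set f | exists t v, 0 <= t /\ f = fun a => peval (ipoly c t v a)].
have [[w [t [v [t0 ->]]] w1]|noW] :=
    pselect (exists2 w, W w & forall a x, iset a x -> 1 <= w a x).
  have /choice[b bP] : forall a, exists b, forall x, iset a x ->
      `|peval (ipoly c 1 (fun=> 0) a) x| <= b.
    by move=> a; exact: (compact_bounded_on (cip _ _ _) (@iset_compact a)).
  pose s := 1 + \sum_a `|b a|.
  have s0 : 0 < s by rewrite ltr_wpDr ?sumr_ge0.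
  (* Here t may be 0. Adding 1/s times the data of t = 1, v = 0 makes it positive and lowers each
     slack by less than 1. *)
  exists (t + s^-1), (fun i => v i + s^-1 *: 0); split.
    by rewrite ltr_wpDl ?invr_gt0.
  move=> a x ax; rewrite -[X in t + X]mulr1 ipolyD ipolyZ pevalD pevalZ.
  have bs : b a < s.
    rewrite /s (bigD1 a)//= addrCA; apply: le_lt_trans (ler_norm _) _.
    by rewrite ltrDl ltr_wpDr ?sumr_ge0.
  have := w1 a x ax; have := bP a x ax; rewrite ler_norml => /andP[h _] h1.
  have : s^-1 * - s < s^-1 * peval (ipoly c 1 (fun=> 0) a) x.
    by rewrite ltr_pM2l ?invr_gt0//; lra.
  by rewrite mulrN mulVf ?gt_eqF//; lra.
exfalso.
have [|||||mu [muK mu1 muW]] := measure_alternative iset_compact (W := W).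
- exists 0, (fun i => 0 *: 0); split=> //; apply: functional_extensionality_dep => a.
  apply/funext => x; have := ipolyZ c 0 0 (fun=> 0) a.
  by rewrite mul0r => ->; rewrite scale0r peval0.
- move=> _ _ [t [v [t0 ->]]] [t' [v' [t'0 ->]]].
  exists (t + t'), (fun i => v i + v' i); split; first exact: addr_ge0.
  apply: functional_extensionality_dep => a; apply/funext => x.
  by rewrite ipolyD pevalD.
- move=> s _ s0 [t [v [t0 ->]]].
  exists (s * t), (fun i => s *: v i); split; first exact: mulr_ge0.
  apply: functional_extensionality_dep => a; apply/funext => x.
  by rewrite ipolyZ pevalZ.
- by move=> _ a [t [v [_ ->]]].
- by [].
have muW' t v : 0 <= t -> \sum_a pairing (mu a) (peval (ipoly c t v a)) <= 0.
  by move=> t0; apply: (muW (fun a => peval (ipoly c t v a))); exists t, v.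
pose one d (_ : 'rV[R]_d) : R := 1.
have c1 d : continuous (@one d : 'rV[R]_d -> R) by exact: cstf_continuous.
pose l := pairing (mu (inl tt)) (@one _).
have muC k : pairing (mu (inl tt)) (peval (mpolyC 0 k)) = k * l.
  rewrite -(pairingZ (@iset_compact (inl tt)) (muK _) k (c1 _)); congr pairing.
  by apply/funext => x; rewrite pevalC mulr1.
have l0 : 0 < l.
  rewrite lt_neqAle; apply/andP; split; last first.
    by apply: (pairing_ge0 (@iset_compact (inl tt)) (muK _)).
  (* If l = 0, the objective contributes nothing; the strict direction, taken with t = 0, has all
     other slacks at least 1, so its pairing is at least the total mass 1 although it must be
     nonpositive. *)
  apply/eqP => l0; have [w [wX wT wS]] := strict_direction hS.
  suff : 1 <= 0 :> R by rewrite ler10.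
  apply: le_trans (muW' 0 w (lexx _)); rewrite -mu1; apply: ler_sum => a _.
  case: a => [[]|a]; first by rewrite muC -l0 mulr0 -[leLHS]/l -l0.
  apply: (pairing_le (@iset_compact (inr a)) (muK _) (c1 _) (@cip _ _ _)).
  case: a => [i|[i|[i i']]] z /=.
  - by rewrite scale0r addr0 peval_plie; exact: wX.
  - by move=> /wT; rewrite pevalB pevalZ peval_pfinal /one; lra.
  - by move=> [e zS]; rewrite e pevalB peval_preset; exact: wS.
have lV0 : 0 <= l^-1 by rewrite invr_ge0 ltW.
pose scaled a : {finite_measure set (borel R (idim a)) -> \bar R} :=
  mscale (NngNum lV0) (mu a).
have scaledK a : concentrated (scaled a) (iset a).
  by rewrite /concentrated /= /mscale/= muK mule0.
have scaledE a f : continuous f -> pairing (mu a) f = l * pairing (scaled a) f.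
  move=> cf; rewrite /scaled pairing_mscale//=; first by rewrite mulVKf ?gt_eqF.
  exact: (compact_integrable (@iset_compact a) (muK a)).
pose M := @Measures R S (fun i => scaled (inr (inl i)))
  (fun i => scaled (inr (inr (inl i))))
  (fun i i' => scaled (inr (inr (inr (i, i'))))).
have MX i : concentrated (occ M i) (occ_set (i:=i)) by exact: (scaledK (inr (inl i))).
have MT i : concentrated (ter M i) (target (i:=i)).
  exact: (scaledK (inr (inr (inl i)))).
have MS i i' : edge i i' -> concentrated (grd M i i') (guard_set (i:=i) i').
  move=> e; have := scaledK (inr (inr (inr (i, i')))) => /=.
  congr concentrated; apply/seteqP; split=> z /=; last by split.
  by case.
have cp k (p : mpoly k R) : continuous (peval p) by exact: peval_continuous.
(* With t = 0, nonpositivity for v and for -v forces the sum of the balances to vanish; with t = 1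
   it then bounds the cost by c. *)
have key t v : \sum_a pairing (mu a) (peval (ipoly c t v a)) =
    l * (\sum_i balance M (peval (v i)) + t * (P_cost M - c)).
  rewrite (sum_balance hS MS); last by move=> i; exact: cp.
  rewrite !big_sumType/= (big_pred1 tt); last by case.
  rewrite muC.
  have -> : \sum_i pairing (mu (inr (inl i))) (peval (plie (v i) + t *: run_cost i)) =
     l * (\sum_i pairing (occ M i) (lie (peval (v i))) +
          t * \sum_i pairing (occ M i) (peval (run_cost i))).
    rewrite mulr_sumr -big_split/= mulr_sumr; apply: eq_bigr => i _.
    rewrite (scaledE (inr (inl i))); last exact: cp.
    congr (_ * _); rewrite -(pairingZ (@occ_compact _ _ hS i) (MX i) _ (cp _ _)).
    have cl : continuous (lie (peval (v i))) by apply: lie_continuous; exact: pC1_peval.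
    have cz : continuous ((fun z => t * peval (run_cost i) z) : 'rV[R]_(1 + n i + m) -> R).
      exact: (scalef_continuous (cp _ _)).
    rewrite -(pairingD (@occ_compact _ _ hS i) (MX i) cl cz).
    by congr pairing; apply/funext => z; rewrite pevalD pevalZ peval_plie.
  have -> : \sum_i pairing (mu (inr (inr (inl i)))) (peval (t *: end_cost i - pfinal (v i))) =
     l * (t * \sum_i pairing (ter M i) (peval (end_cost i)) -
          \sum_i pairing (ter M i) (fun x => peval (v i) (tx T x))).
    rewrite mulr_sumr -sumrB mulr_sumr; apply: eq_bigr => i _.
    rewrite (scaledE (inr (inr (inl i)))); last exact: cp.
    congr (_ * _); rewrite -(pairingZ (target_compact hS (i:=i)) (MT i) _ (cp _ _)).
    have ct : continuous ((fun x => peval (v i) (tx T x)) : 'rV[R]_(n i) -> R).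
      rewrite (_ : (fun x => _) = peval (pfinal (v i))); first exact: cp.
      by apply/funext => x; rewrite peval_pfinal.
    have cz : continuous ((fun z => t * peval (end_cost i) z) : 'rV[R]_(n i) -> R).
      exact: (scalef_continuous (cp _ _)).
    rewrite -(pairingB (target_compact hS (i:=i)) (MT i) cz ct).
    by congr pairing; apply/funext => z; rewrite pevalB pevalZ peval_pfinal.
  have -> : \sum_e pairing (mu (inr (inr (inr e))))
        (peval (if edge e.1 e.2 then preset e.1 (v e.2) - v e.1 else 0)) =
     l * \sum_i \sum_(i' | edge i i') pairing (grd M i i')
          (fun z => peval (v i') (reset_map_t i' z) - peval (v i) z).
    under [in RHS]eq_bigr do rewrite big_mkcond.
    rewrite pair_big/= mulr_sumr; apply: eq_bigr => -[i i'] _ /=.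
    rewrite (scaledE (inr (inr (inr (i, i'))))); last exact: cp.
    congr (_ * _); case: ifP => _; last first.
      rewrite (_ : peval 0 = fun=> 0); last by apply/funext => z; rewrite peval0.
      by rewrite /pairing /Rintegral integral0.
    by congr pairing; apply/funext => z; rewrite pevalB peval_preset.
  by rewrite /P_cost; ring.
have B0 i : balance M (peval (0 : mpoly (1 + n i) R)) = 0.
  have C0 : pC1 (peval (0 : mpoly (1 + n i) R)) by exact: pC1_peval.
  have := balanceB hS MX MT MS C0 C0; rewrite subrr => <-.
  by congr balance; apply/funext => z; rewrite subrr peval0.
have bal0 (v : polys) : \sum_i balance M (peval (v i)) = 0.
  have le0 (v' : polys) : \sum_i balance M (peval (v' i)) <= 0.
    by have := muW' 0 v' (lexx _); rewrite key mul0r addr0 pmulr_rle0.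
  apply/eqP; rewrite eq_le le0/=.
  have := le0 (fun i => 0 - v i); rewrite -oppr_ge0 -sumrN.
  have E i : balance M (peval (0 - v i)) = - balance M (peval (v i)).
    rewrite -[RHS]add0r -(B0 i) -(balanceB hS MX MT MS); try exact: pC1_peval.
    by congr balance; apply/funext => z; rewrite pevalB.
  congr (0 <= _); apply: eq_bigr => i _.
  by rewrite E opprK.
have Mfeas : P_feasible M.
  apply: (polynomial_feasible hS) => // i p.
  (* Test functions supported in a single mode isolate its balance. *)
  have := bal0 (dfwith (fun=> 0) i p).
  rewrite (bigD1 i)//= dfwithin big1 ?addr0// => j ji.
  by rewrite dfwithout 1?eq_sym.
have : P_cost M <= c.
  have := muW' 1 (fun=> 0) ler01; rewrite key bal0 add0r mul1r.
  by rewrite pmulr_rle0// subr_le0.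
move=> Mc; have PM : (P_value S <= (P_cost M)%:E)%E.
  by apply: ereal_inf_lbound; exists M.
by have := lt_le_trans cP PM; rewrite lte_fin ltNge Mc.
Qed.

End StrictPolynomialDual.

(** * The truncated hierarchies *)

Section RieszFunctional.
Variables (R : realType) (d : nat).
Implicit Types (p q h : mpoly d R) (y : moment_seq (R := R) d).

(** A range of exponents independent of p makes linearity visible. *)
Lemma rieszE k y p : (mmeasure (@mdeg d) p <= k)%N ->
  riesz y p = \sum_(a : bmultinom d k) mcoeff (bmnm a) p * y (bmnm a).
Proof.
move=> pk; pose I : subFinType _ := bmultinom d k.
rewrite /riesz (big_mksub I)//=; first last.
- by move=> x /msize_mdeg_lt /leq_trans; apply.
- exact: msupp_uniq.
by rewrite big_rmcond //= => i; move/memN_msupp_eq0 ->; rewrite mul0r.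
Qed.

Lemma rieszD y p q : riesz y (p + q) = riesz y p + riesz y q.
Proof.
pose k := maxn (mmeasure (@mdeg d) (p + q))
  (maxn (mmeasure (@mdeg d) p) (mmeasure (@mdeg d) q)).
rewrite !(@rieszE k) /k ?leq_max ?leqnn ?orbT// -big_split/=.
by apply: eq_bigr => a _; rewrite mcoeffD mulrDl.
Qed.

Lemma rieszZ y c p : riesz y (c *: p) = c * riesz y p.
Proof.
pose k := maxn (mmeasure (@mdeg d) (c *: p)) (mmeasure (@mdeg d) p).
rewrite !(@rieszE k) /k ?leq_max ?leqnn ?orbT// mulr_sumr.
by apply: eq_bigr => a _; rewrite mcoeffZ mulrA.
Qed.

Lemma riesz0 y : riesz y 0 = 0.
Proof. by rewrite -(scale0r (0 : mpoly d R)) rieszZ mul0r. Qed.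

Lemma rieszB y p q : riesz y (p - q) = riesz y p - riesz y q.
Proof. by rewrite -scaleN1r rieszD rieszZ mulN1r. Qed.

Lemma riesz_sum (I : Type) (r : seq I) (P : pred I) (F : I -> mpoly d R) y :
  riesz y (\sum_(i <- r | P i) F i) = \sum_(i <- r | P i) riesz y (F i).
Proof. by apply: (big_morph (riesz y)) => [p q|]; rewrite ?rieszD ?riesz0. Qed.

Lemma rieszX y a : riesz y (mpolyX R a) = y a.
Proof. by rewrite /riesz msuppX big_seq1 mcoeffX eqxx mul1r. Qed.

Definition row_poly k (c : 'rV[R]_#|{: bmultinom d k.+1}|) : mpoly d R :=
  \sum_a c ord0 a *: mpolyX R (bmnm (enum_val a)).

Lemma row_poly_surj k p : (mmeasure (@mdeg d) p <= k.+1)%N ->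
  exists c : 'rV[R]_#|{: bmultinom d k.+1}|, p = row_poly c.
Proof.
move=> /mpolywE pE; exists (\row_a mcoeff (bmnm (enum_val a)) p).
rewrite [LHS]pE (reindex_onto (@enum_val _ _) enum_rank)/=; last first.
  by move=> i _; rewrite enum_rankK.
rewrite /row_poly; apply: eq_big => a; last by move=> _; rewrite mxE.
by rewrite enum_valK eqxx.
Qed.

Lemma row_poly_size k (c : 'rV[R]_#|{: bmultinom d k.+1}|) :
  (mmeasure (@mdeg d) (row_poly c) <= k.+1)%N.
Proof.
apply: (leq_trans (mmeasure_sum _ _ _ _)).
apply/bigmax_leqP => a _; apply: (leq_trans (mmeasureZ_le _ _ _)).
by rewrite mmeasureX; exact: bmdeg.
Qed.

Lemma localizing_form k h y (c : 'rV[R]_#|{: bmultinom d k.+1}|) :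
  (c *m localizing_matrix k h y *m c^T) ord0 ord0 = riesz y (row_poly c ^+ 2 * h).
Proof.
have rX e : riesz y (mpolyX R e * h) = \sum_(b <- msupp h) mcoeff b h * y (mnm_add b e).
  rewrite {1}[h]mpolyE mulr_sumr riesz_sum; apply: eq_bigr => b _.
  rewrite -(rieszX y (mnm_add b e)) -rieszZ; congr riesz.
  by rewrite mpolyXD -scalerAr mulrC.
rewrite expr2 {2}/row_poly mulr_sumr mulr_suml riesz_sum mxE.
apply: eq_bigr => b _; rewrite mxE [c^T _ _]mxE mulrC.
rewrite -scalerAr -scalerAl rieszZ; congr (_ * _).
rewrite /row_poly !mulr_suml riesz_sum; apply: eq_bigr => a _.
by rewrite -!scalerAl rieszZ -mpolyXD rX mxE.
Qed.

Lemma moment_matrix1 k y : moment_matrix k y = localizing_matrix k 1 y.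
Proof.
apply/matrixP => a b; rewrite !mxE -mpolyC1 msupp1 big_seq1.
by rewrite mcoeffC eqxx !mulr1 mul1r add0m.
Qed.

(** The quadratic form at the coefficient vector of q is L_y(q^2 h). As [mmeasure] is the degree
    plus one, or 0 for the zero polynomial, the bound [k.+1] means degree at most k. *)
Lemma localizing_psdP k h y : psd (localizing_matrix k h y) <->
  forall q, (mmeasure (@mdeg d) q <= k.+1)%N -> 0 <= riesz y (q ^+ 2 * h).
Proof.
split=> [[_ h0] q /row_poly_surj[c ->]|h0].
  by rewrite -localizing_form; exact: h0.
split; last by move=> c; rewrite localizing_form; apply: h0; exact: row_poly_size.
by apply/matrixP => a b; rewrite !mxE; apply: eq_bigr => c _; rewrite [mnm_add (bmnm _) _]addmC.
Qed.

Lemma moment_psdP k y : psd (moment_matrix k y) <->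
  forall q, (mmeasure (@mdeg d) q <= k.+1)%N -> 0 <= riesz y (q ^+ 2).
Proof.
rewrite moment_matrix1 localizing_psdP.
by split=> h q /h; rewrite mulr1.
Qed.

End RieszFunctional.

(** A certificate involves finitely many squares, so one threshold on k covers all its terms. The
    threshold is uniform in y, since the admissible y change with k. *)
Lemma qgen_riesz (R : realType) d (Y : Type) (E : nat -> Y -> Prop)
    (f : Y -> moment_seq d) (gs : seq (mpoly d R)) p :
  (forall g, g \in 1 :: gs -> forall q, \forall k \near \oo,
     forall y, E k y -> 0 <= riesz (f y) (q ^+ 2 * g)) ->
  qgen gs p -> \forall k \near \oo, forall y, E k y -> 0 <= riesz (f y) p.
Proof.
move=> Eg [s0 [s [S0 Ss ->]]].
pose nn p := \forall k \near \oo, forall y, E k y -> 0 <= riesz (f y) p.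
have nnD p1 p2 : nn p1 -> nn p2 -> nn (p1 + p2).
  move=> h1 h2; apply: filterS2 h1 h2 => k h1 h2 y Ey.
  by rewrite rieszD addr_ge0 ?h1 ?h2.
have nn0 : nn 0 by apply: nearW => k y _; rewrite riesz0.
have nnM g r : g \in 1 :: gs -> sos r -> nn (r * g).
  move=> /Eg gq [qs ->]; rewrite mulr_suml; apply: (big_ind nn) => // q _.
  exact: gq.
apply: (nnD); first by rewrite -[s0]mulr1; apply: (nnM); rewrite ?inE ?eqxx.
apply: (big_ind nn nn0 nnD) => l _; apply: nnM => //.
by rewrite inE mem_nth ?orbT.
Qed.

Lemma quad_module_mono (R : realType) d (k l : nat) (gs : seq (mpoly d R)) p :
  (k <= l)%N -> quad_module k gs p -> quad_module l gs p.
Proof.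
move=> kl [pk [s0 [s [[S0 s0k] Ss pE]]]].
split; first exact: leq_trans pk kl.
exists s0, s; split=> //; first by split=> //; exact: leq_trans kl.
by move=> j; have [? ?] := Ss j; split=> //; exact: leq_trans kl.
Qed.

Lemma qgen_quad_module (R : realType) d (gs : seq (mpoly d R)) p :
  qgen gs p -> \forall k \near \oo, quad_module (2 * k) gs p.
Proof.
move=> [s0 [s [S0 Ss ->]]].
have H : \forall k \near \oo, forall l, (pdeg (s l * gs`_l)%R <= k)%N.
  by apply: filter_forall => j; exact: nbhs_infty_ge.
near=> k.
have kl j : (j <= k)%N -> (j <= 2 * k)%N by move=> /leq_trans; apply; rewrite leq_pmull.
split; first by apply: kl; near: k; exact: nbhs_infty_ge.
exists s0, s; split=> //; first split=> //.
  by apply: kl; near: k; exact: nbhs_infty_ge.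
move=> l; split=> //; apply: kl.
by move: l; near: k; exact: H.
Unshelve. all: by end_near. Qed.

(** * Monotonicity and bounds of the hierarchies *)

Section Hierarchy.
Variables (R : realType) (S : hybrid_system R).
Implicit Types i : mode S.
Local Notation n := (@Defs.dim R S).
Local Notation m := (cdim S).
Local Notation T := (horizon S).
Local Notation polys := (forall i, mpoly (1 + n i) R).
Local Notation objective v := (D_objective (fun i => peval (v i))).

Lemma localizing_psd_ge0 d k h (y : moment_seq (R := R) d) q :
  localizing_psd k h y -> (uphalf (pdeg h) + mmeasure (@mdeg d) q <= k)%N ->
  0 <= riesz y (q ^+ 2 * h).
Proof.
move=> + hk => /(_ (leq_trans (leq_addr _ _) hk))/localizing_psdP; apply.
by move: hk; lia.
Qed.

Lemma localizing_psd_pred d k h (y : moment_seq (R := R) d) :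
  localizing_psd k.+1 h y -> localizing_psd k h y.
Proof.
move=> H hk; have /localizing_psdP h0 := H (leqW hk).
by apply/localizing_psdP => q qk; apply: h0; lia.
Qed.

Lemma localizing_matrix_pred d k l h (y : moment_seq (R := R) d) : (k <= l)%N ->
  psd (localizing_matrix l h y) -> psd (localizing_matrix k h y).
Proof.
move=> kl /localizing_psdP h0; apply/localizing_psdP => q qk.
by apply: h0; exact: leq_trans qk _.
Qed.

Lemma moment_matrix_pred d k (y : moment_seq (R := R) d) :
  psd (moment_matrix k.+1 y) -> psd (moment_matrix k y).
Proof. by rewrite !moment_matrix1; exact: localizing_matrix_pred. Qed.

(** The same sequences are kept: the linear tests of order k are also tests of order k + 1, and the
    matrices are principal submatrices up to indexing. *)
Lemma Pk_feasible_pred k (y : moments S) : Pk_feasible k.+1 y -> Pk_feasible k y.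
Proof.
have lek j : (j <= 2 * k)%N -> (j <= 2 * k.+1)%N by lia.
have kk : (k.-1 <= k)%N by exact: leq_pred.
move=> [yL yX yT yS]; split=> [i v v1 v2 v3|i|i|i i' e].
- by apply: yL => [||i' e]; apply: lek => //; exact: v3.
- have [h1 h2 h3 h4] := yX i; split=> [||g gin|g gin].
  + exact: moment_matrix_pred.
  + exact: localizing_matrix_pred h2.
  + exact/localizing_psd_pred/h3.
  + exact/localizing_psd_pred/h4.
- have [h1 h2] := yT i; split=> [|g gin]; first exact: moment_matrix_pred.
  exact/localizing_psd_pred/h2.
- have [h1 h2 h3] := yS i i' e; split=> [||g gin].
  + exact: moment_matrix_pred.
  + exact: localizing_matrix_pred h2.
  + exact/localizing_psd_pred/h3.
Qed.

Lemma Dk_feasible_succ k (v : polys) : Dk_feasible k v -> Dk_feasible k.+1 v.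
Proof.
have lek : (2 * k <= 2 * k.+1)%N by lia.
move=> [vd vX vT vS]; split=> [i|i|i|i i' e].
- exact: leq_trans (vd i) lek.
- exact: quad_module_mono lek (vX i).
- exact: quad_module_mono lek (vT i).
- exact: quad_module_mono lek (vS i i' e).
Qed.

Lemma quad_module_ge0 d k (gs : seq (mpoly d R)) p :
  quad_module k gs p -> forall z, nonneg_set gs z -> 0 <= peval p z.
Proof.
have sos_ge0 (r : mpoly d R) z : sos r -> 0 <= peval r z.
  move=> [qs ->]; rewrite peval_sum; apply: sumr_ge0 => q _.
  by rewrite pevalX sqr_ge0.
move=> [_ [s0 [s [[S0 _] Ss ->]]]] z gz; rewrite pevalD.
apply: addr_ge0; first exact: sos_ge0.
rewrite peval_sum; apply: sumr_ge0 => l _; have [Sl _] := Ss l.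
rewrite pevalM; apply: mulr_ge0; first exact: sos_ge0.
by apply: gz; exact: mem_nth.
Qed.

Lemma Dk_feasible_D k (v : polys) : standing_assumptions S ->
  Dk_feasible k v -> D_feasible (fun i => peval (v i)).
Proof.
move=> hS [_ vX vT vS]; split=> [i|i z zX|i x xT|i i' z e zS].
- exact: C1_peval.
- move: zX; rewrite occ_set_gens// => /(quad_module_ge0 (vX i)).
  by rewrite pevalD peval_plie.
- by have := quad_module_ge0 (vT i) xT; rewrite pevalB peval_pfinal subr_ge0.
- move: zS; rewrite guard_set_gens// => /(quad_module_ge0 (vS i i' e)).
  by rewrite pevalB peval_preset subr_ge0.
Qed.

Lemma riesz_pairing d (mu : {finite_measure set (borel R d) -> \bar R})
    (K : set 'rV[R]_d) (p : mpoly d R) : compact K -> concentrated mu K ->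
  riesz (fun a => pairing mu (peval (mpolyX R a))) p = pairing mu (peval p).
Proof.
move=> cK muK; have cp (q : mpoly d R) : continuous (peval q).
  by exact: peval_continuous.
rewrite [in RHS](mpolyE p) /riesz.
elim: (msupp p) => [|a r ih].
  rewrite !big_nil (_ : peval 0 = fun=> 0).
    by rewrite /pairing /Rintegral integral0.
  by apply/funext => x; rewrite peval0.
rewrite !big_cons ih -(pairingZ cK muK _ (cp _)).
have ca : continuous ((fun x => mcoeff a p * peval (mpolyX R a) x) : 'rV[R]_d -> R).
  exact: (scalef_continuous (cp _)).
rewrite -(pairingD cK muK ca (cp _)).
by congr pairing; apply/funext => x; rewrite pevalD pevalZ.
Qed.

Lemma pairing_psd d (mu : {finite_measure set (borel R d) -> \bar R})
    (K : set 'rV[R]_d) (h : mpoly d R) k : compact K -> concentrated mu K ->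
  (forall x, K x -> 0 <= peval h x) ->
  psd (localizing_matrix k h (fun a => pairing mu (peval (mpolyX R a)))).
Proof.
move=> cK muK h0; apply/localizing_psdP => q _.
rewrite (riesz_pairing _ cK muK); apply: (pairing_ge0 cK muK).
  exact: peval_continuous.
by move=> x Kx; rewrite pevalM pevalX mulr_ge0 ?sqr_ge0 ?h0.
Qed.

Lemma P_feasible_Pk k (mu : measures S) : standing_assumptions S ->
  P_feasible mu -> exists2 y : moments S, Pk_feasible k y & Pk_cost y = P_cost mu.
Proof.
move=> hS [muX muT muS muE].
pose y := @Moments R S (fun i a => pairing (occ mu i) (peval (mpolyX R a)))
  (fun i a => pairing (ter mu i) (peval (mpolyX R a)))
  (fun i i' a => pairing (grd mu i i') (peval (mpolyX R a))).
have rX i p : riesz (@occ_y R S y i) p = pairing (occ mu i) (peval p).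
  exact: (riesz_pairing _ (@occ_compact _ _ hS i) (muX i)).
have rT i p : riesz (@ter_y R S y i) p = pairing (ter mu i) (peval p).
  exact: (riesz_pairing _ (target_compact hS (i:=i)) (muT i)).
have rS i i' p : edge i i' -> riesz (@grd_y R S y i i') p = pairing (grd mu i i') (peval p).
  by move=> e; exact: (riesz_pairing _ (guard_set_compact hS e) (muS i i' e)).
have one_ge0 d (K : set 'rV[R]_d) x : K x -> 0 <= peval (1 : mpoly d R) x.
  by move=> _; rewrite -mpolyC1 pevalC.
exists y; last first.
  by rewrite /Pk_cost /P_cost; congr (_ + _); apply: eq_bigr => i _; rewrite ?rX ?rT.
split=> [i v _ _ _|i|i|i i' e].
- have := muE i _ (@C1_peval R _ v).
  rewrite rX rT (_ : peval (plie v) = lie (peval v)); last first.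
    by apply/funext => z; rewrite peval_plie.
  rewrite (_ : peval (pfinal v) = fun x => peval v (tx T x)); last first.
    by apply/funext => x; rewrite peval_pfinal.
  rewrite (eq_bigr (fun i' => riesz (@grd_y R S y i' i) (preset i' v))).
    by rewrite [in RHS](eq_bigr (fun i' => riesz (@grd_y R S y i i') v))// => i' e; rewrite rS.
  move=> i' e; rewrite rS//; congr pairing; apply/funext => z.
  by rewrite peval_preset.
- have psdX h l : (forall z, occ_set z -> 0 <= peval h z) ->
      psd (localizing_matrix l h (@occ_y R S y i)).
    exact: (pairing_psd l (@occ_compact _ _ hS i) (muX i)).
  have gX g : g \in occ_gens i -> forall z, @occ_set R S i z -> 0 <= peval g z.
    by move=> gin z; rewrite occ_set_gens//; apply.
  split=> [||g gin _|g gin _].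
  + by rewrite moment_matrix1; apply: psdX; exact: one_ge0.
  + by apply/psdX/gX; rewrite inE eqxx.
  + apply/psdX/gX; rewrite inE mem_cat.
    by rewrite (map_f (fun g => tx_to_txu (x_to_tx g)) gin) orbT.
  + by apply/psdX/gX; rewrite inE mem_cat (map_f (@u_to_txu R S i) gin) !orbT.
- have psdT h l : (forall z, target z -> 0 <= peval h z) ->
      psd (localizing_matrix l h (@ter_y R S y i)).
    exact: (pairing_psd l (target_compact hS (i:=i)) (muT i)).
  split=> [|g gin _]; first by rewrite moment_matrix1; apply: psdT; exact: one_ge0.
  by apply: psdT => x; apply.
- have psdS h l : (forall z, guard_set i' z -> 0 <= peval h z) ->
      psd (localizing_matrix l h (@grd_y R S y i i')).
    exact: (pairing_psd l (guard_set_compact hS e) (muS i i' e)).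
  have gS g : g \in grd_gens i i' -> forall z, @guard_set R S i i' z -> 0 <= peval g z.
    by move=> gin z; rewrite guard_set_gens//; apply.
  split=> [||g gin _].
  + by rewrite moment_matrix1; apply: psdS; exact: one_ge0.
  + by apply/psdS/gS; rewrite inE eqxx.
  + by apply/psdS/gS; rewrite inE (map_f (@x_to_tx R S i) gin) orbT.
Qed.

End Hierarchy.

(** * Convergence of both hierarchies *)

Section Convergence.
Variables (R : realType) (S : hybrid_system R).
Hypothesis hS : standing_assumptions S.
Implicit Types i : mode S.
Local Notation n := (@Defs.dim R S).
Local Notation m := (cdim S).
Local Notation T := (horizon S).
Local Notation polys := (forall i, mpoly (1 + n i) R).
Local Notation objective v := (D_objective (fun i => peval (v i))).

Let le_near (f : nat) : \forall k \near \oo, (f <= 2 * k)%N.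
Proof.
by near=> k; apply: (@leq_trans k); [near: k; exact: nbhs_infty_ge|rewrite leq_pmull].
Unshelve. all: by end_near. Qed.

Section Certificates.
Variable v : polys.
Hypotheses
  (vX : forall i, qgen (occ_gens i) (plie (v i) + run_cost i))
  (vT : forall i, qgen (hT i) (end_cost i - pfinal (v i)))
  (vS : forall i i', edge i i' ->
     qgen (grd_gens i i') (preset i (v i') - v i)).

Lemma Dk_feasible_near : \forall k \near \oo, Dk_feasible k v.
Proof.
have h1 : \forall k \near \oo, forall i, (pdeg (v i) <= 2 * k)%N.
  by apply: filter_forall => i; exact: le_near.
have h2 : \forall k \near \oo, forall i,
    quad_module (2 * k) (occ_gens i) (plie (v i) + run_cost i).
  by apply: filter_forall => i; exact: qgen_quad_module.
have h3 : \forall k \near \oo, forall i,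
    quad_module (2 * k) (hT i) (end_cost i - pfinal (v i)).
  by apply: filter_forall => i; exact: qgen_quad_module.
have h4 : \forall k \near \oo, forall i i', edge i i' ->
    quad_module (2 * k) (grd_gens i i') (preset i (v i') - v i).
  apply: filter_forall => i; apply: filter_forall => i'.
  have [e|_] := boolP (edge i i'); last exact: nearW.
  by apply: filterS (qgen_quad_module (vS e)) => k h _.
near=> k; split=> [i|i|i|i i'].
- by move: i; near: k; exact: h1.
- by move: i; near: k; exact: h2.
- by move: i; near: k; exact: h3.
- by move: i i'; near: k; exact: h4.
Unshelve. all: by end_near. Qed.

Let occ_near i : \forall k \near \oo, forall y, Pk_feasible k y ->
  0 <= riesz (@occ_y R S y i) (plie (v i) + run_cost i).
Proof.
apply: (qgen_riesz (f := fun y => @occ_y R S y i) _ (vX i)) => g gin q.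
apply: filterS (nbhs_infty_ge (uphalf (pdeg g) + mmeasure (@mdeg _) q).+1).
move=> k /= qk y [_ /(_ i)[h1 h2 h3 h4] _ _].
have q3 : (uphalf (pdeg g) + mmeasure (@mdeg _) q <= k)%N by lia.
have q1 : (mmeasure (@mdeg _) q <= k.+1)%N by lia.
have q2 : (mmeasure (@mdeg _) q <= k.-1.+1)%N by lia.
move: gin q3; rewrite !inE => /predU1P[->|/predU1P[->|]] => [_|_|].
- by rewrite mulr1; move/moment_psdP: h1; apply.
- by move/localizing_psdP: h2; apply.
- rewrite mem_cat => /orP[] /mapP[h hin ->]; apply: localizing_psd_ge0.
    exact: h3.
  exact: h4.
Qed.

Let ter_near i : \forall k \near \oo, forall y, Pk_feasible k y ->
  0 <= riesz (@ter_y R S y i) (end_cost i - pfinal (v i)).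
Proof.
apply: (qgen_riesz (f := fun y => @ter_y R S y i) _ (vT i)) => g gin q.
apply: filterS (nbhs_infty_ge (uphalf (pdeg g) + mmeasure (@mdeg _) q)).
move=> k /= q3 y [_ _ /(_ i)[h1 h2] _].
have q1 : (mmeasure (@mdeg _) q <= k.+1)%N by lia.
move: gin q3; rewrite inE => /predU1P[->|gin] => [_|].
  by rewrite mulr1; move/moment_psdP: h1; apply.
by apply: localizing_psd_ge0; exact: h2.
Qed.

Let grd_near i i' : edge i i' -> \forall k \near \oo, forall y, Pk_feasible k y ->
  0 <= riesz (@grd_y R S y i i') (preset i (v i') - v i).
Proof.
move=> e; apply: (qgen_riesz (f := fun y => @grd_y R S y i i') _ (vS e)) => g gin q.
apply: filterS (nbhs_infty_ge (uphalf (pdeg g) + mmeasure (@mdeg _) q).+1).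
move=> k /= qk y [_ _ _ /(_ i i' e)[h1 h2 h3]].
have q3 : (uphalf (pdeg g) + mmeasure (@mdeg _) q <= k)%N by lia.
have q1 : (mmeasure (@mdeg _) q <= k.+1)%N by lia.
have q2 : (mmeasure (@mdeg _) q <= k.-1.+1)%N by lia.
move: gin q3; rewrite !inE => /predU1P[->|/predU1P[->|]] => [_|_|].
- by rewrite mulr1; move/moment_psdP: h1; apply.
- by move/localizing_psdP: h2; apply.
- by move=> /mapP[h hin ->]; apply: localizing_psd_ge0; exact: h3.
Qed.

(** Weak duality with L_y in place of integrals: once 2 k exceeds the degrees involved, v is itself
    a test in the linear constraints, and the certificates replace pointwise inequalities. *)
Lemma Pk_cost_near : \forall k \near \oo, forall y : moments S, Pk_feasible k y ->
  objective v <= Pk_cost y.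
Proof.
have h1 : \forall k \near \oo, forall i, (pdeg (v i) <= 2 * k)%N.
  by apply: filter_forall => i; exact: le_near.
have h2 : \forall k \near \oo, forall i, (pdeg (plie (v i)) <= 2 * k)%N.
  by apply: filter_forall => i; exact: le_near.
have h3 : \forall k \near \oo, forall i i', (pdeg (preset i' (v i)) <= 2 * k)%N.
  by apply: filter_forall => i; apply: filter_forall => i'; exact: le_near.
have hX : \forall k \near \oo, forall i y, Pk_feasible k y ->
    0 <= riesz (@occ_y R S y i) (plie (v i) + run_cost i).
  by apply: filter_forall => i; exact: occ_near.
have hT : \forall k \near \oo, forall i y, Pk_feasible k y ->
    0 <= riesz (@ter_y R S y i) (end_cost i - pfinal (v i)).
  by apply: filter_forall => i; exact: ter_near.
have hG : \forall k \near \oo, forall i i' y, edge i i' -> Pk_feasible k y ->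
    0 <= riesz (@grd_y R S y i i') (preset i (v i') - v i).
  apply: filter_forall => i; apply: filter_forall => i'.
  have [e|_] := boolP (edge i i'); last exact: nearW.
  by apply: filterS (grd_near e) => k h y _; exact: h.
near=> k.
have k1 : forall i, (pdeg (v i) <= 2 * k)%N by near: k; exact: h1.
have k2 : forall i, (pdeg (plie (v i)) <= 2 * k)%N by near: k; exact: h2.
have k3 : forall i i', (pdeg (preset i' (v i)) <= 2 * k)%N by near: k; exact: h3.
have kX : forall i y, Pk_feasible k y ->
  0 <= riesz (@occ_y R S y i) (plie (v i) + run_cost i) by near: k; exact: hX.
have kT : forall i y, Pk_feasible k y ->
  0 <= riesz (@ter_y R S y i) (end_cost i - pfinal (v i)) by near: k; exact: hT.
have kG : forall i i' y, edge i i' -> Pk_feasible k y ->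
  0 <= riesz (@grd_y R S y i i') (preset i (v i') - v i) by near: k; exact: hG.
move=> y Fy; have [yL _ _ _] := Fy.
pose a i i' := riesz (@grd_y R S y i i') (preset i (v i')).
pose b i i' := riesz (@grd_y R S y i i') (v i).
have sX : 0 <= \sum_i riesz (@occ_y R S y i) (plie (v i)) +
               \sum_i riesz (@occ_y R S y i) (run_cost i).
  by rewrite -big_split/=; apply: sumr_ge0 => i _; rewrite -rieszD; exact: kX.
have sT : \sum_i riesz (@ter_y R S y i) (pfinal (v i)) <=
          \sum_i riesz (@ter_y R S y i) (end_cost i).
  by apply: ler_sum => i _; rewrite -subr_ge0 -rieszB; exact: kT.
have sG : 0 <= \sum_i \sum_(i' | edge i i') (a i i' - b i i').
  by do 2 apply: sumr_ge0 => ? ?; rewrite -rieszB; exact: kG.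
have E : objective v + \sum_i riesz (@occ_y R S y i) (plie (v i)) -
    \sum_i riesz (@ter_y R S y i) (pfinal (v i)) +
    \sum_i \sum_(i' | edge i i') (a i i' - b i i') = 0.
  rewrite -edge_exchange /D_objective -big_split/= -sumrB -big_split/=.
  apply: big1 => i _; have := yL i (v i) (k1 i) (k2 i) (fun i' _ => k3 i i').
  set x1 := pairing _ _; set x2 := riesz _ _; set x3 := \sum_(i' | _) _.
  set x4 := riesz _ _; set x5 := \sum_(i' | _) _.
  rewrite -/x3 -/x5; lra.
rewrite /Pk_cost; lra.
Unshelve. all: by end_near. Qed.

End Certificates.

Lemma value_near (c : R) : (c%:E < P_value S)%E ->
  \forall k \near \oo, (c%:E <= Pk_value S k /\ c%:E <= Dk_value S k)%E.
Proof.
move=> /(strict_polynomial_dual hS)[v [cv vX vT vS]].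
have qX i : qgen (occ_gens i) (plie (v i) + run_cost i).
  apply: putinar; first exact: archimedean_occ.
  by move=> z; rewrite -occ_set_gens//; exact: vX.
have qT i : qgen (hT i) (end_cost i - pfinal (v i)).
  by apply: putinar; [exact: archimedean_target|exact: vT].
have qS i i' : edge i i' -> qgen (grd_gens i i') (preset i (v i') - v i).
  move=> e; apply: putinar; first exact: archimedean_grd.
  by move=> z; rewrite -guard_set_gens//; exact: vS.
apply: filterS2 (Pk_cost_near qX qT qS) (Dk_feasible_near qX qT qS) => k hP hD.
split.
  apply: le_ereal_inf_tmp => _ [y Fy <-]; rewrite lee_fin.
  by apply: le_trans (ltW cv) _; exact: hP.
apply: (@le_trans _ _ (objective v)%:E); first by rewrite lee_fin ltW.
by apply: ereal_sup_ubound; exists v.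
Qed.

End Convergence.

Lemma ereal_le_of_lt_real (R : realType) (x y : \bar R) :
  (forall c : R, (c%:E < x)%E -> (c%:E <= y)%E) -> (x <= y)%E.
Proof.
case: x => [x||] h.
- apply/lee_subgt0Pr => e e0; rewrite -EFinB; apply: h.
  by rewrite lte_fin ltrBlDr ltrDl.
- rewrite leye_eq; apply/eqP/eqyP => A _; apply: h; exact: ltry.
- exact: leNye.
Qed.

(** Infinite limits are included: for x = +oo the last hypothesis ranges over all real c, and for x
    = -oo it is void while the second one makes u constant. *)
Lemma ereal_monotone_cvg (R : realType) (u : nat -> \bar R) (x : \bar R) :
  (forall k, u k <= u k.+1)%E -> (forall k, u k <= x)%E ->
  (forall c : R, (c%:E < x)%E -> \forall k \near \oo, (c%:E <= u k)%E) ->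
  u k @[k --> \oo] --> x.
Proof.
move=> u_mono ux xu.
have -> : x = ereal_sup (range u).
  apply/eqP; rewrite eq_le; apply/andP; split.
    apply: ereal_le_of_lt_real => c /xu[k _ ck].
    apply: (le_trans (ck k (leqnn k))).
    by apply: ereal_sup_ubound; exists k.
  by apply: ub_ereal_sup => _ [k _ <-].
by apply: ereal_nondecreasing_cvgn; apply/nondecreasing_seqP.
Qed.

Local Open Scope ereal_scope.

Theorem theorem25 (R : realType) (S : hybrid_system R)
    (hS : standing_assumptions S) :
  [/\ P_value S = D_value S,
      (forall k : nat, (1 <= k)%N ->
         Pk_value S k <= Pk_value S k.+1 /\ Pk_value S k <= P_value S),
      Pk_value S k @[k --> \oo] --> P_value S,
      (forall k : nat, (1 <= k)%N ->
         Dk_value S k <= Dk_value S k.+1 /\ Dk_value S k <= D_value S) &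
      Dk_value S k @[k --> \oo] --> D_value S].
Proof.
have PkS k : Pk_value S k <= Pk_value S k.+1.
  apply: ereal_inf_le_tmp => _ [y Fy <-]; exists y => //.
  exact: Pk_feasible_pred.
have PkP k : Pk_value S k <= P_value S.
  apply: le_ereal_inf_tmp => _ [mu Fmu <-].
  have [y Fy <-] := P_feasible_Pk k hS Fmu.
  by apply: ereal_inf_lbound; exists y.
have DkS k : Dk_value S k <= Dk_value S k.+1.
  apply: ereal_sup_le => _ [v Fv <-]; exists v => //.
  exact: Dk_feasible_succ.
have DkD k : Dk_value S k <= D_value S.
  apply: ge_ereal_sup => _ [v Fv <-]; apply: ereal_sup_ubound.
  by exists (fun i => peval (v i)) => //; exact: Dk_feasible_D Fv.
have near c : c%:E < P_value S ->
    \forall k \near \oo, c%:E <= Pk_value S k /\ c%:E <= Dk_value S k.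
  exact: value_near.
(* The absence of a duality gap is a by-product: every real c below the primal value is eventually
   below D_k, which is at most the dual value. *)
have PD : P_value S = D_value S.
  apply/eqP; rewrite eq_le; apply/andP; split.
    apply: ereal_le_of_lt_real => c /near[k _ /(_ k (leqnn k))[_ cD]].
    exact: le_trans cD (DkD k).
  apply: ge_ereal_sup => _ [v Fv <-]; apply: le_ereal_inf_tmp => _ [mu Fmu <-].
  by rewrite lee_fin; exact: weak_duality.
split=> //.
- apply: ereal_monotone_cvg => // c /near.
  by apply: filterS => k [].
- rewrite -PD; apply: ereal_monotone_cvg => // [k|c /near].
    by rewrite PD.
  by apply: filterS => k [].
Qed.
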